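(* Let $Y$ be a completely metrizable space. The following are equivalent: (i) $Y$ is connected and locally arcwise connected; (ii) $\mathrm{K}_1(X,Y)\cap\Sigma^f(X,Y)=\mathrm{B}_1(X,Y)$ for every topological space $X$; (iii) $\mathrm{H}_1([0,1],Y)=\mathrm{B}_1([0,1],Y)$.
   Context: Functionally closed/open sets: zero sets of continuous functions $X\to[0,1]$, resp. their complements; functionally $F_\sigma$: countable union of functionally closed sets. $\mathrm{H}_1(X,Y)$: mappings $f:X\to Y$ with $f^{-1}(V)$ an $F_\sigma$-set for every open $V\subseteq Y$. $\mathrm{K}_1(X,Y)$: mappings with $f^{-1}(V)$ functionally $F_\sigma$ for every open $V\subseteq Y$. A family $(A_i:i\in I)$ of subsets of $X$ is strongly functionally discrete (sfd) if there is a discrete family $(U_i:i\in I)$ of functionally open sets with $\overline{A_i}\subseteq U_i$ for all $i$; $\sigma$-sfd: countable union of sfd families. A family $\mathcal B$ is a base for $f$ if each $f^{-1}(V)$, $V$ open, is a union of members of $\mathcal B$. $\Sigma^f(X,Y)$: mappings having a $\sigma$-sfd base. $\mathrm{B}_1(X,Y)$: pointwise limits of sequences of continuous mappings $X\to Y$. *)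

(* Defs.v *)
From Stdlib Require Import Reals Lra.
Open Scope R_scope.
Set Implicit Arguments.

Record TopSpace := {
  carrier :> Type;
  is_open : (carrier -> Prop) -> Prop;
  open_full : is_open (fun _ => True);
  open_inter : forall U V, is_open U -> is_open V -> is_open (fun x => U x /\ V x);
  open_union : forall F : (carrier -> Prop) -> Prop,
      (forall U, F U -> is_open U) -> is_open (fun x => exists U, F U /\ U x)
}.
Arguments is_open {t} _.

Definition metric_open {T : Type} (d : T -> T -> R) (U : T -> Prop) : Prop :=
  forall x, U x -> exists eps, 0 < eps /\ forall y, d x y < eps -> U y.

Lemma metric_open_full {T : Type} (d : T -> T -> R) : metric_open d (fun _ => True).
Proof. intros x _; exists 1; split; [lra| auto]. Qed.

Lemma metric_open_inter {T : Type} (d : T -> T -> R) U V :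
  metric_open d U -> metric_open d V -> metric_open d (fun x => U x /\ V x).
Proof.
  intros HU HV x [Ux Vx].
  destruct (HU x Ux) as [e1 [He1 Hclass1]]; destruct (HV x Vx) as [e2 [He2 H2]].
  exists (Rmin e1 e2); split; [now apply Rmin_pos|].
  intros y Hy; split; [apply Hclass1 | apply H2];
    [apply Rlt_le_trans with (1 := Hy); apply Rmin_l
    |apply Rlt_le_trans with (1 := Hy); apply Rmin_r].
Qed.

Lemma metric_open_union {T : Type} (d : T -> T -> R) (F : (T -> Prop) -> Prop) :
  (forall U, F U -> metric_open d U) -> metric_open d (fun x => exists U, F U /\ U x).
Proof.
  intros HF x [U [FU Ux]]. destruct (HF U FU x Ux) as [e [He H]].
  exists e; split; auto. intros y Hy; exists U; auto.
Qed.

Definition unit_interval := { x : R | 0 <= x <= 1 }.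
Definition I01_dist (x y : unit_interval) : R := Rabs (proj1_sig x - proj1_sig y).

Definition I01 : TopSpace :=
  {| carrier := unit_interval;
     is_open := metric_open I01_dist;
     open_full := metric_open_full I01_dist;
     open_inter := @metric_open_inter _ I01_dist;
     open_union := @metric_open_union _ I01_dist |}.

Definition I01_zero : I01 := exist _ 0 (conj (Rle_refl 0) Rle_0_1).
Definition I01_one : I01 := exist _ 1 (conj Rle_0_1 (Rle_refl 1)).

Section Topology.
Context {X Y : TopSpace}.

Definition continuous (f : X -> Y) : Prop :=
  forall V, is_open V -> is_open (fun x => V (f x)).

End Topology.

Section Sets.
Context {X : TopSpace}.

Definition is_closed (F : X -> Prop) : Prop := is_open (fun x => ~ F x).

Definition closure (A : X -> Prop) : X -> Prop :=
  fun x => forall U, is_open U -> U x -> exists y, U y /\ A y.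

Definition functionally_closed (F : X -> Prop) : Prop :=
  exists g : X -> I01, continuous g /\ forall x, F x <-> proj1_sig (g x) = 0.

Definition functionally_open (U : X -> Prop) : Prop :=
  functionally_closed (fun x => ~ U x).

Definition F_sigma (A : X -> Prop) : Prop :=
  exists Fn : nat -> X -> Prop,
    (forall n, is_closed (Fn n)) /\ forall x, A x <-> exists n, Fn n x.

Definition functionally_F_sigma (A : X -> Prop) : Prop :=
  exists Fn : nat -> X -> Prop,
    (forall n, functionally_closed (Fn n)) /\ forall x, A x <-> exists n, Fn n x.

Definition discrete_family {I : Type} (U : I -> X -> Prop) : Prop :=
  forall x, exists W, is_open W /\ W x /\
    forall i j, (exists y, W y /\ U i y) -> (exists y, W y /\ U j y) -> i = j.

Definition sfd {I : Type} (A : I -> X -> Prop) : Prop :=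
  exists U : I -> X -> Prop,
    discrete_family U /\ (forall i, functionally_open (U i)) /\
    forall i x, closure (A i) x -> U i x.

End Sets.

Section Classes.
Context {X Y : TopSpace}.

Definition Hclass1 (f : X -> Y) : Prop :=
  forall V : Y -> Prop, is_open V -> F_sigma (fun x => V (f x)).

Definition Kclass1 (f : X -> Y) : Prop :=
  forall V : Y -> Prop, is_open V -> functionally_F_sigma (fun x => V (f x)).

(** Sigma^f(X,Y): f has a sigma-sfd base.  The sigma-sfd family is the union of
    countably many sfd families (A n i)_{i in I n}; it is a base for f when each
    preimage f^{-1}(V), V open, is the union of some subfamily of its members. *)
Definition Sigma_f (f : X -> Y) : Prop :=
  exists (I : nat -> Type) (A : forall n, I n -> X -> Prop),
    (forall n, sfd (A n)) /\
    forall V : Y -> Prop, is_open V ->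
      exists S : forall n, I n -> Prop,
        forall x, V (f x) <-> exists n i, S n i /\ A n i x.

Definition Baire1 (f : X -> Y) : Prop :=
  exists fn : nat -> X -> Y,
    (forall n, continuous (fn n)) /\
    forall x V, is_open V -> V (f x) -> exists N, forall n, (N <= n)%nat -> V (fn n x).

End Classes.

Section SpaceProps.
Context {Y : TopSpace}.

Definition completely_metrizable : Prop :=
  exists d : Y -> Y -> R,
    (forall x y, 0 <= d x y) /\
    (forall x y, d x y = 0 <-> x = y) /\
    (forall x y, d x y = d y x) /\
    (forall x y z, d x z <= d x y + d y z) /\
    (forall U, is_open U <-> metric_open d U) /\
    (forall u : nat -> Y,
        (forall eps, 0 < eps -> exists N, forall m n, (N <= m)%nat -> (N <= n)%nat ->
                      d (u m) (u n) < eps) ->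
        exists l, forall eps, 0 < eps -> exists N, forall n, (N <= n)%nat -> d (u n) l < eps).

Definition connected : Prop :=
  ~ exists U V : Y -> Prop, is_open U /\ is_open V /\
      (exists x, U x) /\ (exists x, V x) /\
      (forall x, U x \/ V x) /\ (forall x, ~ (U x /\ V x)).

Definition is_arc (g : I01 -> Y) : Prop :=
  continuous g /\ (forall s t, g s = g t -> s = t) /\
  forall U : I01 -> Prop, is_open U ->
    exists W : Y -> Prop, is_open W /\ forall t, (exists s, U s /\ g s = g t) <-> W (g t).

Definition arcwise_connected_set (V : Y -> Prop) : Prop :=
  forall a b, V a -> V b -> a <> b ->
    exists g : I01 -> Y, is_arc g /\ g I01_zero = a /\ g I01_one = b /\ forall t, V (g t).

Definition locally_arcwise_connected : Prop :=
  forall x U, is_open U -> U x ->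
    exists V, is_open V /\ V x /\ (forall y, V y -> U y) /\ arcwise_connected_set V.

End SpaceProps.
Arguments completely_metrizable : clear implicits.
Arguments connected : clear implicits.
Arguments locally_arcwise_connected : clear implicits.

(* Main.v *)
Require Import Defs.
From Stdlib Require Import Reals Lra Lia Arith ZArith Classical ClassicalEpsilon
  FunctionalExtensionality PropExtensionality Cantor.
From mathcomp Require boot.eqtype boot.ssrbool classical.boolp classical.wochoice.
Open Scope R_scope.

(* The implications (i) => (ii) => (iii) => (i) hold for the following reasons.

   (i) => (ii).  If f is in K_1 with a sigma-sfd base, then for every eps the space X is a
   countable union of discrete families of functionally closed sets, on each of which f maps
   into a path-connected open set of radius eps.  For fixed k one shrinks finitely many of these
   families so that together they are discrete, with bump functions around them.  The k-th
   continuous approximation starts from a constant map and, for eps = 1, 1/2, 1/4, ..., is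
   modified near these sets by moving its value along paths inside the union of two consecutive
   small sets, so the modifications are summable.  Conversely, if f = lim f_n with f_n
   continuous, preimages under f of the members of a sigma-discrete base of Y (Stone) are
   countable unions of sets that are closed and deep in the f_N-preimage of that member.

   (ii) => (iii).  On [0,1] closed sets are functionally closed, and an H_1 function on [0,1]
   has a separable range, hence a countable base.

   (iii) => (i).  A two-valued function gives connectedness.  A function equal to c off the
   rationals, with values y_n -> c on them, is in H_1; being a limit of continuous functions it
   yields, inside a small ball, paths from arbitrarily near y_n to arbitrarily near c.
   Completeness turns such almost joining paths into honest ones, by filling gaps recursively,
   and every path contains an arc. *)

(** * Continuity into metric spaces *)

(** A general X offers no normality and no extension theorem, so every neighbourhood in (i) => (ii)
    is the positivity set of a continuous function: the base supplies the discrete ones, K_1 the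
    zero sets inside preimages. Values in Y cannot be added or averaged. A map can therefore be
    changed continuously only where it is constant before the change, and each stage must hand such
    regions to the next one, giving up a collar of every bump each time. In (iii) => (i) pointwise
    convergence controls an approximant at two chosen points only up to an error, so its paths end
    near [c] and near [y_n], never exactly there. This leaves gaps, and a gap can be filled only by
    further paths of the same kind. Excising loops from a path still leaves intervals on which it is
    constant. They are collapsed by a monotone function that is constant exactly where the path is,
    and the continuity of the quotient then rests on compactness of [0,1], used as the intersection
    property of nested closed sets. *)

Lemma open_ext {X : TopSpace} (A B : X -> Prop) :
  (forall x, A x <-> B x) -> is_open A -> is_open B.
Proof.
  intros H HA. replace B with A; [exact HA|].
  extensionality x. apply propositional_extensionality, H.
Qed.

Lemma open_of_nbhds {X : TopSpace} (A : X -> Prop) :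
  (forall x, A x -> exists W, is_open W /\ W x /\ forall y, W y -> A y) -> is_open A.
Proof.
  intros H.
  apply open_ext with
    (fun x => exists U, (is_open U /\ forall y, U y -> A y) /\ U x).
  - intros x; split.
    + intros [U [[_ HU] Ux]]; auto.
    + intros Ax. destruct (H x Ax) as [W [? [? ?]]]. exists W; auto.
  - apply open_union. intros U [HU _]; exact HU.
Qed.

Lemma open_const {X : TopSpace} (P : Prop) : is_open (fun _ : X => P).
Proof.
  apply open_of_nbhds. intros x p. exists (fun _ => True).
  split; [apply open_full|auto].
Qed.

(** [Q n] is inherited by smaller neighbourhoods, so a finite intersection settles all [n < N] at
    once. *)
Lemma nbhd_forall_lt {X : TopSpace} (x : X) (Q : nat -> (X -> Prop) -> Prop) (N : nat) :
  (forall n W W', (forall y, W' y -> W y) -> Q n W -> Q n W') ->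
  (forall n, (n < N)%nat -> exists W, is_open W /\ W x /\ Q n W) ->
  exists W, is_open W /\ W x /\ forall n, (n < N)%nat -> Q n W.
Proof.
  intros Hm. induction N as [|N IH]; intros H.
  - exists (fun _ => True). split; [apply open_full|split;[auto|lia]].
  - destruct IH as [W [oW [Wx HW]]]; [intros; apply H; lia|].
    destruct (H N) as [W' [oW' [Wx' HW']]]; [lia|].
    exists (fun y => W y /\ W' y). split; [now apply open_inter|split;[auto|]].
    intros n Hn. destruct (Nat.eq_dec n N) as [->|ne].
    + apply Hm with W'; [tauto|auto].
    + apply Hm with W; [tauto|apply HW; lia].
Qed.

Record metric {T : Type} (d : T -> T -> R) : Prop := {
  metric_ge0 : forall x y, 0 <= d x y;
  metric_eq0 : forall x y, d x y = 0 -> x = y;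
  metric_refl : forall x, d x x = 0;
  metric_sym : forall x y, d x y = d y x;
  metric_tri : forall x y z, d x z <= d x y + d y z }.

Arguments metric_ge0 {T d} _ _ _.
Arguments metric_eq0 {T d} _ _ _ _.
Arguments metric_refl {T d} _ _.
Arguments metric_sym {T d} _ _ _.
Arguments metric_tri {T d} _ _ _ _.

Definition Rd (a b : R) : R := Rabs (a - b).

Lemma Rd_metric : metric Rd.
Proof.
  unfold Rd; split; intros.
  - apply Rabs_pos.
  - destruct (Req_dec (x - y) 0); [lra|]. apply Rabs_no_R0 in H0. lra.
  - rewrite Rminus_diag. apply Rabs_R0.
  - apply Rabs_minus_sym.
  - replace (x - z) with ((x - y) + (y - z)) by ring. apply Rabs_triang.
Qed.

Lemma Rd_lt a b e : Rd a b < e <-> a - e < b < a + e.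
Proof.
  unfold Rd; split; intros H.
  - apply Rabs_def2 in H. lra.
  - apply Rabs_def1; lra.
Qed.

Lemma Rd_le a b e : Rd a b <= e <-> a - e <= b <= a + e.
Proof.
  unfold Rd, Rabs; destruct (Rcase_abs (a - b)); split; lra.
Qed.

Definition RT : TopSpace :=
  {| carrier := R; is_open := metric_open Rd;
     open_full := metric_open_full Rd;
     open_inter := @metric_open_inter _ Rd;
     open_union := @metric_open_union _ Rd |}.

Lemma I01_metric : metric I01_dist.
Proof.
  pose proof Rd_metric as [A B C D E]. unfold I01_dist.
  split; intros.
  - apply A.
  - apply B in H. destruct x as [x hx], y as [y hy]; simpl in H. subst y.
    f_equal. apply proof_irrelevance.
  - apply C.
  - apply D.
  - apply E.
Qed.

Definition mcont {X : TopSpace} {T : Type} (d : T -> T -> R) (g : X -> T) : Prop :=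
  forall x e, 0 < e -> exists W, is_open W /\ W x /\ forall y, W y -> d (g x) (g y) < e.

Definition mcontinuous {S T : Type} (dS : S -> S -> R) (d : T -> T -> R) (g : S -> T) :=
  forall x e, 0 < e -> exists r, 0 < r /\ forall y, dS x y < r -> d (g x) (g y) < e.

Section Metric.
Context {T : Type} {d : T -> T -> R}.
Context (M : metric d).

Lemma ball_open c r : metric_open d (fun y => d c y < r).
Proof.
  intros x Hx. exists (r - d c x). split; [lra|]. intros y Hy.
  pose proof (metric_tri M c x y). lra.
Qed.

Lemma mcont_preimage {X : TopSpace} (g : X -> T) (V : T -> Prop) :
  mcont d g -> metric_open d V -> is_open (fun x => V (g x)).
Proof.
  intros Hg HV. apply open_of_nbhds. intros x Vx.
  destruct (HV _ Vx) as [e [He H]]. destruct (Hg x e He) as [W [oW [Wx HW]]].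
  exists W; auto.
Qed.

Lemma continuous_mcont {X Y : TopSpace} {dY : Y -> Y -> R} (g : X -> Y) :
  metric dY -> (forall U : Y -> Prop, is_open U <-> metric_open dY U) ->
  continuous g <-> mcont dY g.
Proof.
  intros MY HO; split; intros H.
  - intros x e He. exists (fun y => dY (g x) (g y) < e).
    split; [|split].
    + apply (H (fun z => dY (g x) z < e)). apply HO. intros z Hz.
      exists (e - dY (g x) z). split; [lra|]. intros y Hy.
      pose proof (metric_tri MY (g x) z y). lra.
    + rewrite (metric_refl MY); lra.
    + auto.
  - intros V oV. apply HO in oV. apply open_of_nbhds. intros x Vx.
    destruct (oV _ Vx) as [e [He H']]. destruct (H x e He) as [W [oW [Wx HW]]].
    exists W; auto.
Qed.

Lemma mcont_comp {X : TopSpace} {S : Type} {dS : S -> S -> R} (g : X -> S) (h : S -> T) :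
  mcont dS g -> mcontinuous dS d h -> mcont d (fun x => h (g x)).
Proof.
  intros Hg Hh x e He. destruct (Hh (g x) e He) as [r [Hr H]].
  destruct (Hg x r Hr) as [W [oW [Wx HW]]]. exists W; auto.
Qed.

Lemma mcont_local {X : TopSpace} (g : X -> T) :
  (forall x, exists W h, is_open W /\ W x /\ mcont d h /\ forall y, W y -> g y = h y) ->
  mcont d g.
Proof.
  intros H x e He. destruct (H x) as [W [h [oW [Wx [Hh Hg]]]]].
  destruct (Hh x e He) as [W' [oW' [Wx' HW']]].
  exists (fun y => W y /\ W' y). split; [now apply open_inter|split;[auto|]].
  intros y [Wy Wy']. rewrite !Hg; auto.
Qed.

Lemma mcont_const {X : TopSpace} (c : T) : mcont d (fun _ : X => c).
Proof.
  intros x e He. exists (fun _ => True). split; [apply open_full|split;[auto|]].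
  intros. rewrite (metric_refl M); auto.
Qed.
End Metric.

Lemma RT_mcont {T : Type} {d : T -> T -> R} (g : R -> T) :
  @mcont RT T d g <-> mcontinuous Rd d g.
Proof.
  split; intros H x e He.
  - destruct (H x e He) as [W [oW [Wx HW]]].
    destruct (oW x Wx) as [r [Hr H']]. exists r; auto.
  - destruct (H x e He) as [r [Hr H']].
    exists (fun y => Rd x y < r). split; [exact (ball_open Rd_metric x r)|].
    split; [rewrite (metric_refl Rd_metric); lra|auto].
Qed.

Notation rcont := (mcont Rd).

Lemma rcont2 {X : TopSpace} (g h : X -> R) (op : R -> R -> R) :
  (forall a b e, 0 < e -> exists r, 0 < r /\
     forall a' b', Rd a a' < r -> Rd b b' < r -> Rd (op a b) (op a' b') < e) ->
  rcont g -> rcont h -> rcont (fun x => op (g x) (h x)).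
Proof.
  intros Hop Hg Hh x e He. destruct (Hop (g x) (h x) e He) as [r [Hr H]].
  destruct (Hg x r Hr) as [W [oW [Wx HW]]]. destruct (Hh x r Hr) as [W' [oW' [Wx' HW']]].
  exists (fun y => W y /\ W' y). split; [now apply open_inter|split;[auto|]].
  intros y [? ?]; auto.
Qed.

Lemma rcont_plus {X : TopSpace} (g h : X -> R) :
  rcont g -> rcont h -> rcont (fun x => g x + h x).
Proof.
  apply rcont2. intros a b e He. exists (e/2). split; [lra|].
  intros a' b'. rewrite !Rd_lt. lra.
Qed.

Lemma rcont_min {X : TopSpace} (g h : X -> R) :
  rcont g -> rcont h -> rcont (fun x => Rmin (g x) (h x)).
Proof.
  apply rcont2. intros a b e He. exists e. split; [lra|].
  intros a' b'. rewrite !Rd_lt. unfold Rmin. repeat destruct Rle_dec; lra.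
Qed.

Lemma rcont_max {X : TopSpace} (g h : X -> R) :
  rcont g -> rcont h -> rcont (fun x => Rmax (g x) (h x)).
Proof.
  apply rcont2. intros a b e He. exists e. split; [lra|].
  intros a' b'. rewrite !Rd_lt. unfold Rmax. repeat destruct Rle_dec; lra.
Qed.

Lemma rcont_affine {X : TopSpace} (g : X -> R) a b :
  rcont g -> rcont (fun x => a * g x + b).
Proof.
  intros Hg x e He. destruct (Hg x (e / (Rabs a + 1))) as [W [oW [Wx HW]]].
  - apply Rdiv_lt_0_compat; auto. pose proof (Rabs_pos a); lra.
  - exists W. split; auto. split; auto. intros y Wy. specialize (HW y Wy).
    pose proof (Rabs_pos a). unfold Rd in *.
    replace (a * g x + b - (a * g y + b)) with (a * (g x - g y)) by ring.
    rewrite Rabs_mult. pose proof (Rabs_pos (g x - g y)).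
    apply Rle_lt_trans with ((Rabs a + 1) * Rabs (g x - g y)); [nra|].
    apply Rmult_lt_compat_l with (r := Rabs a + 1) in HW; [|lra].
    replace ((Rabs a + 1) * (e / (Rabs a + 1))) with e in HW by (field; lra). exact HW.
Qed.

Lemma rcont_ext {X : TopSpace} (g h : X -> R) :
  (forall x, g x = h x) -> rcont g -> rcont h.
Proof. intros H Hg x e He. destruct (Hg x e He) as [W HW]. exists W. now rewrite <- H; setoid_rewrite <- H. Qed.

Lemma rcont_div {X : TopSpace} (g h : X -> R) :
  (forall x, 0 < h x) -> rcont g -> rcont h -> rcont (fun x => g x / h x).
Proof.
  intros Hpos Hg Hh x e He.
  pose proof (Hpos x) as hx. set (b := h x) in *. set (a := g x) in *.
  (* [r <= b / 2] keeps the new denominator above [b / 2], so the product of the denominators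
     exceeds [b * b / 2]; the last bound controls the numerator, which is at most
     [r * (b + Rabs a)]. *)
  assert (exists r, 0 < r /\ r <= b / 2 /\ r * (b + Rabs a) < e * (b * b / 2)) as [r [Hr [Hr2 Hr3]]].
  { pose proof (Rabs_pos a).
    assert (0 < e * (b * b / 2)) as Hp by (apply Rmult_lt_0_compat; nra).
    exists (Rmin (b/2) (e * (b * b / 2) / (2 * (b + Rabs a)))).
    split; [apply Rmin_pos; [lra|apply Rdiv_lt_0_compat; lra]|].
    split; [apply Rmin_l|].
    apply Rle_lt_trans with ((e * (b * b / 2) / (2 * (b + Rabs a))) * (b + Rabs a)).
    - apply Rmult_le_compat_r; [lra|apply Rmin_r].
    - replace (e * (b * b / 2) / (2 * (b + Rabs a)) * (b + Rabs a)) with (e * (b*b/2) / 2)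
        by (field; lra). lra. }
  destruct (Hg x r Hr) as [W [oW [Wx HW]]]. destruct (Hh x r Hr) as [W' [oW' [Wx' HW']]].
  exists (fun y => W y /\ W' y). split; [now apply open_inter|split;[auto|]].
  intros y [Wy Wy']. specialize (HW y Wy); specialize (HW' y Wy').
  fold a in HW; fold b in HW'. fold a; fold b.
  set (a' := g y) in *. set (b' := h y) in *.
  assert (b / 2 < b') by (apply Rd_lt in HW'; lra).
  unfold Rd in *.
  replace (a / b - a' / b') with (((a - a') * b - a * (b - b')) / (b * b')) by (field; lra).
  unfold Rdiv. rewrite Rabs_mult, Rabs_inv.
  rewrite (Rabs_right (b * b')); [|nra].
  apply Rmult_lt_reg_r with (b * b'); [nra|].
  rewrite Rmult_assoc, Rinv_l, Rmult_1_r; [|nra].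
  apply Rle_lt_trans with (Rabs (a - a') * b + Rabs a * Rabs (b - b')).
  - eapply Rle_trans; [apply Rabs_triang|]. rewrite Rabs_Ropp, !Rabs_mult, (Rabs_right b); lra.
  - pose proof (Rabs_pos a). apply Rle_lt_trans with (r * (b + Rabs a)); [nra|].
    apply Rlt_le_trans with (1 := Hr3). apply Rmult_le_compat_l; [lra|nra].
Qed.

(** * Weighted sums of functions *)

Definition wpartial (u : nat -> R) (n : nat) : R :=
  sum_f_R0 (fun i => u i * (/2)^(S i)) n.

Lemma wpartial_S u n : wpartial u (S n) = wpartial u n + u (S n) * (/2)^(S (S n)).
Proof. reflexivity. Qed.

Lemma half_pow_pos n : 0 < (/2)^n.
Proof. apply pow_lt; lra. Qed.

Lemma half_pow_small e : 0 < e -> exists N, forall n, (N <= n)%nat -> (/2)^n < e.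
Proof.
  intros He. destruct (pow_lt_1_zero (/2)) with e as [N HN]; [rewrite Rabs_right; lra|lra|].
  exists N. intros n Hn. specialize (HN n Hn). rewrite Rabs_right in HN; auto.
  left; apply half_pow_pos.
Qed.

Lemma inv_INR_small e : 0 < e -> exists N, forall n, (N <= n)%nat -> / (INR n + 1) < e.
Proof.
  intros He. destruct (archimed_cor1 e He) as [N [H1 H2]]. exists N. intros n Hn.
  apply Rlt_trans with (2 := H1). apply Rinv_lt_contravar.
  - apply Rmult_lt_0_compat; [apply lt_0_INR; lia|pose proof (pos_INR n); lra].
  - apply le_INR in Hn. lra.
Qed.

Lemma wpartial_le u n m : (forall i, 0 <= u i <= 1) -> (n <= m)%nat ->
  wpartial u n <= wpartial u m <= wpartial u n + (/2)^(S n) - (/2)^(S m).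
Proof.
  intros Hu. induction 1 as [|m Hm IH].
  - lra.
  - rewrite wpartial_S. pose proof (half_pow_pos (S (S m))).
    specialize (Hu (S m)). simpl (_ ^ S (S m)) in *. simpl (_ ^ S m) in *. nra.
Qed.

(** The bounds on [u] stand under the existential, so that [wsum] becomes a total function. *)
Lemma wsum_exists u : exists l, (forall i, 0 <= u i <= 1) ->
  forall n, wpartial u n <= l <= wpartial u n + (/2)^(S n).
Proof.
  destruct (classic (forall i, 0 <= u i <= 1)) as [Hu|]; [|exists 0; tauto].
  destruct (completeness (fun r => exists n, r = wpartial u n)) as [l [H1 H2]].
  - exists (wpartial u 0 + (/2)^1). intros r [n ->].
    destruct (wpartial_le u 0 n Hu) as [_ H]; [lia|]. pose proof (half_pow_pos (S n)). lra.
  - exists (wpartial u 0); eauto.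
  - exists l. intros _ n. split; [apply H1; eauto|].
    apply H2. intros r [m ->]. pose proof (half_pow_pos (S n)).
    destruct (Nat.le_ge_cases n m) as [H'|H'].
    + pose proof (wpartial_le u n m Hu H'). pose proof (half_pow_pos (S m)). lra.
    + pose proof (wpartial_le u m n Hu H'). lra.
Qed.

Definition wsum (u : nat -> R) : R := proj1_sig (constructive_indefinite_description _ (wsum_exists u)).

Lemma wsum_spec u : (forall i, 0 <= u i <= 1) ->
  forall n, wpartial u n <= wsum u <= wpartial u n + (/2)^(S n).
Proof. unfold wsum; destruct constructive_indefinite_description; auto. Qed.

Lemma wpartial_ge0 u n : (forall i, 0 <= u i <= 1) -> 0 <= wpartial u n.
Proof.
  intros Hu. apply cond_pos_sum. intros i. apply Rmult_le_pos; [apply Hu|].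
  left; apply half_pow_pos.
Qed.

Lemma wsum_bounds u : (forall i, 0 <= u i <= 1) -> 0 <= wsum u <= 1.
Proof.
  intros Hu. pose proof (wsum_spec u Hu 0) as [H1 H2].
  pose proof (wpartial_ge0 u 0 Hu). split; [lra|]. cbn in H2. specialize (Hu 0%nat). lra.
Qed.

Lemma wpartial_lt u v n j : (forall i, 0 <= u i <= 1) -> (forall i, 0 <= v i <= 1) ->
  (forall i, u i <= v i) -> (j <= n)%nat ->
  wpartial u n + (v j - u j) * (/2)^(S j) <= wpartial v n.
Proof.
  intros Hu Hv Huv Hj. induction Hj as [|n Hj IH].
  - destruct j as [|j].
    + cbn. lra.
    + rewrite !wpartial_S. assert (wpartial u j <= wpartial v j); [|lra].
      apply sum_Rle. intros i _. apply Rmult_le_compat_r; auto. left; apply half_pow_pos.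
  - rewrite !wpartial_S. pose proof (half_pow_pos (S (S n))). specialize (Huv (S n)). nra.
Qed.

(** Partial sums already show the gain in coordinate [j], and the tail can be made smaller than any
    deficit. The gain allows single coordinates to be read off from the sum, as in [wsum_eq0] and
    [progress_incr]. *)
Lemma wsum_mono u v j : (forall i, 0 <= u i <= 1) -> (forall i, 0 <= v i <= 1) ->
  (forall i, u i <= v i) -> wsum u + (v j - u j) * (/2)^(S j) <= wsum v.
Proof.
  intros Hu Hv Huv. apply Rnot_lt_le. intros H.
  destruct (half_pow_small (wsum u + (v j - u j) * (/2)^(S j) - wsum v)) as [N HN]; [lra|].
  set (n := Nat.max N j). specialize (HN (S n) ltac:(lia)).
  pose proof (wsum_spec u Hu n). pose proof (wsum_spec v Hv n).
  pose proof (wpartial_lt u v n j Hu Hv Huv ltac:(lia)). lra.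
Qed.

Lemma wsum_eq0 u : (forall i, 0 <= u i <= 1) -> (wsum u = 0 <-> forall i, u i = 0).
Proof.
  intros Hu; split.
  - intros H i. pose proof (wsum_mono (fun _ => 0) u i ltac:(intros; lra) Hu ltac:(intros; apply Hu)).
    pose proof (wsum_bounds (fun _ => 0) ltac:(intros; lra)).
    pose proof (half_pow_pos (S i)). specialize (Hu i). nra.
  - intros H. destruct (wsum_bounds u Hu) as [H1 _]. apply Rle_antisym; auto.
    apply Rnot_lt_le. intros H2. destruct (half_pow_small _ H2) as [N HN].
    specialize (HN (S N) ltac:(lia)). pose proof (wsum_spec u Hu N).
    assert (wpartial u N = 0); [|lra]. apply sum_eq_R0. intros. rewrite H; lra.
Qed.

Lemma rcont_wpartial {X : TopSpace} (g : nat -> X -> R) n :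
  (forall i, rcont (g i)) -> rcont (fun x => wpartial (fun i => g i x) n).
Proof.
  intros Hg. induction n.
  - apply rcont_ext with (fun x => (/2)^1 * g 0%nat x + 0); [intros; cbn; lra|].
    apply rcont_affine; auto.
  - apply rcont_ext with (fun x => wpartial (fun i => g i x) n + ((/2)^(S (S n)) * g (S n) x + 0)).
    + intros. rewrite wpartial_S. ring.
    + apply rcont_plus; auto. apply rcont_affine; auto.
Qed.

Lemma rcont_wsum {X : TopSpace} (g : nat -> X -> R) :
  (forall i, rcont (g i)) -> (forall i x, 0 <= g i x <= 1) ->
  rcont (fun x => wsum (fun i => g i x)).
Proof.
  intros Hg Hb x e He. destruct (half_pow_small (e/2)) as [N HN]; [lra|].
  specialize (HN (S N) ltac:(lia)).
  destruct (rcont_wpartial g N Hg x (e/2)) as [W [oW [Wx HW]]]; [lra|].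
  exists W. split; auto. split; auto. intros y Wy. specialize (HW y Wy).
  pose proof (wsum_spec (fun i => g i x) (fun i => Hb i x) N).
  pose proof (wsum_spec (fun i => g i y) (fun i => Hb i y) N).
  apply Rd_lt in HW. apply Rd_lt. cbn beta in *. lra.
Qed.

(** * Functionally closed sets and Stone's theorem *)

(** In Stone's construction the minimum picks the first ball containing a point, and trichotomy
    separates two different centres. *)
Lemma well_order_exists (T : Type) : exists lt : T -> T -> Prop,
  (forall x y, lt x y \/ x = y \/ lt y x) /\
  forall P : T -> Prop, (exists x, P x) -> exists x, P x /\ forall y, P y -> ~ lt y x.
Proof.
  destruct (wochoice.well_ordering_principle
    (eqtype.Equality.Pack (eqtype.Equality.Class (boolp.gen_eqMixin T)))) as [R HR].
  simpl in R.
  assert (Hmin : forall P : T -> Prop, (exists x, P x) ->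
    exists z, (P z /\ forall y, P y -> R z y = true) /\
      forall z', P z' -> (forall y, P y -> R z' y = true) -> z = z').
  { intros P [x Px].
    destruct (HR (fun y => boolp.asbool (P y))) as [z [[Hz Hl] Hu]].
    { exists x. exact (ssrbool.introT (boolp.asboolP _) Px). }
    exists z. split; [split|].
    - exact (ssrbool.elimT (boolp.asboolP _) Hz).
    - intros y Py. apply (Hl y). exact (ssrbool.introT (boolp.asboolP _) Py).
    - intros z' Pz' Hz'. apply Hu. split.
      + exact (ssrbool.introT (boolp.asboolP _) Pz').
      + intros y Py. apply Hz'. exact (ssrbool.elimT (boolp.asboolP _) Py). }
  exists (fun x y => R y x = false). split.
  - intros x y. destruct (Hmin (fun z => z = x \/ z = y)) as [z [[[->| ->] H1] H2]]; [eauto| |].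
    + destruct (R y x) eqn:E; auto. right; left. apply H2; [auto|].
      intros w [->| ->]; auto. destruct (Hmin (fun z => z = y)) as [z [[-> H3] _]]; eauto.
    + destruct (R x y) eqn:E; auto. right; left. symmetry. apply H2; [auto|].
      intros w [->| ->]; auto. destruct (Hmin (fun z => z = x)) as [z [[-> H3] _]]; eauto.
  - intros P HP. destruct (Hmin P HP) as [z [[Pz H1] _]]. exists z. split; auto.
    intros y Py E. rewrite (H1 y Py) in E. discriminate.
Qed.

Section BoundedDistance.
Context {T : Type} {d : T -> T -> R} (M : metric d).

(* [min 1 (d y A)], with value 1 when [A] is empty. *)
Lemma bdist_exists (A : T -> Prop) (y : T) :
  exists l, is_lub (fun r => 0 <= r <= 1 /\ forall a, A a -> r <= d y a) l.
Proof.
  destruct (completeness (fun r => 0 <= r <= 1 /\ forall a, A a -> r <= d y a)) as [l Hl].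
  - exists 1. intros r Hr. lra.
  - exists 0. split; [lra|]. intros. apply (metric_ge0 M).
  - eauto.
Qed.

Definition bdist (A : T -> Prop) (y : T) : R :=
  proj1_sig (constructive_indefinite_description _ (bdist_exists A y)).

Lemma bdist_lub A y :
  is_lub (fun r => 0 <= r <= 1 /\ forall a, A a -> r <= d y a) (bdist A y).
Proof. unfold bdist; destruct constructive_indefinite_description; auto. Qed.

Lemma bdist_ge A y r : 0 <= r <= 1 -> (forall a, A a -> r <= d y a) -> r <= bdist A y.
Proof. intros. apply (bdist_lub A y). auto. Qed.

Lemma bdist_bounds A y : 0 <= bdist A y <= 1.
Proof.
  split.
  - apply bdist_ge; [lra|]. intros. apply (metric_ge0 M).
  - apply (bdist_lub A y). intros r Hr; lra.
Qed.

Lemma bdist_le A y a : A a -> bdist A y <= d y a.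
Proof. intros Aa. apply (bdist_lub A y). intros r [_ Hr]; auto. Qed.

Lemma bdist_in A y : A y -> bdist A y = 0.
Proof.
  intros Ay. pose proof (bdist_bounds A y). pose proof (bdist_le A y y Ay).
  rewrite (metric_refl M) in *. lra.
Qed.

Lemma bdist_lip A y z : bdist A y <= bdist A z + d y z.
Proof.
  apply (bdist_lub A y). intros r [Hr H].
  assert (r - d y z <= bdist A z); [|lra].
  destruct (Rle_dec (r - d y z) 0); [pose proof (bdist_bounds A z); lra|].
  pose proof (metric_ge0 M y z).
  apply bdist_ge; [lra|]. intros a Aa. pose proof (H a Aa). pose proof (metric_tri M y z a). lra.
Qed.

Lemma bdist_continuous A : mcontinuous d Rd (bdist A).
Proof.
  intros x e He. exists e. split; auto. intros y Hy. apply Rd_lt.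
  pose proof (bdist_lip A x y). pose proof (bdist_lip A y x). rewrite (metric_sym M y x) in *. lra.
Qed.

Lemma bdist_pos (V : T -> Prop) y : metric_open d V -> V y -> 0 < bdist (fun z => ~ V z) y.
Proof.
  intros HV Vy. destruct (HV y Vy) as [e [He H]].
  apply Rlt_le_trans with (Rmin e 1); [apply Rmin_pos; lra|].
  apply bdist_ge.
  - pose proof (Rmin_r e 1). split; [|auto]. apply Rmin_glb; lra.
  - intros a Ha. apply Rle_trans with e; [apply Rmin_l|].
    apply Rnot_lt_le. intros H'. apply Ha, H, H'.
Qed.

Lemma bdist_pos_in (V : T -> Prop) y : 0 < bdist (fun z => ~ V z) y -> V y.
Proof.
  intros H. apply NNPP. intros nV. rewrite (bdist_in (fun z => ~ V z) y) in H; auto. lra.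
Qed.

End BoundedDistance.

Definition clamp (r : R) : R := Rmax 0 (Rmin 1 r).

Lemma clamp_bounds r : 0 <= clamp r <= 1.
Proof. unfold clamp, Rmax, Rmin. repeat destruct Rle_dec; lra. Qed.

Lemma clamp_id r : 0 <= r <= 1 -> clamp r = r.
Proof. unfold clamp, Rmax, Rmin. repeat destruct Rle_dec; lra. Qed.

Definition clampI (r : R) : I01 := exist _ (clamp r) (clamp_bounds r).

Lemma clamp_lip a b : Rd (clamp a) (clamp b) <= Rd a b.
Proof.
  unfold Rd, clamp, Rmax, Rmin, Rabs.
  repeat (destruct Rle_dec || destruct Rcase_abs); lra.
Qed.

Lemma clampI_continuous : mcontinuous Rd I01_dist clampI.
Proof.
  intros x e He. exists e. split; auto. intros y Hy.
  apply Rle_lt_trans with (Rd x y); auto. apply clamp_lip.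
Qed.

Lemma clamp_continuous : mcontinuous Rd Rd clamp.
Proof. exact clampI_continuous. Qed.

Lemma rcont_clamp {X : TopSpace} (g : X -> R) : rcont g -> rcont (fun x => clamp (g x)).
Proof. intros Hg. exact (mcont_comp _ _ Hg clamp_continuous). Qed.

Lemma I01_open_iff : forall U : I01 -> Prop, is_open U <-> metric_open I01_dist U.
Proof. reflexivity. Qed.

Lemma functionally_closed_iff {X : TopSpace} (F : X -> Prop) :
  functionally_closed F <->
  exists g : X -> R, rcont g /\ (forall x, 0 <= g x <= 1) /\ forall x, F x <-> g x = 0.
Proof.
  split.
  - intros [g [Hg HF]]. exists (fun x => proj1_sig (g x)). split; [|split; auto].
    + intros x e He.
      apply (proj1 (continuous_mcont (Y := I01) (dY := I01_dist) g I01_metric I01_open_iff) Hg x e He).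
    + intros x. apply (proj2_sig (g x)).
  - intros [g [Hg [Hb HF]]]. exists (fun x => clampI (g x)). split.
    + apply (continuous_mcont (Y := I01) (dY := I01_dist) _ I01_metric I01_open_iff).
      exact (mcont_comp _ _ Hg clampI_continuous).
    + intros x. simpl. rewrite clamp_id; auto.
Qed.

Lemma functionally_open_iff {X : TopSpace} (U : X -> Prop) :
  functionally_open U <->
  exists g : X -> R, rcont g /\ (forall x, 0 <= g x <= 1) /\ forall x, U x <-> 0 < g x.
Proof.
  unfold functionally_open. rewrite functionally_closed_iff.
  split; intros [g [Hg [Hb H]]]; exists g; (split; [auto|split; [auto|]]); intros x;
    specialize (H x); specialize (Hb x).
  - split; intros H1.
    + apply Rnot_le_lt. intros H2. apply H; auto. lra.
    + apply NNPP. intros H2. apply H in H2. lra.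
  - rewrite H. split; lra.
Qed.

(** A weighted sum of nonnegative functions vanishes exactly where all of them do. *)
Lemma functionally_closed_inter {X : TopSpace} (F : nat -> X -> Prop) :
  (forall n, functionally_closed (F n)) -> functionally_closed (fun x => forall n, F n x).
Proof.
  intros HF.
  assert (H : forall n, exists g : X -> R,
    rcont g /\ (forall x, 0 <= g x <= 1) /\ forall x, F n x <-> g x = 0).
  { intros n. apply functionally_closed_iff, HF. }
  apply choice in H. destruct H as [g Hg].
  apply functionally_closed_iff. exists (fun x => wsum (fun n => g n x)).
  split; [|split].
  - apply rcont_wsum; intros; apply Hg.
  - intros x. apply wsum_bounds. intros; apply Hg.
  - intros x. rewrite wsum_eq0; [|intros; apply Hg].
    split; intros H n; apply Hg; auto.
Qed.

Lemma functionally_closed_closed {X : TopSpace} (F : X -> Prop) :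
  functionally_closed F -> is_closed F.
Proof.
  intros HF. apply functionally_closed_iff in HF. destruct HF as [g [Hg [Hb H]]].
  apply open_ext with (fun x => 0 < g x).
  - intros x. rewrite H. specialize (Hb x). split; lra.
  - apply (mcont_preimage (d := Rd) g (fun r => 0 < r) Hg).
    intros r Hr. exists r. split; auto. intros s Hs. apply Rd_lt in Hs. lra.
Qed.

(* A. H. Stone's construction: [E n y] is the (2^-n/3)-neighbourhood of the set of those
   points of the ball around [y], at depth at least 2^-n, which lie in no ball around a
   predecessor of [y] in a well-order. *)
Lemma stone_cover {T : Type} {d : T -> T -> R} (M : metric d) eps : 0 < eps ->
  exists E : nat -> T -> T -> Prop,
    (forall n y, metric_open d (E n y)) /\
    (forall n x, exists r, 0 < r /\ forall y z,
        (exists p, d x p < r /\ E n y p) -> (exists p, d x p < r /\ E n z p) -> y = z) /\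
    (forall x, exists n y, E n y x) /\
    (forall n y x, E n y x -> d y x < eps).
Proof.
  intros Heps. destruct (well_order_exists T) as [lt [Htot Hwf]].
  set (S := fun n y x => (forall p, d x p < (/2)^n -> d y p < eps) /\
                         forall z, lt z y -> ~ d z x < eps).
  assert (Hsep : forall n y z x x', S n y x -> S n z x' -> d x x' < (/2)^n -> y = z).
  { intros n y z x x' [H1 H2] [H1' H2'] Hd. destruct (Htot y z) as [H|[H|H]]; auto; exfalso.
    - apply (H2' y H). apply H1. auto.
    - apply (H2 z H). apply H1'. rewrite (metric_sym M); auto. }
  exists (fun n y x => exists p, S n y p /\ d p x < (/2)^n / 3).
  split; [|split; [|split]].
  - intros n y x [p [Sp Hp]]. exists ((/2)^n / 3 - d p x). split; [lra|].
    intros q Hq. exists p. split; auto. pose proof (metric_tri M p x q). lra.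
  (* If two sets meet this ball, their core points are closer than 1/3 + 1/6 + 1/6 + 1/3 = 1 times
     [(/2)^n], and [Hsep] identifies the indices. *)
  - intros n x. pose proof (half_pow_pos n). exists ((/2)^n / 6). split; [lra|].
    intros y z [p [Hp [q [Sq Hq]]]] [p' [Hp' [q' [Sq' Hq']]]].
    apply (Hsep n y z q q'); auto.
    pose proof (metric_tri M q p q'). pose proof (metric_tri M p x q').
    pose proof (metric_tri M x p' q'). rewrite (metric_sym M p x) in *.
    rewrite (metric_sym M p' q') in *. lra.
  (* The first ball containing [x], and a level at which [x] is deep enough in it; [x] is then its
     own core point. *)
  - intros x. destruct (Hwf (fun y => d y x < eps)) as [y [Hy Hmin]].
    { exists x. rewrite (metric_refl M); auto. }
    destruct (half_pow_small (eps - d y x)) as [n Hn]; [lra|].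
    exists n, y, x. split; [split|].
    + intros p Hp. specialize (Hn n ltac:(lia)). pose proof (metric_tri M y x p). lra.
    + intros z Hz H. exact (Hmin z H Hz).
    + rewrite (metric_refl M). pose proof (half_pow_pos n). lra.
  - intros n y x [p [[H1 _] H2]]. apply H1. pose proof (half_pow_pos n). lra.
Qed.

Lemma discrete_preimage {X : TopSpace} {T I : Type} {d : T -> T -> R} (M : metric d)
  (g : X -> T) (E : I -> T -> Prop) :
  mcont d g ->
  (forall x, exists r, 0 < r /\ forall y z,
    (exists p, d x p < r /\ E y p) -> (exists p, d x p < r /\ E z p) -> y = z) ->
  discrete_family (fun i x => E i (g x)).
Proof.
  intros Hg HE x. destruct (HE (g x)) as [r [Hr H]].
  destruct (Hg x r Hr) as [W [oW [Wx HW]]]. exists W. split; auto. split; auto.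
  intros i j [y [Wy Hi]] [z [Wz Hj]]. apply H; eauto.
Qed.

(** * Baire-one functions are in K_1 and have a sigma-sfd base *)

Section BaireOne.
Context {X Y : TopSpace} {d : Y -> Y -> R} (M : metric d)
  (HO : forall U : Y -> Prop, is_open U <-> metric_open d U).

Lemma Baire1_pointwise (f : X -> Y) :
  Baire1 f <-> exists fn : nat -> X -> Y, (forall n, mcont d (fn n)) /\
    forall x e, 0 < e -> exists N, forall n, (N <= n)%nat -> d (f x) (fn n x) < e.
Proof.
  split; intros [fn [Hc Hl]]; exists fn; split.
  - intros n. apply (continuous_mcont (dY := d) _ M HO). apply Hc.
  - intros x e He. apply (Hl x (fun y => d (f x) y < e)).
    + apply HO. exact (ball_open M (f x) e).
    + rewrite (metric_refl M); auto.
  - intros n. apply (continuous_mcont (dY := d) _ M HO). apply Hc.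
  - intros x V oV Vx. apply HO in oV. destruct (oV _ Vx) as [e [He H]].
    destruct (Hl x e He) as [N HN]. exists N. auto.
Qed.

Lemma deep_closed (h : X -> Y) (B : Y -> Prop) k : mcont d h ->
  functionally_closed (fun x => / (INR k + 1) <= bdist M (fun z => ~ B z) (h x)).
Proof.
  intros Hh. apply functionally_closed_iff.
  assert (0 < / (INR k + 1)) as Hk by (apply Rinv_0_lt_compat; pose proof (pos_INR k); lra).
  exists (fun x => clamp (-1 * bdist M (fun z => ~ B z) (h x) + / (INR k + 1))).
  split; [|split].
  - apply rcont_clamp, rcont_affine. exact (mcont_comp _ _ Hh (bdist_continuous M _)).
  - intros; apply clamp_bounds.
  - intros x. unfold clamp, Rmax, Rmin. repeat destruct Rle_dec; split; lra.
Qed.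

(** Eventual membership of [fn n x] in [B] would not put the limit into [B]. A depth bounded below
    does, because [bdist] is 1-Lipschitz. *)
Lemma limit_in_open (f : X -> Y) (fn : nat -> X -> Y) (B : Y -> Prop) x :
  metric_open d B ->
  (forall e, 0 < e -> exists N, forall n, (N <= n)%nat -> d (f x) (fn n x) < e) ->
  B (f x) <-> exists k N, forall n, (N <= n)%nat ->
     / (INR k + 1) <= bdist M (fun z => ~ B z) (fn n x).
Proof.
  intros HB Hl. split.
  - intros Bx. pose proof (bdist_pos M B _ HB Bx) as Hp.
    destruct (inv_INR_small (bdist M (fun z => ~ B z) (f x) / 2)) as [k Hk]; [lra|].
    specialize (Hk k ltac:(lia)). exists k.
    destruct (Hl (bdist M (fun z => ~ B z) (f x) / 2)) as [N HN]; [lra|].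
    exists N. intros n Hn. specialize (HN n Hn).
    pose proof (bdist_lip M (fun z => ~ B z) (f x) (fn n x)). lra.
  - intros [k [N H]]. apply (bdist_pos_in M).
    assert (0 < / (INR k + 1)) as Hk by (apply Rinv_0_lt_compat; pose proof (pos_INR k); lra).
    destruct (Hl _ Hk) as [N' HN'].
    specialize (HN' (Nat.max N N') ltac:(lia)). specialize (H (Nat.max N N') ltac:(lia)).
    pose proof (bdist_lip M (fun z => ~ B z) (fn (Nat.max N N') x) (f x)).
    rewrite (metric_sym M) in HN'. lra.
Qed.

Lemma Baire1_Kclass1 (f : X -> Y) : Baire1 f -> Kclass1 f.
Proof.
  intros Hf. apply Baire1_pointwise in Hf. destruct Hf as [fn [Hc Hl]].
  intros V oV. apply HO in oV.
  exists (fun m x => forall i, / (INR (fst (of_nat m)) + 1) <=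
      bdist M (fun z => ~ V z) (fn (snd (of_nat m) + i)%nat x)).
  split.
  - intros m. apply functionally_closed_inter. intros i. apply deep_closed, Hc.
  - intros x. rewrite (limit_in_open f fn V x oV (Hl x)). split.
    + intros [k [N H]]. exists (to_nat (k, N)). intros i. rewrite cancel_of_to. simpl.
      apply H. lia.
    + intros [m H]. exists (fst (of_nat m)), (snd (of_nat m)). intros n Hn.
      specialize (H (n - snd (of_nat m))%nat).
      replace (snd (of_nat m) + (n - snd (of_nat m)))%nat with n in H by lia. exact H.
Qed.

Lemma Baire1_Sigma_f (f : X -> Y) : Baire1 f -> Sigma_f f.
Proof.
  intros Hf. apply Baire1_pointwise in Hf. destruct Hf as [fn [Hc Hl]].
  assert (HE : forall m : nat, exists E : nat -> Y -> Y -> Prop,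
    (forall n y, metric_open d (E n y)) /\
    (forall n x, exists r, 0 < r /\ forall y z,
        (exists p, d x p < r /\ E n y p) -> (exists p, d x p < r /\ E n z p) -> y = z) /\
    (forall x, exists n y, E n y x) /\
    (forall n y x, E n y x -> d y x < / (INR m + 1))).
  { intros m. apply (stone_cover M). apply Rinv_0_lt_compat; pose proof (pos_INR m); lra. }
  apply choice in HE. destruct HE as [E HE].
  (* A family number [t] codes the Stone scale [a], the Stone level [b], the depth parameter [k] and
     the stage [N]. *)
  set (a := fun t => fst (of_nat (fst (of_nat t)))).
  set (b := fun t => snd (of_nat (fst (of_nat t)))).
  set (k := fun t => fst (of_nat (snd (of_nat t)))).
  set (N := fun t => snd (of_nat (snd (of_nat t)))).
  exists (fun _ => carrier Y), (fun t y x => forall n, (N t <= n)%nat ->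
     / (INR (k t) + 1) <= bdist M (fun z => ~ E (a t) (b t) y z) (fn n x)).
  assert (Hpos : forall k, 0 < / (INR k + 1)).
  { intros k'. apply Rinv_0_lt_compat; pose proof (pos_INR k'); lra. }
  split.
  (* The single continuous map [fn (N t)] provides the discrete functionally open neighbourhoods.
     Depth at stage [N t] is a closed condition, so it survives passing to the closure. *)
  - intros t. exists (fun y x => E (a t) (b t) y (fn (N t) x)). split; [|split].
    + apply (discrete_preimage M _ (E (a t) (b t))); [apply Hc|]. apply HE.
    + intros y. apply functionally_open_iff.
      exists (fun x => bdist M (fun z => ~ E (a t) (b t) y z) (fn (N t) x)).
      split; [|split].
      * exact (mcont_comp _ _ (Hc _) (bdist_continuous M _)).
      * intros; apply bdist_bounds.
      * intros x. split; [apply bdist_pos; apply HE|apply bdist_pos_in].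
    + intros y x Hx. apply (bdist_pos_in M). apply Rnot_le_lt. intros H0.
      set (B := fun z => ~ E (a t) (b t) y z) in *.
      destruct (Hx (fun z => ~ / (INR (k t) + 1) <= bdist M B (fn (N t) z))) as [z [Hz1 Hz2]].
      * apply functionally_closed_closed. apply deep_closed, Hc.
      * specialize (Hpos (k t)). lra.
      * apply Hz1, Hz2. lia.
  - intros V oV. exists (fun t y => forall z, E (a t) (b t) y z -> V z).
    intros x. split.
    + intros Vx. apply HO in oV. destruct (oV _ Vx) as [e [He H]].
      destruct (inv_INR_small (e/2)) as [m Hm]; [lra|]. specialize (Hm m ltac:(lia)).
      destruct (HE m) as [E1 [E2 [E3 E4]]]. destruct (E3 (f x)) as [n [y Hy]].
      pose proof (proj1 (limit_in_open f fn (E m n y) x (E1 n y) (Hl x)) Hy) as [k' [N' HN]].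
      exists (to_nat (to_nat (m, n), to_nat (k', N'))), y.
      unfold a, b, k, N. repeat (rewrite cancel_of_to; cbn [fst snd]).
      split; [|exact HN].
      intros z Hz. apply H. pose proof (E4 _ _ _ Hy). pose proof (E4 _ _ _ Hz).
      pose proof (metric_tri M (f x) y z). rewrite (metric_sym M (f x) y) in *. lra.
    + intros [t [y [H1 H2]]]. apply H1.
      apply (limit_in_open f fn _ x (proj1 (HE (a t)) (b t) y) (Hl x)). eauto.
Qed.

End BaireOne.

(** * Discrete levels of a function with a sigma-sfd base *)

(** Functional form of a strongly functionally discrete family: the sets to be separated are the
    cores where [phi j] is 1, and the positivity sets are their neighbourhoods. *)
Record bumps {X : TopSpace} {J : Type} (phi : J -> X -> R) : Prop := {
  bumps_cont : forall j, rcont (phi j);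
  bumps_bounds : forall j x, 0 <= phi j x <= 1;
  bumps_discrete : discrete_family (fun j x => 0 < phi j x) }.
Arguments bumps_cont {X J phi} _ _.
Arguments bumps_bounds {X J phi} _ _ _.
Arguments bumps_discrete {X J phi} _ _.

Lemma bumps_inj {X : TopSpace} {J : Type} (phi : J -> X -> R) x i j :
  bumps phi -> 0 < phi i x -> 0 < phi j x -> i = j.
Proof.
  intros B Hi Hj. destruct (bumps_discrete B x) as [W [_ [Wx HW]]]. apply HW; eauto.
Qed.

(** Near each point at most one bump is nonzero, so [s] locally is either that bump or 0. The
    equation [s x = 1] describes the union of the cores by one continuous function. *)
Lemma bumps_sum {X : TopSpace} {J : Type} (phi : J -> X -> R) : bumps phi ->
  exists s : X -> R, rcont s /\ (forall x, 0 <= s x <= 1) /\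
    (forall j x, 0 < phi j x -> s x = phi j x) /\
    forall x, s x = 1 -> exists j, phi j x = 1.
Proof.
  intros B.
  assert (H : forall x, exists r, (forall j, 0 < phi j x -> r = phi j x) /\
                                  ((forall j, ~ 0 < phi j x) -> r = 0)).
  { intros x. destruct (classic (exists j, 0 < phi j x)) as [[j Hj]|H].
    - exists (phi j x). split.
      + intros i Hi. now rewrite (bumps_inj phi x i j).
      + intros H. destruct (H j Hj).
    - exists 0. split; auto. intros j Hj. destruct H; eauto. }
  apply choice in H. destruct H as [s Hs]. exists s.
  assert (Hb : forall x, (exists j, 0 < phi j x /\ s x = phi j x) \/
                         ((forall j, ~ 0 < phi j x) /\ s x = 0)).
  { intros x. destruct (classic (exists j, 0 < phi j x)) as [[j Hj]|H].
    - left. exists j. split; auto. now apply Hs.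
    - right. assert (H' : forall j, ~ 0 < phi j x) by (intros j Hj; eauto).
      split; auto. now apply Hs. }
  split; [|split; [|split]].
  - apply mcont_local. intros x. destruct (bumps_discrete B x) as [W [oW [Wx HW]]].
    destruct (classic (exists j y, W y /\ 0 < phi j y)) as [[j [y [Wy Hj]]]|H].
    + exists W, (phi j). split; auto. split; auto. split; [apply B|].
      intros z Wz. destruct (Hb z) as [[i [Hi ->]]|[Hz ->]].
      * rewrite (HW i j); eauto.
      * pose proof (bumps_bounds B j z). specialize (Hz j). lra.
    + exists W, (fun _ => 0). split; auto. split; auto.
      split; [apply (mcont_const Rd_metric)|].
      intros z Wz. destruct (Hb z) as [[i [Hi _]]|[_ Hz]]; auto. destruct H; eauto.
  - intros x. destruct (Hb x) as [[j [_ ->]]|[_ ->]]; [apply B|lra].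
  - intros j x Hj. now apply Hs.
  - intros x Hx. destruct (Hb x) as [[j [_ H]]|[_ H]]; [exists j|]; lra.
Qed.

(** Each factor is 0 where [1 - s t' <= 2/(3c)] and 1 where [1 - s t' >= 1/c]. In
    [bumps_disjointify] the family [t'] itself lives where [1 - s t' < 1/(3c)]; the band between
    1/(3c) and 2/(3c) separates it from all later families. *)
Fixpoint cutoff {X : Type} (s : nat -> X -> R) (c : R) (t : nat) (x : X) : R :=
  match t with
  | O => 1
  | S t => Rmin (cutoff s c t x) (clamp (3 * c * (1 - s t x) - 2))
  end.

Lemma cutoff_bounds {X : Type} (s : nat -> X -> R) c t x : 0 <= cutoff s c t x <= 1.
Proof.
  induction t; simpl; [lra|]. pose proof (clamp_bounds (3 * c * (1 - s t x) - 2)).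
  unfold Rmin; destruct Rle_dec; lra.
Qed.

Lemma cutoff_pos {X : Type} (s : nat -> X -> R) c t x : 0 < cutoff s c t x ->
  forall t', (t' < t)%nat -> 2 < 3 * c * (1 - s t' x).
Proof.
  induction t as [|t IH]; intros H t' Ht; [lia|]. simpl in H.
  assert (0 < cutoff s c t x /\ 0 < clamp (3 * c * (1 - s t x) - 2)) as [H1 H2].
  { unfold Rmin in H; destruct Rle_dec; lra. }
  destruct (Nat.eq_dec t' t) as [->|]; [|apply IH; auto; lia].
  revert H2. unfold clamp, Rmax, Rmin. repeat destruct Rle_dec; lra.
Qed.

Lemma cutoff_eventually_1 {X : Type} (s : nat -> X -> R) t x :
  (forall t', (t' < t)%nat -> s t' x < 1) ->
  exists K, forall k, (K <= k)%nat -> cutoff s (INR k + 1) t x = 1.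
Proof.
  induction t as [|t IH]; intros H; [exists O; auto|].
  destruct IH as [K HK]; [intros; apply H; lia|].
  destruct (inv_INR_small (1 - s t x)) as [K' HK']; [specialize (H t ltac:(lia)); lra|].
  exists (Nat.max K K'). intros k Hk. simpl. rewrite HK; [|lia]. specialize (HK' k ltac:(lia)).
  pose proof (pos_INR k).
  assert (1 < (INR k + 1) * (1 - s t x)).
  { apply Rmult_lt_compat_l with (r := INR k + 1) in HK'; [|lra]. rewrite Rinv_r in HK'; lra. }
  unfold clamp, Rmax, Rmin. repeat destruct Rle_dec; lra.
Qed.

Lemma rcont_cutoff {X : TopSpace} (s : nat -> X -> R) c t :
  (forall t, rcont (s t)) -> rcont (cutoff s c t).
Proof.
  intros Hs. induction t; simpl.
  - apply (mcont_const Rd_metric).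
  - apply rcont_min; [exact IHt|]. apply rcont_clamp.
    apply rcont_ext with (fun x => (-3 * c) * s t x + (3 * c - 2)); [intros; ring|].
    apply rcont_affine; auto.
Qed.

(* A sigma-discrete cover is made discrete at each stage [k] by shrinking the
   [t]-th family away from the families before it; a point is in the end
   captured by the first family that covers it. *)
Lemma bumps_disjointify {X : TopSpace} (G : nat -> Type) (e : forall t, G t -> X -> R) :
  (forall t, bumps (e t)) -> (forall x, exists t i, e t i x = 1) ->
  exists phi : nat -> {t : nat & G t} -> X -> R,
    (forall k, bumps (phi k)) /\
    forall x, exists t i, e t i x = 1 /\
      exists K, forall k, (K <= k)%nat -> phi k (existT _ t i) x = 1.
Proof.
  intros He Hcov.
  assert (Hs : forall t, exists s : X -> R, rcont s /\ (forall x, 0 <= s x <= 1) /\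
    (forall j x, 0 < e t j x -> s x = e t j x) /\
    forall x, s x = 1 -> exists j, e t j x = 1) by (intros t; apply bumps_sum; auto).
  apply choice in Hs. destruct Hs as [s Hs].
  (* Families with index above [k] are switched off, so that finitely many remain and a common
     neighbourhood can be found. *)
  set (phi := fun k (j : {t : nat & G t}) x =>
    if le_dec (projT1 j) k then
      Rmin (clamp (1 - 3 * (INR k + 1) * (1 - e (projT1 j) (projT2 j) x)))
           (cutoff s (INR k + 1) (projT1 j) x)
    else 0).
  assert (Hpos : forall k t i x, 0 < phi k (existT _ t i) x ->
    (t <= k)%nat /\ 0 < e t i x /\ 3 * (INR k + 1) * (1 - s t x) < 1 /\
    forall t', (t' < t)%nat -> 2 < 3 * (INR k + 1) * (1 - s t' x)).
  { intros k t i x. unfold phi. simpl. destruct le_dec as [Hle|]; [|lra]. intros H.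
    assert (0 < clamp (1 - 3 * (INR k + 1) * (1 - e t i x)) /\
            0 < cutoff s (INR k + 1) t x) as [H1 H2].
    { unfold Rmin in H; destruct Rle_dec; lra. }
    assert (3 * (INR k + 1) * (1 - e t i x) < 1) as H3.
    { revert H1. unfold clamp, Rmax, Rmin. repeat destruct Rle_dec; lra. }
    assert (0 < e t i x) as H4.
    { pose proof (pos_INR k). apply Rnot_le_lt. intros H5. nra. }
    split; auto. split; auto. split.
    - destruct (Hs t) as [_ [_ [H5 _]]]. now rewrite (H5 i x H4).
    - apply cutoff_pos; auto. }
  exists phi. split.
  - intros k. split.
    + intros [t i]. unfold phi; simpl. destruct le_dec.
      * apply rcont_min; [apply rcont_clamp|apply rcont_cutoff; apply Hs].
        apply rcont_ext with (fun x => (3 * (INR k + 1)) * e t i x + (1 - 3 * (INR k + 1))).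
        { intros; ring. }
        apply rcont_affine. apply (bumps_cont (He t)).
      * apply (mcont_const Rd_metric).
    + intros [t i] x. unfold phi; simpl. destruct le_dec; [|lra].
      pose proof (clamp_bounds (1 - 3 * (INR k + 1) * (1 - e t i x))).
      pose proof (cutoff_bounds s (INR k + 1) t x). unfold Rmin; destruct Rle_dec; lra.
    + intros x.
      (* Variations below 1/2 around [x] cannot bridge the values below 1 and above 2 that [Hpos]
         prescribes on an earlier and on a later family. *)
      destruct (nbhd_forall_lt x (fun t W =>
          (forall i j, (exists y, W y /\ 0 < e t i y) -> (exists y, W y /\ 0 < e t j y) -> i = j)
          /\ forall y, W y -> Rd (3 * (INR k + 1) * (1 - s t x)) (3 * (INR k + 1) * (1 - s t y)) < 1/2)
          (S k)) as [W [oW [Wx HW]]].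
      * intros t W W' HWW [H1 H2]. split.
        -- intros i j [y [? ?]] [z [? ?]]. apply H1; eauto.
        -- auto.
      * intros t _. destruct (bumps_discrete (He t) x) as [W1 [o1 [x1 H1]]].
        assert (Hc : rcont (fun x => 3 * (INR k + 1) * (1 - s t x))).
        { apply rcont_ext with (fun x => (-3 * (INR k + 1)) * s t x + 3 * (INR k + 1)).
          - intros; ring.
          - apply rcont_affine. apply Hs. }
        destruct (Hc x (1/2)) as [W2 [o2 [x2 H2]]]; [lra|].
        exists (fun y => W1 y /\ W2 y). split; [now apply open_inter|]. split; auto.
        split; [|intuition].
        intros i j [y [[? ?] ?]] [z [[? ?] ?]]. apply H1; eauto.
      * exists W. split; auto. split; auto.
        assert (Hlt : forall t i y t' i' y', W y -> W y' -> 0 < phi k (existT _ t i) y ->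
           0 < phi k (existT _ t' i') y' -> (t < t')%nat -> False).
        { intros t i y t' i' y' Wy Wy' Hy Hy' Htt.
          apply Hpos in Hy. apply Hpos in Hy'.
          destruct Hy as [Hk [_ [Hy _]]]. destruct Hy' as [Hk' [_ [_ Hy']]].
          specialize (Hy' t Htt). destruct (HW t) as [_ Hd]; [lia|].
          pose proof (Hd y Wy) as D1. pose proof (Hd y' Wy') as D2.
          apply Rd_lt in D1. apply Rd_lt in D2. lra. }
        intros [t i] [t' i'] [y [Wy Hy]] [y' [Wy' Hy']].
        destruct (Nat.lt_trichotomy t t') as [H|[H|H]].
        -- exfalso. eapply Hlt with (y := y) (y' := y'); eauto.
        -- subst t'. f_equal. apply Hpos in Hy. apply Hpos in Hy'.
           destruct (HW t) as [H1 _]; [lia|]. apply H1; [exists y|exists y']; tauto.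
        -- exfalso. eapply Hlt with (y := y') (y' := y); eauto.
  - intros x.
    destruct (classic (exists t, (exists i, e t i x = 1) /\
                 forall t', (t' < t)%nat -> ~ exists i, e t' i x = 1)) as [[t [[i Hi] Hmin]]|Hn].
    + exists t, i. split; auto.
      destruct (cutoff_eventually_1 s t x) as [K HK].
      { intros t' Ht'. destruct (Hs t') as [_ [Hb [_ H1]]].
        destruct (Hb x) as [_ [H2|H2]]; auto. destruct (Hmin t' Ht'). auto. }
      exists (Nat.max K t). intros k Hk. unfold phi; simpl. destruct le_dec; [|lia].
      rewrite HK; [|lia]. rewrite Hi.
      unfold clamp, Rmax, Rmin. repeat destruct Rle_dec; lra.
    + exfalso. assert (H : forall n t, (t < n)%nat -> ~ exists i, e t i x = 1).
      { induction n; intros t Ht; [lia|]. intros Hex. apply Hn. exists t. split; auto.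
        intros t' Ht'. apply IHn. lia. }
      destruct (Hcov x) as [t Ht]. apply (H (S t) t); auto.
Qed.

(** Paths are total on R, so that affine changes of parameter carry no range conditions; outside
    [0,1] the values merely have to stay in [V]. *)
Definition joined {T : Type} (d : T -> T -> R) (V : T -> Prop) (a b : T) : Prop :=
  exists p : R -> T, mcontinuous Rd d p /\ p 0 = a /\ p 1 = b /\ forall t, V (p t).

Definition path_connected_set {T : Type} (d : T -> T -> R) (V : T -> Prop) : Prop :=
  forall a b, V a -> V b -> joined d V a b.

Lemma joined_concat {T : Type} {d : T -> T -> R} (V W : T -> Prop) a z b :
  joined d V a z -> joined d W z b -> joined d (fun y => V y \/ W y) a b.
Proof.
  intros [p [Hp [p0 [p1 pV]]]] [q [Hq [q0 [q1 qW]]]].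
  exists (fun t => if Rle_dec t (1/2) then p (2 * t) else q (2 * t - 1)).
  split; [|split; [|split]].
  - intros t e He. destruct (total_order_T t (1/2)) as [[H|H]|H].
    + destruct (Hp (2 * t) e He) as [r [Hr H']]. exists (Rmin (r/2) (1/2 - t)).
      split; [apply Rmin_pos; lra|]. intros t' Ht'.
      pose proof (Rmin_l (r/2) (1/2 - t)). pose proof (Rmin_r (r/2) (1/2 - t)).
      apply Rd_lt in Ht'. destruct Rle_dec; [|lra]. destruct Rle_dec; [|lra].
      apply H'. apply Rd_lt. lra.
    + subst t. destruct (Hp 1 e He) as [r [Hr H']]. destruct (Hq 0 e He) as [r' [Hr' H'']].
      exists (Rmin (r/2) (r'/2)). split; [apply Rmin_pos; lra|]. intros t' Ht'.
      pose proof (Rmin_l (r/2) (r'/2)). pose proof (Rmin_r (r/2) (r'/2)).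
      apply Rd_lt in Ht'. destruct (Rle_dec (1/2) (1/2)); [|lra].
      replace (2 * (1/2)) with 1 by lra. destruct Rle_dec.
      * apply H'. apply Rd_lt. lra.
      * rewrite p1, <- q0. apply H''. apply Rd_lt. lra.
    + destruct (Hq (2 * t - 1) e He) as [r [Hr H']]. exists (Rmin (r/2) (t - 1/2)).
      split; [apply Rmin_pos; lra|]. intros t' Ht'.
      pose proof (Rmin_l (r/2) (t - 1/2)). pose proof (Rmin_r (r/2) (t - 1/2)).
      apply Rd_lt in Ht'. destruct Rle_dec; [lra|]. destruct Rle_dec; [lra|].
      apply H'. apply Rd_lt. lra.
  - destruct Rle_dec; [|lra]. now rewrite Rmult_0_r.
  - destruct Rle_dec; [lra|]. now replace (2 * 1 - 1) with 1 by lra.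
  - intros t. destruct Rle_dec; auto.
Qed.

Lemma joined_union {T : Type} {d : T -> T -> R} (V W : T -> Prop) a b z :
  path_connected_set d V -> path_connected_set d W -> V a -> V z -> W z -> W b ->
  joined d (fun y => V y \/ W y) a b.
Proof. intros HV HW Va Vz Wz Wb. apply joined_concat with z; auto. Qed.

(** The natural number in [lv_bump] is the stage of shrinking: a given point lies in a core only
    from some stage on. *)
Record level (X : TopSpace) (T : Type) := {
  lv_index : Type;
  lv_pt : lv_index -> T;
  lv_set : lv_index -> T -> Prop;
  lv_bump : nat -> lv_index -> X -> R }.
Arguments lv_index {X T} _.
Arguments lv_pt {X T} _ _.
Arguments lv_set {X T} _ _ _.
Arguments lv_bump {X T} _ _ _ _.

Record level_for {X : TopSpace} {T : Type} (d : T -> T -> R) (f : X -> T) (eps : R)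
    (lv : level X T) : Prop := {
  lv_bumps : forall k, bumps (lv_bump lv k);
  lv_path : forall j, path_connected_set d (lv_set lv j);
  lv_in : forall j, lv_set lv j (lv_pt lv j);
  lv_small : forall j z, lv_set lv j z -> d (lv_pt lv j) z < eps;
  lv_cover : forall x, exists j, lv_set lv j (f x) /\
     exists K, forall k, (K <= k)%nat -> lv_bump lv k j x = 1 }.

(** A base member is kept if [f] maps it into some admissible small set [V]. It need not be
    functionally closed, so it is replaced by cores on which a K_1 zero function certifies that
    [f x] lies in [V], while the base neighbourhoods [u] keep the family discrete. *)
Lemma level_exists {X Y : TopSpace} {d : Y -> Y -> R} (f : X -> Y) eps :
  (forall y : Y, exists V : Y -> Prop, is_open V /\ V y /\ (forall z, V z -> d y z < eps) /\
             path_connected_set d V) ->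
  Kclass1 f -> Sigma_f f -> exists lv, level_for d f eps lv.
Proof.
  intros Hloc HK [I [A [HA Hbase]]].
  set (fits := fun n (i : I n) (y : Y) (V : Y -> Prop) =>
     V y /\ is_open V /\ (forall z, V z -> d y z < eps) /\ path_connected_set d V /\
     forall x, A n i x -> V (f x)).
  assert (Hq : forall j : {n : nat & {i : I n | exists y V, fits n i y V}},
    exists q : (Y * (Y -> Prop)) * ((nat -> X -> R) * (X -> R)),
      fits (projT1 j) (proj1_sig (projT2 j)) (fst (fst q)) (snd (fst q)) /\
      (forall k, rcont (fst (snd q) k) /\ forall x, 0 <= fst (snd q) k x <= 1) /\
      (forall x, snd (fst q) (f x) <-> exists k, fst (snd q) k x = 0)).
  { intros [n [i [y [V H]]]]. simpl.
    destruct (HK V) as [Z [HZ HV]]; [apply H|].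
    assert (Hz : forall k, exists z : X -> R, rcont z /\ (forall x, 0 <= z x <= 1) /\
                   forall x, Z k x <-> z x = 0).
    { intros k. apply functionally_closed_iff, HZ. }
    apply choice in Hz. destruct Hz as [z Hz].
    exists ((y, V), (z, fun _ => 0)). simpl. split; auto. split.
    - intros k. split; apply Hz.
    - intros x. rewrite HV. split; intros [k Hk]; exists k; apply Hz; auto. }
  apply choice in Hq. destruct Hq as [q Hq].
  assert (HU : forall n, exists u : I n -> X -> R, bumps u /\ forall i x, A n i x -> 0 < u i x).
  { intros n. destruct (HA n) as [U [HU1 [HU2 HU3]]].
    assert (Hu : forall i, exists u : X -> R, rcont u /\ (forall x, 0 <= u x <= 1) /\
                   forall x, U i x <-> 0 < u x).
    { intros i. apply functionally_open_iff, HU2. }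
    apply choice in Hu. destruct Hu as [u Hu]. exists u. split; [split|].
    - intros; apply Hu.
    - intros; apply Hu.
    - intros x. destruct (HU1 x) as [W [oW [Wx HW]]]. exists W. split; auto. split; auto.
      intros i j [y [? Hi]] [z [? Hj]]. apply Hu in Hi, Hj. apply HW; eauto.
    - intros i x Hx. apply Hu, HU3. intros W oW Wx. eauto. }
  set (u := fun n => proj1_sig (constructive_indefinite_description _ (HU n))).
  assert (Hu : forall n, bumps (u n) /\ forall i x, A n i x -> 0 < u n i x).
  { intros n. unfold u. destruct constructive_indefinite_description; auto. }
  set (N := fun t => fst (of_nat t)).
  set (k := fun t => fst (of_nat (snd (of_nat t)))).
  set (l := fun t => snd (of_nat (snd (of_nat t)))).
  set (G := fun t => {i : I (N t) | exists y V, fits (N t) i y V}).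
  set (J := fun t (i : G t) =>
     existT (fun n => {i : I n | exists y V, fits n i y V}) (N t) i).
  (* [rest] vanishes exactly where the [k t]-th zero function does and [u] is at least
     [/ (INR (l t) + 1)]. Hence [e] is 1 exactly there, and its denominator never vanishes. *)
  set (rest := fun t i x => fst (snd (q (J t i))) (k t) x +
              Rmax 0 (-1 * u (N t) (proj1_sig i) x + / (INR (l t) + 1))).
  set (e := fun t (i : G t) x =>
     u (N t) (proj1_sig i) x / (u (N t) (proj1_sig i) x + rest t i x)).
  assert (Hl : forall t, 0 < / (INR (l t) + 1)).
  { intros t. apply Rinv_0_lt_compat. pose proof (pos_INR (l t)); lra. }
  assert (Hrest : forall t i x, 0 <= rest t i x /\ 0 < u (N t) (proj1_sig i) x + rest t i x).
  { intros t i x. unfold rest. specialize (Hl t).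
    pose proof (bumps_bounds (proj1 (Hu (N t))) (proj1_sig i) x).
    destruct (Hq (J t i)) as [_ [H1 _]]. destruct (H1 (k t)) as [_ H2]. specialize (H2 x).
    unfold Rmax. destruct Rle_dec; lra. }
  destruct (bumps_disjointify G e) as [phi [Hphi Hcov]].
  - intros t. split.
    + intros i. unfold e. apply rcont_div.
      * intros x; apply Hrest.
      * apply (bumps_cont (proj1 (Hu (N t)))).
      * apply rcont_plus; [apply (bumps_cont (proj1 (Hu (N t))))|].
        unfold rest. apply rcont_plus; [apply (Hq (J t i))|].
        apply rcont_max; [apply (mcont_const Rd_metric)|].
        apply rcont_affine, (bumps_cont (proj1 (Hu (N t)))).
    + intros i x. unfold e. destruct (Hrest t i x) as [H1 H2].
      pose proof (bumps_bounds (proj1 (Hu (N t))) (proj1_sig i) x).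
      split.
      * apply Rmult_le_pos; [lra|left; apply Rinv_0_lt_compat; lra].
      * apply Rmult_le_reg_r with (1 := H2). unfold Rdiv.
        rewrite Rmult_assoc, Rinv_l; lra.
    + assert (Hp : forall i x, 0 < e t i x -> 0 < u (N t) (proj1_sig i) x).
      { intros i x Hx. unfold e in Hx. destruct (Hrest t i x) as [H1 H2].
        pose proof (bumps_bounds (proj1 (Hu (N t))) (proj1_sig i) x) as [[H3|H3] _]; auto.
        rewrite <- H3 in Hx. unfold Rdiv in Hx. lra. }
      intros x. destruct (bumps_discrete (proj1 (Hu (N t))) x) as [W [oW [Wx HW]]].
      exists W. split; auto. split; auto. intros i j [y [Wy Hi]] [z [Wz Hj]].
      apply Hp in Hi, Hj. destruct i as [i pi], j as [j pj]. simpl in *.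
      assert (i = j) by (apply HW; eauto). subst j. f_equal. apply proof_irrelevance.
  - intros x. destruct (Hloc (f x)) as [V [oV [Vx [H1 H2]]]].
    destruct (Hbase V oV) as [S HS]. destruct (proj1 (HS x) Vx) as [n [i [Si Ai]]].
    assert (Hfit : exists y V, fits n i y V).
    { exists (f x), V. repeat split; auto. intros z Az. apply HS. eauto. }
    set (j := existT (fun n => {i : I n | exists y V, fits n i y V}) n (exist _ i Hfit)).
    destruct (Hq j) as [Hf [_ Hz]].
    destruct (proj1 (Hz x)) as [k' Hk']; [apply Hf; exact Ai|].
    destruct (inv_INR_small (u n i x)) as [l' Hl']; [apply (Hu n); auto|].
    specialize (Hl' l' ltac:(lia)).
    exists (to_nat (n, to_nat (k', l'))).
    unfold e, rest, J, G, N, k, l. repeat (rewrite cancel_of_to; cbn [fst snd]).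
    exists (exist _ i Hfit). fold j. rewrite Hk'. simpl proj1_sig.
    pose proof (proj2 (Hu n) i x Ai).
    rewrite Rmax_left by lra. rewrite !Rplus_0_r. field. lra.
  - exists {| lv_index := {t : nat & G t};
              lv_pt := fun j => fst (fst (q (J (projT1 j) (projT2 j))));
              lv_set := fun j => snd (fst (q (J (projT1 j) (projT2 j))));
              lv_bump := phi |}.
    split; simpl.
    + exact Hphi.
    + intros j. apply (Hq (J (projT1 j) (projT2 j))).
    + intros j. apply (Hq (J (projT1 j) (projT2 j))).
    + intros j. apply (Hq (J (projT1 j) (projT2 j))).
    + intros x. destruct (Hcov x) as [t [i [Hi HK']]]. exists (existT _ t i). simpl.
      split; auto. apply (Hq (J t i)). exists (k t).
      destruct (Hq (J t i)) as [_ [Hb _]]. destruct (Hb (k t)) as [_ Hb']. specialize (Hb' x).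
      unfold e in Hi. destruct (Hrest t i x) as [H1 H2].
      assert (rest t i x = 0) as H3.
      { assert (u (N t) (proj1_sig i) x = u (N t) (proj1_sig i) x + rest t i x); [|lra].
        rewrite <- (Rmult_1_l (u (N t) (proj1_sig i) x + rest t i x)). rewrite <- Hi. field. lra. }
      unfold rest in H3. pose proof (Rmax_l 0 (-1 * u (N t) (proj1_sig i) x + / (INR (l t) + 1))).
      lra.
Qed.

(** * Continuous approximations *)

(** Shrinks a bump without changing its core: the value 1 is kept, values up to 1/2 become 0. *)
Definition cut (t : R) : R := clamp (2 * t - 1).

Lemma cut_bounds t : 0 <= cut t <= 1.
Proof. apply clamp_bounds. Qed.

Lemma cut_pos t : 0 < cut t -> 1/2 < t.
Proof. unfold cut, clamp, Rmax, Rmin. repeat destruct Rle_dec; lra. Qed.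

Lemma cut_1 : cut 1 = 1.
Proof. unfold cut. rewrite clamp_id; lra. Qed.

Lemma rcont_cut {X : TopSpace} (g : X -> R) : rcont g -> rcont (fun x => cut (g x)).
Proof. intros Hg. apply rcont_clamp. exact (rcont_affine g 2 (-1) Hg). Qed.

(* [st_map] will be constant, with value [st_pt l], where [0 < st_bump l], so that the next
   step can modify it there along paths without losing continuity. *)
Record stage (X : TopSpace) (T : Type) := {
  st_index : Type;
  st_pt : st_index -> T;
  st_set : st_index -> T -> Prop;
  st_bump : st_index -> X -> R;
  st_map : X -> T }.
Arguments st_index {X T} _.
Arguments st_pt {X T} _ _.
Arguments st_set {X T} _ _ _.
Arguments st_bump {X T} _ _ _.
Arguments st_map {X T} _ _.

Section Step.
Context {X : TopSpace} {T : Type} {d : T -> T -> R} (M : metric d).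

Record stage_ok (s : stage X T) : Prop := {
  st_bumps : bumps (st_bump s);
  st_path : forall l, path_connected_set d (st_set s l);
  st_in : forall l, st_set s l (st_pt s l);
  st_const : forall l x, 0 < st_bump s l x -> st_map s x = st_pt s l;
  st_cont : mcont d (st_map s) }.

Section OneStep.
Context (s : stage X T) (J : Type) (pt : J -> T) (set : J -> T -> Prop) (phi : J -> X -> R).

Definition linked (q : st_index s * J) : Prop :=
  exists z, st_set s (fst q) z /\ set (snd q) z.

Definition link_path (q : st_index s * J) : R -> T :=
  epsilon (inhabits (fun _ => pt (snd q)))
    (fun p => mcontinuous Rd d p /\ p 0 = st_pt s (fst q) /\ p 1 = pt (snd q) /\
              forall t, st_set s (fst q) (p t) \/ set (snd q) (p t)).

Definition link_bump (q : st_index s * J) (x : X) : R :=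
  Rmin (phi (snd q) x) (cut (st_bump s (fst q) x)).

Definition active (x : X) (q : st_index s * J) : Prop := linked q /\ 0 < link_bump q x.

(** The factor 2 completes the path as soon as [link_bump] reaches 1/2. The bumps of the next stage
    are [cut (link_bump q x)], positive only beyond 1/2, so the new map is constant on their
    supports. *)
Definition step_map (x : X) : T :=
  match excluded_middle_informative (exists q, active x q) with
  | left H => let q := proj1_sig (constructive_indefinite_description _ H) in
              link_path q (clamp (2 * link_bump q x))
  | right _ => st_map s x
  end.

Definition step : stage X T :=
  {| st_index := st_index s * J;
     st_pt := fun q => pt (snd q);
     st_set := fun q => set (snd q);
     st_bump := fun q x => if excluded_middle_informative (linked q)
                           then cut (link_bump q x) else 0;
     st_map := step_map |}.

Context (Hs : stage_ok s) (Hphi : bumps phi)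
  (Hpath : forall j, path_connected_set d (set j)) (Hin : forall j, set j (pt j)).

Lemma link_path_spec q : linked q ->
  mcontinuous Rd d (link_path q) /\ link_path q 0 = st_pt s (fst q) /\
  link_path q 1 = pt (snd q) /\
  forall t, st_set s (fst q) (link_path q t) \/ set (snd q) (link_path q t).
Proof.
  intros [z [Hz1 Hz2]]. unfold link_path. apply epsilon_spec.
  apply (joined_union _ _ _ _ z (st_path s Hs (fst q)) (Hpath (snd q))
    (st_in s Hs _) Hz1 Hz2 (Hin _)).
Qed.

Lemma link_bump_pos q x : 0 < link_bump q x ->
  0 < phi (snd q) x /\ 1/2 < st_bump s (fst q) x.
Proof.
  unfold link_bump, Rmin. intros H. split; [|apply cut_pos]; destruct Rle_dec; lra.
Qed.

Lemma link_bump_bounds q x : 0 <= link_bump q x <= 1.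
Proof.
  unfold link_bump. pose proof (bumps_bounds Hphi (snd q) x).
  pose proof (cut_bounds (st_bump s (fst q) x)). unfold Rmin; destruct Rle_dec; lra.
Qed.

Lemma rcont_link_bump q : rcont (link_bump q).
Proof.
  apply rcont_min; [apply (bumps_cont Hphi)|].
  apply rcont_cut, (bumps_cont (st_bumps s Hs)).
Qed.

Lemma link_bump_discrete x : exists W, is_open W /\ W x /\ forall q q' y y',
  W y -> W y' -> 0 < link_bump q y -> 0 < link_bump q' y' -> q = q'.
Proof.
  destruct (bumps_discrete Hphi x) as [W [oW [Wx HW]]].
  destruct (bumps_discrete (st_bumps s Hs) x) as [W' [oW' [Wx' HW']]].
  exists (fun y => W y /\ W' y). split; [now apply open_inter|]. split; auto.
  intros [l j] [l' j'] y y' [? ?] [? ?] Hq Hq'.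
  apply link_bump_pos in Hq, Hq'. simpl in *. f_equal.
  - apply HW'; [exists y|exists y']; split; auto; lra.
  - apply HW; [exists y|exists y']; split; auto; lra.
Qed.

Lemma active_unique x q q' : active x q -> active x q' -> q = q'.
Proof.
  intros [_ H] [_ H']. destruct (link_bump_discrete x) as [W [_ [Wx HW]]]. eauto.
Qed.

Lemma step_map_active x q : active x q ->
  step_map x = link_path q (clamp (2 * link_bump q x)).
Proof.
  intros Hq. unfold step_map. destruct excluded_middle_informative as [H|H].
  - destruct constructive_indefinite_description as [q' Hq']. simpl.
    now rewrite (active_unique x q' q).
  - destruct H; eauto.
Qed.

Lemma step_map_inactive x : (forall q, ~ active x q) -> step_map x = st_map s x.
Proof.
  intros Hn. unfold step_map. destruct excluded_middle_informative as [[q H]|H]; auto.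
  destruct (Hn q H).
Qed.

(** The path starts at the constant value of the old map, so one formula covers the active points
    and the inactive ones in the support of the old bump. *)
Lemma step_map_linked q x : linked q -> (forall q', active x q' -> q' = q) ->
  0 < st_bump s (fst q) x -> step_map x = link_path q (clamp (2 * link_bump q x)).
Proof.
  intros Hq Hu Hb. destruct (Rle_lt_dec (link_bump q x) 0) as [H|H].
  - rewrite step_map_inactive.
    + pose proof (link_bump_bounds q x). replace (link_bump q x) with 0 by lra.
      rewrite clamp_id by lra. rewrite Rmult_0_r.
      destruct (link_path_spec q Hq) as [_ [-> _]]. now apply (st_const s Hs).
    + intros q' Hq'. pose proof (Hu q' Hq'). subst q'. destruct Hq'. lra.
  - apply step_map_active. split; auto.
Qed.

(** Near any point at most one pair [q] matters. If its old bump vanishes at the point, that bump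
    stays below 1/2 nearby and nothing is modified there; if it is positive, the formula of
    [step_map_linked] holds nearby. *)
Lemma step_map_cont : mcont d step_map.
Proof.
  apply mcont_local. intros x. destruct (link_bump_discrete x) as [W [oW [Wx HW]]].
  destruct (classic (exists q y, W y /\ active y q)) as [[q [y [Wy [Hq Hy]]]]|Hn].
  - assert (Hu : forall z q', W z -> active z q' -> q' = q).
    { intros z q' Wz [_ Hz]. exact (HW q' q z y Wz Wy Hz Hy). }
    assert (Hc : rcont (st_bump s (fst q))) by apply (bumps_cont (st_bumps s Hs)).
    destruct (Rle_lt_dec (st_bump s (fst q) x) 0) as [H|H].
    + exists (fun z => W z /\ st_bump s (fst q) z < 1/2), (st_map s).
      split; [|split; [|split]].
      * apply open_inter; auto.
        apply (mcont_preimage (d := Rd) _ (fun r => r < 1/2) Hc).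
        intros r Hr. exists (1/2 - r). split; [lra|]. intros r' Hr'. apply Rd_lt in Hr'. lra.
      * split; auto; lra.
      * apply (st_cont s Hs).
      * intros z [Wz Hz]. apply step_map_inactive. intros q' Hq'.
        pose proof (Hu z q' Wz Hq'). subst q'. destruct Hq' as [_ Hq'].
        apply link_bump_pos in Hq'. lra.
    + exists (fun z => W z /\ 0 < st_bump s (fst q) z),
        (fun z => link_path q (clamp (2 * link_bump q z))).
      split; [|split; [|split]].
      * apply open_inter; auto.
        apply (mcont_preimage (d := Rd) _ (fun r => 0 < r) Hc).
        intros r Hr. exists r. split; [lra|]. intros r' Hr'. apply Rd_lt in Hr'. lra.
      * auto.
      * apply (fun H => mcont_comp (dS := Rd) _ _ H (proj1 (link_path_spec q Hq))).
        apply rcont_clamp. apply rcont_ext with (fun z => 2 * link_bump q z + 0); [intros; ring|].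
        apply rcont_affine, rcont_link_bump.
      * intros z [Wz Hz]. apply step_map_linked; auto. intros q' Hq'. exact (Hu z q' Wz Hq').
  - exists W. exists (st_map s). split; auto. split; auto. split; [exact (st_cont s Hs)|].
    intros z Wz. apply step_map_inactive. intros q Hq. apply Hn. eauto.
Qed.

Lemma step_ok : stage_ok step.
Proof.
  assert (Hp : forall q x, 0 < st_bump step q x -> linked q /\ 1/2 < link_bump q x).
  { intros q x. simpl. destruct excluded_middle_informative; [|lra]. intros H.
    split; auto. now apply cut_pos. }
  split.
  - split.
    + intros q. simpl. destruct excluded_middle_informative.
      * apply rcont_cut, rcont_link_bump.
      * apply (mcont_const Rd_metric).
    + intros q x. simpl. destruct excluded_middle_informative; [apply cut_bounds|lra].
    + intros x. destruct (link_bump_discrete x) as [W [oW [Wx HW]]].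
      exists W. split; auto. split; auto. intros q q' [y [Wy Hy]] [y' [Wy' Hy']].
      apply Hp in Hy, Hy'. apply (HW q q' y y'); tauto || lra.
  - intros q. apply Hpath.
  - intros q. apply Hin.
  - intros q x Hx. apply Hp in Hx. destruct Hx as [Hq Hx]. simpl.
    rewrite (step_map_active x q); [|split; auto; lra].
    replace (clamp (2 * link_bump q x)) with 1.
    + apply (link_path_spec q Hq).
    + unfold clamp, Rmax, Rmin. repeat destruct Rle_dec; lra.
  - exact step_map_cont.
Qed.

(** A modified value starts from the old centre. If it lies in the old set it is within [a];
    otherwise the route over a common point of the linked sets and the new centre costs
    [a + b + b]. *)
Lemma step_close a b x : 0 < a -> 0 < b ->
  (forall l z, st_set s l z -> d (st_pt s l) z < a) ->
  (forall j z, set j z -> d (pt j) z < b) ->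
  d (st_map s x) (st_map step x) < a + 2 * b.
Proof.
  intros Ha Hb HA HB. simpl. destruct (classic (exists q, active x q)) as [[q Hq]|Hn].
  - rewrite (step_map_active x q Hq). destruct Hq as [Hq Hx].
    rewrite (st_const s Hs (fst q)); [|apply link_bump_pos in Hx; lra].
    destruct (link_path_spec q Hq) as [_ [_ [_ H]]].
    destruct (H (clamp (2 * link_bump q x))) as [H1|H1].
    + apply HA in H1. lra.
    + destruct Hq as [z [Hz1 Hz2]]. apply HA in Hz1. apply HB in Hz2. apply HB in H1.
      set (w := link_path q _) in *.
      pose proof (metric_tri M (st_pt s (fst q)) z w). pose proof (metric_tri M z (pt (snd q)) w).
      rewrite (metric_sym M z (pt (snd q))) in *. lra.
  - rewrite step_map_inactive; [|intros q Hq; eauto]. rewrite (metric_refl M). lra.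
Qed.

Lemma step_bump_1 l j x z : st_set s l z -> set j z -> st_bump s l x = 1 -> phi j x = 1 ->
  st_bump step (l, j) x = 1.
Proof.
  intros H1 H2 H3 H4. simpl. destruct excluded_middle_informative as [H|H].
  - unfold link_bump. simpl. rewrite H3, H4, cut_1. rewrite Rmin_left by lra. apply cut_1.
  - destruct H. exists z; auto.
Qed.
End OneStep.

(** Its only set is the whole space, so every set of the first level is linked to it. That set has
    no radius bound, and distance estimates begin with stage 1. *)
Definition stage0 (y : T) : stage X T :=
  {| st_index := unit; st_pt := fun _ => y; st_set := fun _ _ => True;
     st_bump := fun _ _ => 1; st_map := fun _ => y |}.

Fixpoint stages (lv : nat -> level X T) (y : T) (k m : nat) : stage X T :=
  match m with
  | O => stage0 y
  | S m => step (stages lv y k m) _ (lv_pt (lv m)) (lv_set (lv m)) (lv_bump (lv m) k)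
  end.

(** Where the bumps of levels 0 to [m] are all 1, stage [m + 1] takes the centre of level [m] as its
    value, which is close to [f x]; this happens at each point for large [k]. Running [S k] steps
    with the bumps of stage [k] gives the [k]-th approximation. *)
Theorem approximable_by_levels (f : X -> T) :
  path_connected_set d (fun _ => True) ->
  (forall m : nat, exists lv, level_for d f ((/2)^m) lv) ->
  exists fn : nat -> X -> T, (forall n, mcont d (fn n)) /\
    forall x e, 0 < e -> exists N, forall n, (N <= n)%nat -> d (f x) (fn n x) < e.
Proof.
  intros Hpc Hlv.
  destruct (classic (exists x : X, True)) as [[x0 _]|Hempty].
  2:{ exists (fun _ => f). split; intros; [intros x|]; destruct Hempty; exists x; exact I. }
  apply choice in Hlv. destruct Hlv as [lv Hlv].
  set (st := stages lv (f x0)).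
  assert (Hok : forall k m, stage_ok (st k m)).
  { intros k m. induction m as [|m IH].
    - split; simpl; auto.
      + split; [intros; apply (mcont_const Rd_metric)|intros; lra|].
        intros x. exists (fun _ => True). split; [apply open_full|split; auto].
        intros [] []; auto.
      + apply (mcont_const M).
    - apply step_ok; auto; apply (Hlv m). }
  (* One step costs [(/2)^(m+n) + 2 * (/2)^(m+n+1)], which is exactly the difference of consecutive
     bounds. *)
  assert (Hclose : forall k m n x,
    d (st_map (st k (S m)) x) (st_map (st k (S m + n)%nat) x) <= 4 * (/2)^m - 4 * (/2)^(m+n)).
  { intros k m n x. induction n as [|n IH].
    - rewrite !Nat.add_0_r, (metric_refl M). lra.
    - eapply Rle_trans; [apply (metric_tri M _ (st_map (st k (S m + n)%nat) x))|].
      assert (d (st_map (st k (S m + n)%nat) x) (st_map (st k (S m + S n)%nat) x) <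
              (/2)^(m+n) + 2 * (/2)^(m + S n)).
      { replace (S m + S n)%nat with (S (S (m + n))) by lia.
        replace (S m + n)%nat with (S (m + n)) by lia.
        replace (m + S n)%nat with (S (m + n)) by lia.
        apply (step_close (st k (S (m + n)))); try apply half_pow_pos; auto;
          try apply (Hlv (S (m+n))).
        intros [l j]. apply (Hlv (m + n)%nat). }
      replace (m + S n)%nat with (S (m + n)) in * by lia. simpl ((/2)^(S (m+n))) in *.
      lra. }
  exists (fun k => st_map (st k (S k))). split; [intros; apply (Hok n (S n))|].
  intros x.
  assert (Hj : exists j : forall m, lv_index (lv m), forall m, lv_set (lv m) (j m) (f x) /\
     exists K, forall k, (K <= k)%nat -> lv_bump (lv m) k (j m) x = 1).
  { exists (fun m => proj1_sig (constructive_indefinite_description _ (lv_cover _ _ _ _ (Hlv m) x))).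
    intros m. destruct constructive_indefinite_description; auto. }
  destruct Hj as [j Hj].
  assert (Hst : forall m, exists K, forall k, (K <= k)%nat -> exists l,
     st_bump (st k (S m)) (l, j m) x = 1).
  { induction m as [|m [K IH]].
    - destruct (Hj O) as [H1 [K HK]]. exists K. intros k Hk. exists tt.
      simpl st. apply step_bump_1 with (f x); simpl; auto.
    - destruct (Hj (S m)) as [H1 [K' HK]]. exists (Nat.max K K'). intros k Hk.
      destruct (IH k ltac:(lia)) as [l Hl]. exists (l, j m).
      apply (step_bump_1 (st k (S m)) _ (lv_pt (lv (S m)))) with (f x); auto.
      + apply (Hj m).
      + apply HK; lia. }
  (* One fifth for the radius of level [m], four fifths for all later steps. *)
  intros e He. destruct (half_pow_small (e / 5)) as [m Hm]; [lra|].
  specialize (Hm m ltac:(lia)). destruct (Hst m) as [K HK].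
  exists (Nat.max m K). intros k Hk. destruct (HK k ltac:(lia)) as [l Hl].
  assert (Hpt : st_map (st k (S m)) x = lv_pt (lv m) (j m)).
  { apply (st_const _ (Hok k (S m)) (l, j m)). rewrite Hl. lra. }
  pose proof (Hclose k m (k - m)%nat x) as H.
  replace (S m + (k - m))%nat with (S k) in H by lia.
  pose proof (half_pow_pos (m + (k - m))). rewrite Hpt in H.
  pose proof (lv_small _ _ _ _ (Hlv m) (j m) (f x) (proj1 (Hj m))).
  pose proof (metric_tri M (f x) (lv_pt (lv m) (j m)) (st_map (st k (S k)) x)).
  rewrite (metric_sym M (f x) (lv_pt (lv m) (j m))) in *. lra.
Qed.
End Step.

(** * Baire category and H_1 functions on the unit interval *)

Definition complete {T : Type} (d : T -> T -> R) : Prop :=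
  forall u : nat -> T,
    (forall eps, 0 < eps -> exists N, forall m n, (N <= m)%nat -> (N <= n)%nat ->
                  d (u m) (u n) < eps) ->
    exists l, forall eps, 0 < eps -> exists N, forall n, (N <= n)%nat -> d (u n) l < eps.

Lemma complete_geometric {T : Type} {d : T -> T -> R} (M : metric d) (u : nat -> T) C :
  complete d -> (forall n, d (u n) (u (S n)) <= C * (/2)^n) ->
  exists l, forall n, d (u n) l <= 2 * C * (/2)^n.
Proof.
  intros HC Hu.
  assert (H0 : 0 <= C).
  { specialize (Hu O). simpl in Hu. pose proof (metric_ge0 M (u O) (u 1%nat)). lra. }
  assert (H : forall n k, d (u n) (u (n + k)%nat) <= 2 * C * (/2)^n - 2 * C * (/2)^(n+k)).
  { intros n k. induction k as [|k IH].
    - rewrite Nat.add_0_r, (metric_refl M). lra.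
    - eapply Rle_trans; [apply (metric_tri M _ (u (n + k)%nat))|].
      replace (n + S k)%nat with (S (n + k)) by lia. specialize (Hu (n + k)%nat).
      simpl ((/2)^(S (n+k))). lra. }
  assert (H' : forall n m, (n <= m)%nat -> d (u n) (u m) <= 2 * C * (/2)^n).
  { intros n m Hm. specialize (H n (m - n)%nat). replace (n + (m - n))%nat with m in H by lia.
    pose proof (half_pow_pos m). nra. }
  destruct (HC u) as [l Hl].
  - intros e He. destruct (half_pow_small (e / (4 * (C + 1)))) as [N HN].
    { apply Rdiv_lt_0_compat; lra. }
    exists N. intros m n Hm Hn. specialize (HN N ltac:(lia)).
    pose proof (H' N m Hm). pose proof (H' N n Hn).
    pose proof (metric_tri M (u m) (u N) (u n)). rewrite (metric_sym M (u m) (u N)) in *.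
    apply Rmult_lt_compat_r with (r := 4 * (C + 1)) in HN; [|lra].
    unfold Rdiv in HN. rewrite Rmult_assoc, Rinv_l, Rmult_1_r in HN; [|lra].
    pose proof (half_pow_pos N). nra.
  - exists l. intros n. apply Rnot_lt_le. intros Hn.
    destruct (Hl (d (u n) l - 2 * C * (/2)^n)) as [N HN]; [lra|].
    specialize (HN (Nat.max N n) ltac:(lia)). pose proof (H' n (Nat.max N n) ltac:(lia)).
    pose proof (metric_tri M (u n) (u (Nat.max N n)) l). lra.
Qed.

(** Relative form for a closed [K]: if no [F n] contained a piece of [K], shrinking balls centred in
    [K] could avoid the [F n] one after another, and their centres would converge to an uncovered
    point of [K]. *)
Theorem Baire_category {T : Type} {d : T -> T -> R} (M : metric d) (K : T -> Prop)
  (F : nat -> T -> Prop) :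
  complete d -> metric_open d (fun x => ~ K x) -> (exists x, K x) ->
  (forall n, metric_open d (fun x => ~ F n x)) -> (forall x, K x -> exists n, F n x) ->
  exists n x r, 0 < r /\ K x /\ forall y, K y -> d x y < r -> F n y.
Proof.
  intros HC HK [x0 Kx0] HF Hcov. apply NNPP. intros Hno.
  assert (Hnext : forall q : nat * (T * R), exists p' : T * R,
    0 < snd (snd q) -> K (fst (snd q)) ->
    K (fst p') /\ 0 < snd p' <= snd (snd q) / 2 /\
    forall z, d (fst p') z <= snd p' -> d (fst (snd q)) z < snd (snd q) /\ ~ F (fst q) z).
  { intros [n [x r]]. simpl.
    destruct (classic (0 < r /\ K x)) as [[Hr Kx]|Hn];
      [|exists (x, r); intros; tauto].
    destruct (classic (exists y, K y /\ d x y < r /\ ~ F n y)) as [[y [Ky [Hy Fy]]]|Hn].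
    - destruct (HF n y Fy) as [s [Hs HsF]].
      set (r' := Rmin (r / 2) (Rmin ((r - d x y) / 2) (s / 2))).
      assert (0 < r' /\ r' <= r / 2 /\ r' <= (r - d x y) / 2 /\ r' <= s / 2) as [? [? [? ?]]].
      { unfold r', Rmin. repeat destruct Rle_dec; lra. }
      exists (y, r'). intros _ _. simpl. split; auto. split; [lra|].
      intros z Hz. split; [pose proof (metric_tri M x y z); lra|]. apply HsF. lra.
    - exfalso. apply Hno. exists n, x, r. split; auto. split; auto.
      intros y Ky Hy. apply NNPP. intros Fy. apply Hn. eauto. }
  apply choice in Hnext. destruct Hnext as [next Hnext].
  set (p := fix p n := match n with O => (x0, 1) | S n => next (n, p n) end).
  assert (Hp : forall n, K (fst (p n)) /\ 0 < snd (p n) <= (/2)^n).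
  { induction n as [|n [H1 H2]]; simpl; [split; auto; lra|].
    destruct (Hnext (n, p n)) as [H3 [H4 _]]; simpl; auto; [lra|]. simpl in *. split; auto; lra. }
  assert (Hs : forall n z, d (fst (p (S n))) z <= snd (p (S n)) ->
                d (fst (p n)) z < snd (p n) /\ ~ F n z).
  { intros n. destruct (Hp n) as [H1 [H2 _]]. apply (Hnext (n, p n) H2 H1). }
  assert (Hin : forall k n z, d (fst (p (n + k)%nat)) z <= snd (p (n + k)%nat) ->
                  d (fst (p n)) z <= snd (p n)).
  { induction k as [|k IH]; intros n z Hz.
    - now rewrite Nat.add_0_r in Hz.
    - apply IH. replace (n + S k)%nat with (S (n + k)) in Hz by lia. apply Hs in Hz. lra. }
  destruct (complete_geometric M (fun n => fst (p n)) 1 HC) as [l Hl].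
  { intros n. destruct (Hp n). assert (d (fst (p n)) (fst (p (S n))) < snd (p n)); [|lra].
    apply Hs. rewrite (metric_refl M). destruct (Hp (S n)). lra. }
  assert (Hlim : forall n, d (fst (p n)) l <= snd (p n)).
  { intros n. apply Rnot_lt_le. intros H.
    destruct (half_pow_small ((d (fst (p n)) l - snd (p n)) / 2)) as [N HN]; [lra|].
    specialize (HN (n + N)%nat ltac:(lia)). specialize (Hl (n + N)%nat). cbn beta in Hl.
    assert (d (fst (p n)) (fst (p (n + N)%nat)) <= snd (p n)).
    { apply (Hin N). rewrite (metric_refl M). destruct (Hp (n + N)%nat). lra. }
    pose proof (metric_tri M (fst (p n)) (fst (p (n + N)%nat)) l). lra. }
  assert (Kl : K l).
  { apply NNPP. intros nK. destruct (HK l nK) as [e [He H]].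
    destruct (half_pow_small (e / 2)) as [N HN]; [lra|]. specialize (HN N ltac:(lia)).
    specialize (Hl N). cbn beta in Hl. apply (H (fst (p N))).
    - rewrite (metric_sym M). lra.
    - apply Hp. }
  destruct (Hcov l Kl) as [n Fn]. destruct (Hs n l (Hlim (S n))) as [_ H]. auto.
Qed.

Lemma I01_complete : complete I01_dist.
Proof.
  intros u Hu.
  destruct (R_complete (fun n => proj1_sig (u n))) as [l Hl].
  { intros e He. destruct (Hu e He) as [N HN]. exists N. intros n m Hn Hm.
    apply (HN n m Hn Hm). }
  assert (Hb : 0 <= l <= 1).
  { split; apply Rnot_lt_le; intros H.
    - destruct (Hl (- l)) as [N HN]; [lra|]. specialize (HN N ltac:(lia)).
      unfold Rdist in HN. pose proof (proj2_sig (u N)). apply Rabs_def2 in HN. lra.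
    - destruct (Hl (l - 1)) as [N HN]; [lra|]. specialize (HN N ltac:(lia)).
      unfold Rdist in HN. pose proof (proj2_sig (u N)). apply Rabs_def2 in HN. lra. }
  exists (exist _ l Hb). exact Hl.
Qed.

(** Clamped fractions: the rationals of [0,1], with repetitions. *)
Definition dense01 (n : nat) : I01 :=
  clampI (INR (fst (of_nat n)) / (INR (snd (of_nat n)) + 1)).

Lemma nat_floor x : 0 <= x -> exists n, INR n <= x < INR n + 1.
Proof.
  intros Hx. destruct (archimed x) as [H1 H2].
  assert (0 < up x)%Z by (apply lt_IZR; lra).
  exists (Z.to_nat (up x - 1)). rewrite INR_IZR_INZ, Z2Nat.id by lia.
  rewrite minus_IZR. lra.
Qed.

Lemma dense01_dense (x : I01) e : 0 < e -> exists n, I01_dist (dense01 n) x < e.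
Proof.
  intros He. destruct (inv_INR_small e He) as [b Hb]. specialize (Hb b ltac:(lia)).
  pose proof (pos_INR b). destruct x as [x Hx].
  destruct (nat_floor (x * (INR b + 1))) as [a Ha]; [nra|].
  exists (to_nat (a, b)). unfold dense01, I01_dist. rewrite cancel_of_to. simpl.
  eapply Rle_lt_trans; [|exact Hb]. rewrite <- (clamp_id x) by lra.
  eapply Rle_trans; [apply clamp_lip|].
  assert (x = (x * (INR b + 1)) / (INR b + 1)) as E by (field; lra).
  assert (INR a / (INR b + 1) <= x).
  { rewrite E. apply Rmult_le_compat_r; [left; apply Rinv_0_lt_compat|]; lra. }
  assert (x <= INR a / (INR b + 1) + / (INR b + 1)).
  { rewrite E. apply Rle_trans with ((INR a + 1) / (INR b + 1)).
    - apply Rmult_le_compat_r; [left; apply Rinv_0_lt_compat|]; lra.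
    - right. field. lra. }
  apply Rd_le. lra.
Qed.

Definition ball01 (n : nat) (x : I01) : Prop :=
  I01_dist (dense01 (fst (of_nat n))) x < / (INR (snd (of_nat n)) + 1).

Lemma ball01_open n : metric_open I01_dist (ball01 n).
Proof. exact (ball_open I01_metric _ _). Qed.

Lemma ball01_base (x : I01) r : 0 < r ->
  exists n, ball01 n x /\ forall y, ball01 n y -> I01_dist x y < r.
Proof.
  intros Hr. destruct (inv_INR_small (r/2)) as [b Hb]; [lra|]. specialize (Hb b ltac:(lia)).
  destruct (dense01_dense x (/ (INR b + 1))) as [a Ha].
  { apply Rinv_0_lt_compat. pose proof (pos_INR b). lra. }
  exists (to_nat (a, b)). unfold ball01. rewrite cancel_of_to. simpl. split; auto.
  intros y Hy. pose proof (metric_tri I01_metric x (dense01 a) y).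
  rewrite (metric_sym I01_metric x (dense01 a)) in *. lra.
Qed.

(** * Separability of the range of an H_1 function *)

Lemma separated_closed {T : Type} {d : T -> T -> R} (M : metric d) (u : nat -> T) e :
  0 < e -> (forall m n, m <> n -> e <= d (u m) (u n)) ->
  metric_open d (fun y => forall n, y <> u n).
Proof.
  intros He Hu y Hy. destruct (classic (exists n, d y (u n) < e / 2)) as [[n Hn]|Hno].
  - exists (Rmin (e/2) (d y (u n))). split.
    + apply Rmin_pos; [lra|]. destruct (metric_ge0 M y (u n)) as [H|H]; auto.
      destruct (Hy n). now apply (metric_eq0 M).
    + intros z Hz m ->. pose proof (Rmin_l (e/2) (d y (u n))).
      pose proof (Rmin_r (e/2) (d y (u n))).
      destruct (Nat.eq_dec m n) as [->|ne]; [lra|]. specialize (Hu m n ne).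
      pose proof (metric_tri M (u m) y (u n)). rewrite (metric_sym M (u m) y) in *. lra.
  - exists (e/2). split; [lra|]. intros z Hz m ->. eauto.
Qed.

Section Separable.
Context {Y : TopSpace} {d : Y -> Y -> R} (M : metric d)
  (HO : forall U : Y -> Prop, is_open U <-> metric_open d U)
  (f : I01 -> Y) (Hf : Hclass1 f).

Definition small (eps : R) (A : I01 -> Prop) : Prop :=
  exists c : nat -> Y, forall x, A x -> exists n, d (c n) (f x) < eps.

Lemma small_sub eps (A B : I01 -> Prop) : (forall x, A x -> B x) -> small eps B -> small eps A.
Proof. intros H [c Hc]. exists c. auto. Qed.

Lemma small_Union eps (A : nat -> I01 -> Prop) :
  (forall n, small eps (A n)) -> small eps (fun x => exists n, A n x).
Proof.
  intros H. apply choice in H. destruct H as [c Hc].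
  exists (fun m => c (fst (of_nat m)) (snd (of_nat m))).
  intros x [n Hx]. destruct (Hc n x Hx) as [k Hk]. exists (to_nat (n, k)).
  now rewrite cancel_of_to.
Qed.

Lemma small_union eps (A B : I01 -> Prop) :
  small eps A -> small eps B -> small eps (fun x => A x \/ B x).
Proof.
  intros HA HB. apply small_sub with (fun x => exists n : nat, match n with O => A x | _ => B x end).
  - intros x [H|H]; [exists 0%nat|exists 1%nat]; auto.
  - apply small_Union. intros [|n]; auto.
Qed.

(* If the range of [f] were not coverable by countably many [eps]-balls, then on the
   perfect kernel [K] of nowhere-small points one could choose two disjoint countable
   sets, both dense in [K], whose images together are [eps]-separated.  The
   preimages of these images are disjoint G_delta sets, both dense in [K]. *)
Lemma Hclass1_small eps : 0 < eps -> small eps (fun _ => True).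
Proof.
  intros He. apply NNPP. intros Hns.
  set (K := fun x => forall n, ball01 n x -> ~ small eps (ball01 n)).
  assert (HnK : small eps (fun x => ~ K x)).
  { apply small_sub with
      (fun x => exists n, ball01 n x /\ small eps (ball01 n)).
    - intros x Hx. apply NNPP. intros H. apply Hx. intros n Hn Hs. apply H. eauto.
    - apply small_Union. intros n. destruct (classic (small eps (ball01 n))) as [H|H].
      + apply small_sub with (ball01 n); tauto.
      + exists (fun _ => f I01_zero). tauto. }
  assert (HKns : ~ small eps K).
  { intros H. apply Hns. apply small_sub with (2 := small_union _ _ _ H HnK).
    intros x _. apply classic. }
  assert (HKn : forall n z, K z -> ball01 n z -> ~ small eps (fun x => K x /\ ball01 n x)).
  { intros n z Kz Jz H. apply (Kz n Jz).
    apply small_sub with (2 := small_union _ _ _ H HnK).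
    intros x Jx. destruct (classic (K x)); tauto. }
  assert (Hns_list : forall A (l : list I01), ~ small eps A ->
    exists x, A x /\ forall y, List.In y l -> eps <= d (f y) (f x)).
  { intros A l HA. apply NNPP. intros Hn. apply HA.
    (* Otherwise the images of a finite list, padded by a default point, would be centres of balls
       covering the image of [A]. *)
    exists (fun n => f (List.nth n l I01_zero)). intros x Ax. apply NNPP. intros H.
    apply Hn. exists x. split; auto. intros y Hy. apply Rnot_lt_le. intros Hlt.
    apply H. destruct (List.In_nth l y I01_zero Hy) as [n [_ <-]]. eauto. }
  assert (Hpk : forall q : list I01 * nat, exists x, K x /\
     ((exists z, K z /\ ball01 (snd q) z) -> ball01 (snd q) x) /\
     forall y, List.In y (fst q) -> eps <= d (f y) (f x)).
  { intros [l n]. simpl. destruct (classic (exists z, K z /\ ball01 n z)) as [[z [Kz Jz]]|Hn].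
    - destruct (Hns_list _ l (HKn n z Kz Jz)) as [x [[? ?] ?]]. exists x; auto.
    - destruct (Hns_list _ l HKns) as [x [? ?]]. exists x. tauto. }
  apply choice in Hpk. destruct Hpk as [pk Hpk].
  (* [Nat.div2] lets each basic ball be visited at one even and one odd index, so both halves of the
     sequence are dense in [K]. *)
  set (pts := fix pts n := match n with
                           | O => nil | S n => cons (pk (pts n, Nat.div2 n)) (pts n) end).
  set (xs := fun n => pk (pts n, Nat.div2 n)).
  assert (Hin : forall m n, (m < n)%nat -> List.In (xs m) (pts n)).
  { intros m n. induction 1; simpl; auto. }
  assert (Hsep : forall m n, m <> n -> eps <= d (f (xs m)) (f (xs n))).
  { assert (H : forall m n, (m < n)%nat -> eps <= d (f (xs m)) (f (xs n))).
    { intros m n Hmn. apply (Hpk (pts n, Nat.div2 n)). simpl. auto. }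
    intros m n Hne. destruct (Nat.lt_total m n) as [|[|]]; [auto|lia|].
    rewrite (metric_sym M); auto. }
  (* The image of each half is separated, hence closed, so the points mapped outside it form an
     F_sigma set because [f] is in H_1. *)
  assert (HF : forall i, exists Fn : nat -> I01 -> Prop, (forall n, is_closed (Fn n)) /\
     forall x, (forall n, f x <> f (xs (2 * n + i)%nat)) <-> exists n, Fn n x).
  { intros i. apply (Hf (fun y => forall n, y <> f (xs (2 * n + i)%nat))). apply HO.
    apply (separated_closed M (fun n => f (xs (2 * n + i)%nat)) eps He).
    intros m n Hmn. apply Hsep. lia. }
  destruct (HF 0%nat) as [F0 [F0c HF0]]. destruct (HF 1%nat) as [F1 [F1c HF1]].
  destruct (Baire_category I01_metric K
    (fun n => match fst (of_nat n) with O => F0 | _ => F1 end (snd (of_nat n))))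
    as [n [x [r [Hr [Kx H]]]]].
  - exact I01_complete.
  - intros x Hx.
    assert (exists n, ball01 n x /\ small eps (ball01 n)) as [n [Jn Hs]].
    { apply NNPP. intros H. apply Hx. intros n Hn Hs. apply H. eauto. }
    destruct (ball01_open n x Jn) as [e [He' H]]. exists e. split; auto.
    intros y Hy Ky. exact (Ky n (H y Hy) Hs).
  - exists (xs O). apply Hpk.
  - intros n. destruct (fst (of_nat n)); [apply F0c|apply F1c].
  - intros x _.
    assert ((exists n, F0 n x) \/ exists n, F1 n x) as [[n Hn]|[n Hn]].
    { rewrite <- HF0, <- HF1. apply NNPP. intros H. apply not_or_and in H.
      destruct H as [H0 H1]. apply not_all_ex_not in H0, H1.
      destruct H0 as [a Ha], H1 as [b Hb]. apply NNPP in Ha, Hb.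
      specialize (Hsep (2 * a + 0)%nat (2 * b + 1)%nat ltac:(lia)).
      rewrite <- Ha, <- Hb, (metric_refl M) in Hsep. lra. }
    + exists (to_nat (0%nat, n)). now rewrite cancel_of_to.
    + exists (to_nat (1%nat, n)). now rewrite cancel_of_to.
  (* A relatively open piece of [K] inside one of these closed sets would contain a chosen point of
     the very half that the set avoids. *)
  - destruct (ball01_base x r Hr) as [k [Jx Hk]].
    assert (Hxs : forall i, Nat.div2 i = k -> K (xs i) /\ I01_dist x (xs i) < r).
    { intros i Hi. unfold xs. destruct (Hpk (pts i, Nat.div2 i)) as [H1 [H2 _]].
      simpl in H2. rewrite Hi in *. split; auto. apply Hk. apply H2. eauto. }
    destruct (fst (of_nat n)).
    + destruct (Hxs (2 * k)%nat) as [K0 D0]; [apply Nat.div2_double|].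
      specialize (H _ K0 D0). apply (proj2 (HF0 _) (ex_intro _ _ H) k).
      now rewrite Nat.add_0_r.
    + destruct (Hxs (S (2 * k))) as [K0 D0]; [apply Nat.div2_succ_double|].
      specialize (H _ K0 D0). apply (proj2 (HF1 _) (ex_intro _ _ H) k).
      now rewrite Nat.add_1_r.
Qed.

(** Countably many balls suffice for the range, so each family can have a single member, a closed
    piece of a ball's preimage, with the whole interval as its neighbourhood. *)
Lemma Hclass1_Sigma_f : Sigma_f f.
Proof.
  assert (Hc : forall m : nat, exists c : nat -> Y, forall x, exists n,
             d (c n) (f x) < / (INR m + 1)).
  { intros m. destruct (Hclass1_small (/ (INR m + 1))) as [c Hc].
    - apply Rinv_0_lt_compat. pose proof (pos_INR m). lra.
    - exists c. auto. }
  apply choice in Hc. destruct Hc as [c Hc].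
  set (B := fun q : nat * nat => fun y => d (c (fst q) (snd q)) y < / (INR (fst q) + 1)).
  assert (HF : forall q, F_sigma (fun x => B q (f x))).
  { intros q. apply Hf. apply HO. exact (ball_open M _ _). }
  apply choice in HF. destruct HF as [F HF].
  exists (fun _ => unit), (fun t _ => F (of_nat (fst (of_nat t))) (snd (of_nat t))). split.
  - intros t. exists (fun _ _ => True). split; [|split; auto].
    + intros x. exists (fun _ => True). split; [apply open_full|split; auto].
      intros [] []; auto.
    + intros _. apply functionally_open_iff. exists (fun _ => 1).
      split; [apply (mcont_const Rd_metric)|]. split; intros; lra || (split; auto; lra).
  - intros V oV. exists (fun t _ => forall y, B (of_nat (fst (of_nat t))) y -> V y).
    intros x; split.
    + intros Vx. apply HO in oV. destruct (oV _ Vx) as [e [He H]].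
      destruct (inv_INR_small (e/2)) as [m Hm]; [lra|]. specialize (Hm m ltac:(lia)).
      destruct (Hc m x) as [n Hn].
      destruct (proj1 (proj2 (HF (m, n)) x)) as [k Hk]; [exact Hn|].
      exists (to_nat (to_nat (m, n), k)), tt.
      repeat (rewrite cancel_of_to; cbn [fst snd]). split; auto.
      intros y Hy. apply H. unfold B in Hy. simpl in Hy.
      pose proof (metric_tri M (f x) (c m n) y). rewrite (metric_sym M (f x) (c m n)) in *. lra.
    + intros [t [_ [H1 H2]]]. apply H1. apply (proj2 (HF _)). eauto.
Qed.
End Separable.

Lemma closed_functionally_closed01 (F : I01 -> Prop) : is_closed F -> functionally_closed F.
Proof.
  intros HF. apply functionally_closed_iff.
  exists (bdist I01_metric F). split; [|split].
  - intros x e He. destruct (bdist_continuous I01_metric F x e He) as [r [Hr H]].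
    exists (fun y => I01_dist x y < r). split; [exact (ball_open I01_metric x r)|].
    rewrite (metric_refl I01_metric). auto.
  - apply bdist_bounds.
  - intros x. split; [apply bdist_in|]. intros H0. apply NNPP. intros Hn.
    destruct (HF x Hn) as [e [He H]].
    assert (Rmin e 1 <= bdist I01_metric F x); [|assert (0 < Rmin e 1) by (apply Rmin_pos; lra); lra].
    assert (0 < Rmin e 1) by (apply Rmin_pos; lra).
    apply bdist_ge; [pose proof (Rmin_r e 1); lra|].
    intros a Fa. apply Rle_trans with e; [apply Rmin_l|]. apply Rnot_lt_le. intros H'.
    exact (H a H' Fa).
Qed.

Lemma Hclass1_Kclass1 {Y : TopSpace} (f : I01 -> Y) : Hclass1 f <-> Kclass1 f.
Proof.
  split; intros Hf V oV; destruct (Hf V oV) as [F [HF H]]; exists F; split; auto; intros n.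
  - apply closed_functionally_closed01, HF.
  - apply functionally_closed_closed, HF.
Qed.

(** * Arcs in paths *)

Definition closedR (K : R -> Prop) : Prop := metric_open Rd (fun x => ~ K x).

Lemma closedR_and (A B : R -> Prop) :
  closedR A -> closedR B -> closedR (fun x => A x /\ B x).
Proof.
  intros HA HB x Hx. apply not_and_or in Hx. destruct Hx as [Hx|Hx].
  - destruct (HA x Hx) as [e [He H]]. exists e. split; auto. intros y Hy [? _]. exact (H y Hy H0).
  - destruct (HB x Hx) as [e [He H]]. exists e. split; auto. intros y Hy [_ ?]. exact (H y Hy H0).
Qed.

Lemma closedR_all (A : nat -> R -> Prop) :
  (forall n, closedR (A n)) -> closedR (fun x => forall n, A n x).
Proof.
  intros HA x Hx. apply not_all_ex_not in Hx. destruct Hx as [n Hn].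
  destruct (HA n x Hn) as [e [He H]]. exists e. split; auto. intros y Hy Hall.
  exact (H y Hy (Hall n)).
Qed.

Lemma closedR_le g c : mcontinuous Rd Rd g -> closedR (fun x => g x <= c).
Proof.
  intros Hg x Hx. destruct (Hg x (g x - c)) as [r [Hr H]]; [lra|]. exists r. split; auto.
  intros y Hy. specialize (H y Hy). apply Rd_lt in H. lra.
Qed.

Lemma closedR_ge g c : mcontinuous Rd Rd g -> closedR (fun x => c <= g x).
Proof.
  intros Hg x Hx. destruct (Hg x (c - g x)) as [r [Hr H]]; [lra|]. exists r. split; auto.
  intros y Hy. specialize (H y Hy). apply Rd_lt in H. lra.
Qed.

Lemma id_continuous : mcontinuous Rd Rd (fun x => x).
Proof. intros x e He. exists e. auto. Qed.

Lemma closedR_unit : closedR (fun x => 0 <= x <= 1).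
Proof.
  apply closedR_and; [apply (closedR_ge (fun x => x))|apply (closedR_le (fun x => x))];
    exact id_continuous.
Qed.

Lemma closedR_max (K : R -> Prop) b : closedR K -> (exists x, K x) -> (forall x, K x -> x <= b) ->
  exists m, K m /\ forall x, K x -> x <= m.
Proof.
  intros HK Hne Hb. destruct (completeness K) as [m [H1 H2]]; [exists b; exact Hb|exact Hne|].
  exists m. split; [|exact H1]. apply NNPP. intros Hm. destruct (HK m Hm) as [e [He H]].
  assert (m <= m - e); [|lra]. apply H2. intros x Kx. apply Rnot_lt_le. intros Hx.
  apply (H x); auto. apply Rd_lt. specialize (H1 x Kx). lra.
Qed.

Lemma closedR_min (K : R -> Prop) b : closedR K -> (exists x, K x) -> (forall x, K x -> b <= x) ->
  exists m, K m /\ forall x, K x -> m <= x.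
Proof.
  intros HK [x Kx] Hb. destruct (closedR_max (fun x => K (- x)) (- b)) as [m [H1 H2]].
  - intros y Hy. destruct (HK (- y) Hy) as [e [He H]]. exists e. split; auto.
    intros z Hz. apply H. apply Rd_lt. apply Rd_lt in Hz. lra.
  - exists (- x). now rewrite Ropp_involutive.
  - intros y Ky. specialize (Hb _ Ky). lra.
  - exists (- m). split; auto. intros y Ky. specialize (H2 (- y)).
    rewrite Ropp_involutive in H2. specialize (H2 Ky). lra.
Qed.

Lemma nested_closed (C : nat -> R -> Prop) :
  (forall n, closedR (C n)) -> (forall n x, C (S n) x -> C n x) ->
  (forall n x, C n x -> 0 <= x <= 1) -> (forall n, exists x, C n x) ->
  exists x, forall n, C n x.
Proof.
  intros Hc Hd Hb Hne.
  assert (Hw : forall n, exists w, C n w /\ forall x, C n x -> x <= w).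
  { intros n. apply (closedR_max _ 1); auto. intros x Hx. apply Hb in Hx. lra. }
  apply choice in Hw. destruct Hw as [w Hw].
  assert (Hd' : forall m n x, (m <= n)%nat -> C n x -> C m x) by (induction 1; auto).
  destruct (completeness (fun y => exists n, y = - w n)) as [l [H1 H2]].
  - exists 0. intros y [n ->]. destruct (Hw n) as [H _]. apply Hb in H. lra.
  - exists (- w 0%nat). eauto.
  - exists (- l). intros m. apply NNPP. intros Hm. destruct (Hc m _ Hm) as [e [He H]].
    assert (l <= l - e); [|lra]. apply H2. intros y [n ->]. apply Rnot_lt_le. intros Hn.
    set (k := Nat.max n m).
    apply (H (w k)).
    + assert (- w k <= l) by (apply H1; eauto).
      assert (w k <= w n) by (apply (Hw n), (Hd' n k); [lia|apply Hw]).
      apply Rd_lt. lra.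
    + apply (Hd' m k); [lia|apply Hw].
Qed.

Section MinimalSet.
Context {T : Type} {d : T -> T -> R} (M : metric d) (p : R -> T) (Hp : mcontinuous Rd d p).

Definition last_before (K : R -> Prop) (c u : R) : Prop :=
  K u /\ u <= c /\ forall w, K w -> w <= c -> w <= u.

Definition first_after (K : R -> Prop) (c v : R) : Prop :=
  K v /\ c <= v /\ forall w, K w -> c <= w -> v <= w.

(* Cutting the gaps of [K] out of the parameter interval erases loops from the path [p]. *)
Record loops_cut (K : R -> Prop) : Prop := {
  lc_closed : closedR K;
  lc_0 : K 0;
  lc_1 : K 1;
  lc_unit : forall x, K x -> 0 <= x <= 1;
  lc_gap : forall c u v, last_before K c u -> first_after K c v -> p u = p v }.

Lemma last_before_exists K c : loops_cut K -> 0 <= c -> exists u, last_before K c u.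
Proof.
  intros HK Hc. destruct (closedR_max (fun x => K x /\ x <= c) c) as [u [[H1 H2] H3]].
  - apply closedR_and; [apply HK|]. apply (closedR_le (fun x => x)), id_continuous.
  - exists 0. split; auto. apply HK.
  - tauto.
  - exists u. split; auto.
Qed.

Lemma first_after_exists K c : loops_cut K -> c <= 1 -> exists v, first_after K c v.
Proof.
  intros HK Hc. destruct (closedR_min (fun x => K x /\ c <= x) c) as [u [[H1 H2] H3]].
  - apply closedR_and; [apply HK|]. apply (closedR_ge (fun x => x)), id_continuous.
  - exists 1. split; auto. apply HK.
  - tauto.
  - exists u. split; auto.
Qed.

(** By compactness the gap of [K n] around [c] shrinks, at both ends, to the gap of the
    intersection; equality of the two end values passes to the limit by continuity of [p]. *)
Lemma loops_cut_inter (K : nat -> R -> Prop) :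
  (forall n, loops_cut (K n)) -> (forall n x, K (S n) x -> K n x) ->
  loops_cut (fun x => forall n, K n x).
Proof.
  intros HK Hd.
  assert (Hd' : forall m n x, (m <= n)%nat -> K n x -> K m x) by (induction 1; auto).
  split.
  - apply closedR_all. intros n; apply HK.
  - intros n; apply HK.
  - intros n; apply HK.
  - intros x Hx. apply (HK 0%nat), Hx.
  - intros c u v [Ku [Hu Hu']] [Kv [Hv Hv']].
    apply NNPP. intros Hne.
    assert (He : 0 < d (p u) (p v)).
    { destruct (metric_ge0 M (p u) (p v)) as [H|H]; auto. destruct Hne. now apply (metric_eq0 M). }
    destruct (Hp u (d (p u) (p v) / 2)) as [r [Hr Hru]]; [lra|].
    destruct (Hp v (d (p u) (p v) / 2)) as [r' [Hr' Hrv]]; [lra|].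
    assert (exists n, forall w, K n w -> w <= c -> w < u + r) as [n Hn].
    { apply NNPP. intros H.
      destruct (nested_closed (fun n x => K n x /\ u + r <= x <= c)) as [w Hw].
      - intros n. apply closedR_and; [apply HK|].
        apply closedR_and; [apply (closedR_ge (fun x => x))|apply (closedR_le (fun x => x))];
          apply id_continuous.
      - intuition.
      - intros n x [Kx _]. now apply (HK n).
      - intros n. apply NNPP. intros H'. apply H. exists n. intros w Kw Hw.
        apply Rnot_le_lt. intros H3. apply H'. exists w. auto.
      - assert (w <= u); [|specialize (Hw 0%nat); lra].
        apply Hu'; [intros n; apply Hw|apply (Hw 0%nat)]. }
    assert (exists n, forall w, K n w -> c <= w -> v - r' < w) as [n' Hn'].
    { apply NNPP. intros H.
      destruct (nested_closed (fun n x => K n x /\ c <= x <= v - r')) as [w Hw].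
      - intros m. apply closedR_and; [apply HK|].
        apply closedR_and; [apply (closedR_ge (fun x => x))|apply (closedR_le (fun x => x))];
          apply id_continuous.
      - intuition.
      - intros m x [Kx _]. now apply (HK m).
      - intros m. apply NNPP. intros H'. apply H. exists m. intros w Kw Hw.
        apply Rnot_le_lt. intros H3. apply H'. exists w. auto.
      - assert (v <= w); [|specialize (Hw 0%nat); lra].
        apply Hv'; [intros m; apply Hw|apply (Hw 0%nat)]. }
    set (m := Nat.max n n').
    assert (0 <= c <= 1) as [Hc0 Hc1].
    { pose proof (lc_unit _ (HK 0%nat) u (Ku 0%nat)).
      pose proof (lc_unit _ (HK 0%nat) v (Kv 0%nat)). lra. }
    destruct (last_before_exists (K m) c (HK m) Hc0) as [u1 [Ku1 [Hu1 Hu1']]].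
    destruct (first_after_exists (K m) c (HK m) Hc1) as [v1 [Kv1 [Hv1 Hv1']]].
    assert (E : p u1 = p v1) by (apply (lc_gap _ (HK m) c); split; auto).
    assert (u <= u1 < u + r).
    { split; [apply Hu1'; auto|]. apply Hn; auto. apply (Hd' n m); auto; unfold m; lia. }
    assert (v - r' < v1 <= v).
    { split; [|apply Hv1'; auto]. apply Hn'; auto. apply (Hd' n' m); auto; unfold m; lia. }
    specialize (Hru u1). specialize (Hrv v1). rewrite <- E in Hrv.
    assert (d (p u) (p u1) < d (p u) (p v) / 2) by (apply Hru, Rd_lt; lra).
    assert (d (p v) (p u1) < d (p u) (p v) / 2) by (apply Hrv, Rd_lt; lra).
    pose proof (metric_tri M (p u) (p u1) (p v)). rewrite (metric_sym M (p u1) (p v)) in *. lra.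
Qed.

Definition ballR (n : nat) (x : R) : Prop :=
  Rd (proj1_sig (dense01 (fst (of_nat n)))) x < / (INR (snd (of_nat n)) + 1).

(* Brouwer's reduction: run through a countable base, avoiding each
   basic interval whenever possible. *)
Lemma minimal_loops_cut : exists K, loops_cut K /\
  forall K', loops_cut K' -> (forall x, K' x -> K x) -> forall x, K x -> K' x.
Proof.
  assert (Hnext : forall q : nat * (R -> Prop), exists K' : R -> Prop, loops_cut (snd q) ->
    loops_cut K' /\ (forall x, K' x -> snd q x) /\
    ((exists K'', loops_cut K'' /\ (forall x, K'' x -> snd q x) /\
        forall y, K'' y -> ~ ballR (fst q) y) -> forall y, K' y -> ~ ballR (fst q) y)).
  { intros [n K]. simpl. destruct (classic (exists K'', loops_cut K'' /\
      (forall x, K'' x -> K x) /\ forall y, K'' y -> ~ ballR n y)) as [[K'' [H1 [H2 H3]]]|H].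
    - exists K''. auto.
    - exists K. tauto. }
  apply choice in Hnext. destruct Hnext as [next Hnext].
  set (K := fix K n := match n with O => fun x => 0 <= x <= 1 | S n => next (n, K n) end).
  assert (HK : forall n, loops_cut (K n)).
  { induction n as [|n IH].
    - split; simpl; [apply closedR_unit|lra|lra|auto|].
      intros c u v [Ku [Hu Hu']] [Kv [Hv Hv']]. f_equal.
      assert (c <= u) by (apply Hu'; lra). assert (v <= c) by (apply Hv'; lra). lra.
    - apply (Hnext (n, K n) IH). }
  assert (Hdec : forall n x, K (S n) x -> K n x) by (intros n; apply (Hnext (n, K n) (HK n))).
  exists (fun x => forall n, K n x). split; [now apply loops_cut_inter|].
  intros K' HK' Hsub x Kx. apply NNPP. intros Hx.
  destruct (lc_closed _ HK' x Hx) as [e [He H]].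
  (* A point of [K] outside [K'] has a basic interval missing [K']. When that interval was treated,
     [K'] was an admissible choice, so [K] would miss it as well. *)
  destruct (ball01_base (exist _ x (lc_unit _ (HK 0%nat) x (Kx 0%nat))) e He) as [n [H1 H2]].
  apply (proj2 (proj2 (Hnext (n, K n) (HK n)))) with x.
  - exists K'. split; auto. split; [intros y Hy; now apply Hsub|].
    intros y K'y Hy. apply (H y); auto.
    exact (H2 (exist _ y (lc_unit _ HK' y K'y)) Hy).
  - exact (Kx (S n)).
  - exact H1.
Qed.

(** A gap around a point of the excised interval has the ends [u] and [v]; every other gap is a gap
    of [K]. *)
Lemma loops_cut_excise K u v : loops_cut K -> K u -> K v -> p u = p v ->
  loops_cut (fun x => K x /\ ~ (u < x < v)).
Proof.
  intros HK Ku Kv E. pose proof (lc_unit _ HK u Ku). pose proof (lc_unit _ HK v Kv).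
  destruct (Rlt_le_dec u v) as [Huv|Huv].
  2:{ split.
      - apply closedR_and; [apply HK|]. intros x Hx. exfalso. apply Hx. lra.
      - split; [apply HK|lra].
      - split; [apply HK|lra].
      - intros x [Kx _]. now apply HK.
      - intros c a b [[Ka _] [Ha Ha']] [[Kb _] [Hb Hb']]. apply (lc_gap _ HK c).
        + split; auto. split; auto. intros w Kw. apply Ha'. split; auto. lra.
        + split; auto. split; auto. intros w Kw. apply Hb'. split; auto. lra. }
  split.
  - apply closedR_and; [apply HK|]. intros x Hx. apply NNPP in Hx.
    exists (Rmin (x - u) (v - x)). split; [apply Rmin_pos; lra|].
    intros y Hy. apply Rd_lt in Hy. pose proof (Rmin_l (x - u) (v - x)).
    pose proof (Rmin_r (x - u) (v - x)). lra.
  - split; [apply HK|lra].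
  - split; [apply HK|lra].
  - intros x [Kx _]. now apply HK.
  - intros c a b [[Ka Hna] [Ha Ha']] [[Kb Hnb] [Hb Hb']].
    assert (Hu : u <= c -> u <= a) by (intros; apply Ha'; auto; split; auto; lra).
    assert (Hv : v <= c -> v <= a) by (intros; apply Ha'; auto; split; auto; lra).
    assert (Hu2 : c <= u -> b <= u) by (intros; apply Hb'; auto; split; auto; lra).
    assert (Hv2 : c <= v -> b <= v) by (intros; apply Hb'; auto; split; auto; lra).
    destruct (classic (u < c < v)) as [Hc|Hc].
    + assert (a = u) by lra. assert (b = v) by lra. congruence.
    + apply (lc_gap _ HK c).
      * split; auto. split; auto. intros w Kw Hw.
        destruct (classic (u < w < v)); [lra|]. apply Ha'; auto.
      * split; auto. split; auto. intros w Kw Hw.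
        destruct (classic (u < w < v)); [lra|]. apply Hb'; auto.
Qed.

(** [l x] is the last point of the minimal [K] up to [x]. By [loops_cut_excise] no point of [K] lies
    strictly between two points of [K] with equal image, so the fibres become intervals. At points
    of [K] continuity follows by squeezing [l] from the right and [r], which has the same image,
    from the left; inside a gap the map is constant. *)
Lemma monotone_light_path : p 0 <> p 1 -> exists P : R -> T,
  mcontinuous Rd d P /\ P 0 = p 0 /\ P 1 = p 1 /\ (forall x, exists s, P x = p s) /\
  forall x y z, 0 <= x -> x <= z -> z <= y -> y <= 1 -> P x = P y -> P z = P x.
Proof.
  intros Hne. destruct minimal_loops_cut as [K [HK Hmin]].
  assert (Hlight : forall u v w, K u -> K v -> K w -> p u = p v -> u < w < v -> False).
  { intros u v w Ku Kv Kw E Hw.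
    destruct (Hmin _ (loops_cut_excise K u v HK Ku Kv E)) with w as [_ H]; tauto. }
  assert (Hl : forall x, exists u, last_before K (clamp x) u).
  { intros x. apply last_before_exists; auto. apply clamp_bounds. }
  assert (Hr : forall x, exists u, first_after K (clamp x) u).
  { intros x. apply first_after_exists; auto. apply clamp_bounds. }
  apply choice in Hl, Hr. destruct Hl as [l Hl], Hr as [r Hr].
  assert (Hlr : forall x, p (l x) = p (r x)) by (intros x; apply (lc_gap _ HK (clamp x)); auto).
  assert (HlK : forall x, K (clamp x) -> l x = clamp x).
  { intros x Kx. destruct (Hl x) as [_ [H1 H2]]. specialize (H2 _ Kx). lra. }
  exists (fun x => p (l x)). split; [|split; [|split; [|split]]].
  - intros x e He. destruct (classic (K (clamp x))) as [Kx|Kx].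
    + rewrite (HlK x Kx). destruct (Hp (clamp x) e He) as [s [Hs H]].
      exists s. split; auto. intros y Hy. pose proof (clamp_lip x y) as Hc.
      assert (Rd (clamp x) (clamp y) < s) as Hc' by lra. apply Rd_lt in Hc'.
      destruct (Rle_lt_dec (clamp x) (clamp y)) as [Hxy|Hxy].
      * apply H. destruct (Hl y) as [_ [H1 H2]]. specialize (H2 _ Kx Hxy). apply Rd_lt. lra.
      * rewrite Hlr. apply H. destruct (Hr y) as [_ [H1 H2]]. specialize (H2 _ Kx ltac:(lra)).
        apply Rd_lt. lra.
    + destruct (Hl x) as [Kl [Hl1 Hl2]]. destruct (Hr x) as [Kr [Hr1 Hr2]].
      assert (l x <> clamp x) by congruence. assert (r x <> clamp x) by congruence.
      exists (Rmin (clamp x - l x) (r x - clamp x)). split; [apply Rmin_pos; lra|].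
      intros y Hy. pose proof (Rmin_l (clamp x - l x) (r x - clamp x)).
      pose proof (Rmin_r (clamp x - l x) (r x - clamp x)). pose proof (clamp_lip x y).
      assert (Rd (clamp x) (clamp y) < Rmin (clamp x - l x) (r x - clamp x)) as Hc by lra.
      apply Rd_lt in Hc. replace (l y) with (l x); [rewrite (metric_refl M); auto|].
      destruct (Hl y) as [Kly [Hy1 Hy2]]. specialize (Hy2 (l x) Kl ltac:(lra)).
      destruct (Rle_lt_dec (l y) (clamp x)) as [H5|H5].
      * specialize (Hl2 _ Kly H5). lra.
      * specialize (Hr2 _ Kly ltac:(lra)). lra.
  - rewrite HlK; rewrite clamp_id by lra; auto. apply HK.
  - rewrite HlK; rewrite clamp_id by lra; auto. apply HK.
  - eauto.
  - intros x y z Hx Hxz Hzy Hy E.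
    assert (Hm : forall a b, 0 <= a -> a <= b -> b <= 1 -> l a <= l b).
    { intros a b H1 H2 H3. destruct (Hl a) as [Ka [Ha _]]. destruct (Hl b) as [_ [_ Hb]].
      rewrite clamp_id in * by lra. apply Hb; auto; lra. }
    pose proof (Hm x z ltac:(lra) Hxz ltac:(lra)). pose proof (Hm z y ltac:(lra) Hzy ltac:(lra)).
    destruct (Req_dec (l z) (l x)) as [->|Hn1]; auto.
    destruct (Req_dec (l z) (l y)) as [->|Hn2]; auto.
    exfalso. apply (Hlight (l x) (l y) (l z)); try apply Hl; auto. lra.
Qed.
End MinimalSet.

(** * Running maxima of bounded continuous functions *)

Section RunningMax.
Context (h : R -> R) (Hh : mcontinuous Rd Rd h) (Hb : forall s, 0 <= h s <= 1).

Lemma running_max_exists x :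
  exists l, is_lub (fun r => exists s, 0 <= s <= clamp x /\ r = h s) l.
Proof.
  destruct (completeness (fun r => exists s, 0 <= s <= clamp x /\ r = h s)) as [l Hl].
  - exists 1. intros r [s [_ ->]]. apply Hb.
  - exists (h 0), 0. pose proof (clamp_bounds x). split; auto; lra.
  - eauto.
Qed.

Definition running_max (x : R) : R :=
  proj1_sig (constructive_indefinite_description _ (running_max_exists x)).

Lemma running_max_ge x s : 0 <= s <= clamp x -> h s <= running_max x.
Proof.
  intros Hs. unfold running_max. destruct constructive_indefinite_description as [l Hl].
  simpl. apply (proj1 Hl). eauto.
Qed.

Lemma running_max_le x c : (forall s, 0 <= s <= clamp x -> h s <= c) -> running_max x <= c.
Proof.
  intros Hs. unfold running_max. destruct constructive_indefinite_description as [l Hl].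
  simpl. apply (proj2 Hl). intros r [s [Hs' ->]]; auto.
Qed.

Lemma running_max_mono x y : clamp x <= clamp y -> running_max x <= running_max y.
Proof. intros H. apply running_max_le. intros s Hs. apply running_max_ge. lra. Qed.

Lemma running_max_bounds x : 0 <= running_max x <= 1.
Proof.
  pose proof (clamp_bounds x). split.
  - apply Rle_trans with (h 0); [apply Hb|apply running_max_ge; lra].
  - apply running_max_le. intros; apply Hb.
Qed.

Lemma running_max_continuous : mcontinuous Rd Rd running_max.
Proof.
  intros x e He. destruct (Hh (clamp x) (e/3)) as [r [Hr H]]; [lra|].
  exists r. split; auto. intros y Hy.
  assert (Rd (clamp x) (clamp y) < r) as Hc by (pose proof (clamp_lip x y); lra).
  pose proof (H _ Hc) as Hxy. apply Rd_lt in Hc. apply Rd_lt in Hxy.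
  pose proof (clamp_bounds x). pose proof (clamp_bounds y).
  apply Rd_lt. destruct (Rle_lt_dec (clamp x) (clamp y)) as [Hle|Hlt].
  - pose proof (running_max_mono x y Hle).
    assert (running_max y <= running_max x + e/3); [|lra].
    apply running_max_le. intros s Hs. destruct (Rle_lt_dec s (clamp x)).
    + pose proof (running_max_ge x s). lra.
    + assert (Rd (clamp x) s < r) as Hs' by (apply Rd_lt; lra).
      apply H, Rd_lt in Hs'. pose proof (running_max_ge x (clamp x)). lra.
  - pose proof (running_max_mono y x ltac:(lra)).
    assert (running_max x <= running_max y + 2 * (e/3)); [|lra].
    apply running_max_le. intros s Hs. destruct (Rle_lt_dec s (clamp y)).
    + pose proof (running_max_ge y s). lra.
    + assert (Rd (clamp x) s < r) as Hs' by (apply Rd_lt; lra).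
      apply H, Rd_lt in Hs'. pose proof (running_max_ge y (clamp y)). lra.
Qed.
End RunningMax.

Lemma mcontinuous_continuity g : mcontinuous Rd Rd g -> continuity g.
Proof.
  intros Hg x e He. destruct (Hg x e He) as [r [Hr H]]. exists r. split; auto.
  intros y [_ Hy]. simpl in *. unfold Rdist in *. rewrite Rabs_minus_sym. apply H.
  unfold Rd. now rewrite Rabs_minus_sym.
Qed.

Lemma mcontinuous_comp {A B C : Type} {dA : A -> A -> R} {dB : B -> B -> R} {dC : C -> C -> R}
  (g : A -> B) (h : B -> C) :
  mcontinuous dA dB g -> mcontinuous dB dC h -> mcontinuous dA dC (fun x => h (g x)).
Proof.
  intros Hg Hh x e He. destruct (Hh (g x) e He) as [r [Hr H]].
  destruct (Hg x r Hr) as [r' [Hr' H']]. exists r'. auto.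
Qed.

Lemma dist_continuous {T : Type} {d : T -> T -> R} (M : metric d) a :
  mcontinuous d Rd (fun x => d x a).
Proof.
  intros x e He. exists e. split; auto. intros y Hy. apply Rd_lt.
  pose proof (metric_tri M x y a). pose proof (metric_tri M y x a).
  rewrite (metric_sym M y x) in *. lra.
Qed.

Lemma affine_continuous a b : mcontinuous Rd Rd (fun x => a * x + b).
Proof. apply RT_mcont. apply (@rcont_affine RT (fun x => x)). apply RT_mcont, id_continuous. Qed.

(** * Injective reparametrization of a path with interval fibres *)

Section Reparametrization.
Context {T : Type} {d : T -> T -> R} (M : metric d) (P : R -> T) (HP : mcontinuous Rd d P)
  (Hlight : forall x y z, 0 <= x -> x <= z -> z <= y -> y <= 1 -> P x = P y -> P z = P x)
  (Hne : P 0 <> P 1).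

Let rat (n : nat) : R := proj1_sig (dense01 n).

(** Watches how far [P] moves away from its position at time [rat n]; it is 0 up to that time. *)
Definition departure (n : nat) (s : R) : R := Rmin 1 (d (P (Rmax s (rat n))) (P (rat n))).

Lemma departure_bounds n s : 0 <= departure n s <= 1.
Proof.
  unfold departure. pose proof (metric_ge0 M (P (Rmax s (rat n))) (P (rat n))).
  unfold Rmin; destruct Rle_dec; lra.
Qed.

Lemma departure_continuous n : mcontinuous Rd Rd (departure n).
Proof.
  apply RT_mcont. apply (@rcont_min RT); [apply (mcont_const Rd_metric)|].
  apply RT_mcont. apply (mcontinuous_comp (dB := d) (fun s => P (Rmax s (rat n))) (fun y => d y (P (rat n)))).
  - apply (mcontinuous_comp (dB := Rd) (fun s => Rmax s (rat n)) P); auto.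
    apply RT_mcont. apply (@rcont_max RT); [apply RT_mcont, id_continuous|].
    apply (mcont_const Rd_metric).
  - apply (dist_continuous M).
Qed.

(* A continuous nondecreasing function which is constant exactly where [P] is. *)
Definition progress (x : R) : R :=
  wsum (fun n => running_max (departure n) (departure_bounds n) x).

Lemma progress_bounds x : 0 <= progress x <= 1.
Proof. apply wsum_bounds. intros; apply running_max_bounds. Qed.

Lemma progress_continuous : mcontinuous Rd Rd progress.
Proof.
  apply RT_mcont. apply (@rcont_wsum RT).
  - intros n. apply RT_mcont, running_max_continuous, departure_continuous.
  - intros; apply running_max_bounds.
Qed.

Lemma progress_incr x y n : clamp x <= clamp y ->
  progress x + (running_max _ (departure_bounds n) y - running_max _ (departure_bounds n) x)
    * (/2)^(S n) <= progress y.
Proof.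
  intros H. unfold progress.
  apply (wsum_mono (fun n => running_max _ (departure_bounds n) x)
                   (fun n => running_max _ (departure_bounds n) y) n);
    intros; try apply running_max_bounds. now apply running_max_mono.
Qed.

(** [P] is constant on [x,y]. A departure time up to [y] sees only values on which [P] agrees; a
    later one still gives 0. Hence no running maximum grows. *)
Lemma progress_const x y : 0 <= x -> x <= y -> y <= 1 -> P x = P y -> progress x = progress y.
Proof.
  intros Hx Hxy Hy E. unfold progress. f_equal. extensionality n.
  apply Rle_antisym; [apply running_max_mono; rewrite !clamp_id; lra|].
  apply running_max_le. rewrite clamp_id by lra. intros s Hs.
  destruct (Rle_lt_dec s x) as [Hsx|Hsx].
  - apply running_max_ge. rewrite clamp_id; lra.
  - replace (departure n s) with (departure n x).
    + apply running_max_ge. rewrite clamp_id; lra.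
    + unfold departure. f_equal. f_equal.
      destruct (Rle_lt_dec (rat n) y).
      * rewrite (Hlight x y (Rmax x (rat n))), (Hlight x y (Rmax s (rat n))); auto;
          unfold Rmax; repeat destruct Rle_dec; lra.
      * now rewrite !Rmax_right by lra.
Qed.

(** For a rational time just after [x], [P] is still closer to [P x] than [P y] is. Its departure is
    0 at [x] and positive at [y], so this one summand grows strictly. *)
Lemma progress_sep x y : 0 <= x -> x <= y -> y <= 1 -> progress x = progress y -> P x = P y.
Proof.
  intros Hx Hxy Hy E. apply NNPP. intros Hn.
  assert (Hd : 0 < d (P x) (P y)).
  { destruct (metric_ge0 M (P x) (P y)) as [H|H]; auto. destruct Hn. now apply (metric_eq0 M). }
  assert (x < y) as Hlt by (destruct Hxy; auto; subst; congruence).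
  destruct (HP x _ Hd) as [r [Hr H]].
  set (eta := Rmin r (y - x) / 2).
  assert (0 < eta /\ 2 * eta <= r /\ 2 * eta <= y - x) as [He1 [He2 He3]].
  { unfold eta, Rmin. destruct Rle_dec; lra. }
  assert (Hxe : 0 <= x + eta <= 1) by lra.
  destruct (dense01_dense (exist _ (x + eta) Hxe) eta He1) as [n Hq].
  assert (x < rat n < x + 2 * eta) as Hrat.
  { change (Rabs (rat n - (x + eta)) < eta) in Hq. apply Rabs_def2 in Hq. lra. }
  pose proof (progress_incr x y n ltac:(rewrite !clamp_id; lra)) as Hi.
  assert (running_max _ (departure_bounds n) x <= 0).
  { apply running_max_le. rewrite clamp_id by lra. intros s Hs. unfold departure.
    rewrite Rmax_right by lra. rewrite (metric_refl M). apply Rmin_r. }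
  assert (d (P x) (P (rat n)) < d (P x) (P y)) by (apply H, Rd_lt; lra).
  assert (0 < departure n y).
  { unfold departure. rewrite Rmax_left by lra. apply Rmin_pos; [lra|].
    pose proof (metric_tri M (P x) (P (rat n)) (P y)). rewrite (metric_sym M (P (rat n)) (P y)) in *.
    lra. }
  pose proof (running_max_ge _ (departure_bounds n) y y ltac:(rewrite clamp_id; lra)).
  pose proof (half_pow_pos (S n)). nra.
Qed.

Lemma progress_fiber x y : 0 <= x <= 1 -> 0 <= y <= 1 -> progress x = progress y <-> P x = P y.
Proof.
  intros Hx Hy. destruct (Rle_lt_dec x y).
  - split; [apply progress_sep|apply progress_const]; lra.
  - split; intros E; symmetry; [apply progress_sep|apply progress_const]; lra || auto.
Qed.

Lemma progress_grows : progress 0 < progress 1.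
Proof.
  pose proof (progress_incr 0 1 0%nat ltac:(rewrite !clamp_id; lra)).
  pose proof (running_max_mono _ (departure_bounds 0) 0 1 ltac:(rewrite !clamp_id; lra)).
  pose proof (half_pow_pos 1).
  destruct (Req_dec (progress 0) (progress 1)) as [E|E].
  - destruct Hne. apply progress_fiber; auto; lra.
  - nra.
Qed.

Lemma progress_onto t : exists x, 0 <= x <= 1 /\
  progress x = progress 0 + clamp t * (progress 1 - progress 0).
Proof.
  pose proof progress_grows as Hg. pose proof (clamp_bounds t).
  set (v := progress 0 + clamp t * (progress 1 - progress 0)).
  destruct (IVT_cor (fun x => progress x - v) 0 1) as [x [Hx Hv]].
  - apply mcontinuous_continuity. apply RT_mcont.
    apply (@rcont_ext RT (fun x => 1 * progress x + - v)); [intros; ring|].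
    apply (@rcont_affine RT). apply RT_mcont, progress_continuous.
  - lra.
  - unfold v. set (c := clamp t) in *. set (g := progress 1 - progress 0) in *.
    replace ((progress 0 - (progress 0 + c * g)) * (progress 1 - (progress 0 + c * g)))
      with (- ((c * g) * ((1 - c) * g))) by (unfold g; ring).
    assert (0 < g) by (unfold g; lra).
    assert (0 <= (c * g) * ((1 - c) * g)); [|lra].
    repeat apply Rmult_le_pos; lra.
  - exists x. split; auto. lra.
Qed.

(** [x t] is any parameter of normalized progress [t] and may jump, but [P (x t)] does not:
    parameters with progress tending to that of [x t0] and images far from [P (x t0)] would
    accumulate at one with equal progress and a different image. *)
Lemma arc_of_light_path : exists q : R -> T,
  mcontinuous Rd d q /\ q 0 = P 0 /\ q 1 = P 1 /\ (forall t, exists s, q t = P s) /\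
  forall s t, 0 <= s <= 1 -> 0 <= t <= 1 -> q s = q t -> s = t.
Proof.
  destruct (choice _ progress_onto) as [x Hx].
  pose proof progress_grows as Hg. pose proof (progress_bounds 0). pose proof (progress_bounds 1).
  exists (fun t => P (x t)). split; [|split; [|split; [|split]]].
  - intros t0 e He. destruct (Hx t0) as [Hx0 Hp0].
    set (C := fun n s => (0 <= s <= 1) /\ e <= d (P s) (P (x t0)) /\
                 (- / (INR n + 1) + progress (x t0) <= progress s /\
                  progress s <= / (INR n + 1) + progress (x t0))).
    assert (Hpos : forall n, 0 < / (INR n + 1)).
    { intros n. apply Rinv_0_lt_compat. pose proof (pos_INR n). lra. }
    assert (exists n, forall s, ~ C n s) as [n Hn].
    { apply NNPP. intros Hall. destruct (nested_closed C) as [s Hs].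
      - intros n. apply closedR_and; [apply closedR_unit|].
        apply closedR_and; [|apply closedR_and].
        + apply (closedR_ge (fun s => d (P s) (P (x t0)))).
          apply (mcontinuous_comp (dB := d) P (fun y => d y (P (x t0)))); auto. apply (dist_continuous M).
        + apply (closedR_ge progress), progress_continuous.
        + apply (closedR_le progress), progress_continuous.
      - intros n s [H1 [H2 H3]]. split; auto. split; auto.
        assert (/ (INR (S n) + 1) <= / (INR n + 1)); [|lra].
        apply Rinv_le_contravar; pose proof (pos_INR n); rewrite ?S_INR; lra.
      - intros n s Hs. apply Hs.
      - intros n. apply NNPP. intros H'. apply Hall. exists n. intros s Hs. eauto.
      - assert (Hps : progress s = progress (x t0)).
        { apply NNPP. intros Hd.
          destruct (inv_INR_small (Rabs (progress s - progress (x t0)))) as [n Hn].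
          { apply Rabs_pos_lt. lra. }
          specialize (Hn n ltac:(lia)). destruct (Hs n) as [_ [_ H3]].
          revert Hn. unfold Rabs. destruct Rcase_abs; lra. }
        destruct (Hs 0%nat) as [H1 [H2 _]]. apply progress_fiber in Hps; auto.
        rewrite Hps, (metric_refl M) in H2. lra. }
    exists (/ (INR n + 1)). split; auto. intros t Ht. apply Rnot_le_lt. intros Hle.
    destruct (Hx t) as [Hxt Hpt]. apply (Hn (x t)). split; auto. split.
    + now rewrite (metric_sym M).
    + assert (Hc : Rd (clamp t0) (clamp t) < / (INR n + 1)) by (pose proof (clamp_lip t0 t); lra).
      (* Progress varies no faster than [clamp t], since the scaling factor
         [progress 1 - progress 0] is at most 1. *)
      apply Rd_lt in Hc. rewrite Hpt, Hp0. nra.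
  - destruct (Hx 0) as [H1 H2]. apply progress_fiber; auto; [lra|].
    rewrite H2, clamp_id; lra.
  - destruct (Hx 1) as [H1 H2]. apply progress_fiber; auto; [lra|].
    rewrite H2, clamp_id; lra.
  - eauto.
  - intros s t Hs Ht E. destruct (Hx s) as [H1 H2]. destruct (Hx t) as [H3 H4].
    apply progress_fiber in E; auto. rewrite H2, H4, !clamp_id in E by auto.
    apply Rplus_eq_reg_l, Rmult_eq_reg_r in E; lra.
Qed.
End Reparametrization.

Theorem path_arc {Y : TopSpace} {d : Y -> Y -> R} (M : metric d)
  (HO : forall U : Y -> Prop, is_open U <-> metric_open d U) (V : Y -> Prop) a b :
  joined d V a b -> a <> b ->
  exists g : I01 -> Y, is_arc g /\ g I01_zero = a /\ g I01_one = b /\ forall t, V (g t).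
Proof.
  intros [p [Hp [p0 [p1 pV]]]] Hab.
  destruct (monotone_light_path M p Hp) as [P [HP [P0 [P1 [Pp Hl]]]]]; [congruence|].
  destruct (arc_of_light_path M P HP Hl) as [q [Hq [q0 [q1 [qP Hinj]]]]]; [congruence|].
  exists (fun t => q (proj1_sig t)). split; [|split; [|split]].
  - assert (Hi : forall s t : I01, q (proj1_sig s) = q (proj1_sig t) -> s = t).
    { intros [s Hs] [t Ht] E. simpl in E. apply Hinj in E; auto. subst t.
      f_equal. apply proof_irrelevance. }
    split; [|split; [exact Hi|]].
    + apply (continuous_mcont (dY := d) _ M HO). intros t e He.
      destruct (Hq (proj1_sig t) e He) as [r [Hr H]].
      exists (fun s => I01_dist t s < r). split; [exact (ball_open I01_metric t r)|].
      rewrite (metric_refl I01_metric). auto.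
    + intros U oU.
      (* The union of all balls around points of the arc whose trace on the arc comes from [U]. *)
      exists (fun y => exists (t : I01) (r : R), 0 < r /\ d (q (proj1_sig t)) y < r /\
         forall s : I01, d (q (proj1_sig t)) (q (proj1_sig s)) < r -> U s).
      split.
      * apply HO. intros y [t [r [Hr [Hy H]]]].
        exists (r - d (q (proj1_sig t)) y). split; [lra|]. intros z Hz. exists t, r.
        split; auto. split; auto. pose proof (metric_tri M (q (proj1_sig t)) y z). lra.
      * intros t. split.
        -- intros [s [Us E]]. apply Hi in E. subst s.
           set (C := fun n s => (0 <= s <= 1) /\ ~ U (clampI s) /\
                       d (q s) (q (proj1_sig t)) <= / (INR n + 1)).
           (* If every ball around [q t] caught parameters outside [U], compactness would give one
              with image [q t], against injectivity. *)
           assert (exists n, forall s, ~ C n s) as [n Hn].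
           { apply NNPP. intros Hall. destruct (nested_closed C) as [s Hs].
             - intros n. apply closedR_and; [apply closedR_unit|]. apply closedR_and.
               + intros s Hs. apply NNPP in Hs. destruct (oU _ Hs) as [e [He H]].
                 exists e. split; auto. intros s' Hs' Hn. apply Hn, H.
                 eapply Rle_lt_trans; [apply clamp_lip|exact Hs'].
               + apply (closedR_le (fun s => d (q s) (q (proj1_sig t)))).
                 apply (mcontinuous_comp (dB := d) q (fun y => d y (q (proj1_sig t)))); auto.
                 apply (dist_continuous M).
             - intros n s [H1 [H2 H3]]. split; auto. split; auto.
               eapply Rle_trans; [exact H3|].
               apply Rinv_le_contravar; pose proof (pos_INR n); rewrite ?S_INR; lra.
             - intros n s Hs. apply Hs.
             - intros n. apply NNPP. intros H'. apply Hall. exists n. intros s Hs. eauto.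
             - destruct (Hs 0%nat) as [H1 [H2 _]]. apply H2.
               replace (clampI s) with t; auto. apply Hi. simpl. rewrite clamp_id by auto.
               apply (metric_eq0 M). apply Rle_antisym; [|apply (metric_ge0 M)].
               apply Rnot_lt_le. intros Hpos. rewrite (metric_sym M) in Hpos.
               destruct (inv_INR_small _ Hpos) as [n Hn]. specialize (Hn n ltac:(lia)).
               destruct (Hs n) as [_ [_ H3]]. lra. }
           exists t, (/ (INR n + 1)).
           assert (0 < / (INR n + 1)) by (apply Rinv_0_lt_compat; pose proof (pos_INR n); lra).
           split; auto. split; [rewrite (metric_refl M); auto|].
           intros s Hs. apply NNPP. intros Hn'. apply (Hn (proj1_sig s)). split; [apply proj2_sig|].
           split; [|rewrite (metric_sym M); lra].
           replace (clampI (proj1_sig s)) with s; auto. apply Hi. simpl.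
           rewrite clamp_id; auto. apply proj2_sig.
        -- intros [s [r [Hr [Hs H]]]]. exists t. auto.
  - simpl. congruence.
  - simpl. congruence.
  - intros t. destruct (qP (proj1_sig t)) as [s ->]. destruct (Pp s) as [s' ->]. auto.
Qed.

(** * Completing paths with gaps *)

Section FillingGaps.
Context {T : Type} {d : T -> T -> R} (M : metric d).

(** The approximations [filled] jump at their gaps. Instead of continuity they carry a bound on
    local oscillation, which tends to 0 with the gaps and makes the uniform limit continuous. *)
Definition oscillates_le (r : R) (g : R -> T) : Prop :=
  forall t, exists e, 0 < e /\ forall s, Rd t s < e -> d (g t) (g s) <= r.

Lemma oscillates_glue r a (g h : R -> T) : g a = h a ->
  oscillates_le r g -> oscillates_le r h ->
  oscillates_le r (fun t => if Rlt_dec t a then g t else h t).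
Proof.
  intros E Hg Hh t. destruct (Hg t) as [e1 [He1 H1]]. destruct (Hh t) as [e2 [He2 H2]].
  destruct (total_order_T t a) as [[H|H]|H].
  - exists (Rmin e1 (a - t)). split; [apply Rmin_pos; lra|]. intros s Hs.
    pose proof (Rmin_l e1 (a - t)). pose proof (Rmin_r e1 (a - t)).
    destruct Rlt_dec; [|lra]. destruct Rlt_dec; [apply H1; lra|].
    apply Rd_lt in Hs. lra.
  - subst t. exists (Rmin e1 e2). split; [apply Rmin_pos; lra|]. intros s Hs.
    pose proof (Rmin_l e1 e2). pose proof (Rmin_r e1 e2).
    destruct (Rlt_dec a a); [lra|]. destruct Rlt_dec; [|apply H2; lra].
    rewrite <- E. apply H1. lra.
  - exists (Rmin e2 (t - a)). split; [apply Rmin_pos; lra|]. intros s Hs.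
    pose proof (Rmin_l e2 (t - a)). pose proof (Rmin_r e2 (t - a)).
    destruct Rlt_dec; [lra|]. destruct Rlt_dec; [|apply H2; lra].
    apply Rd_lt in Hs. lra.
Qed.

Lemma oscillates_affine r (g : R -> T) a b :
  oscillates_le r g -> oscillates_le r (fun t => g (a * t + b)).
Proof.
  intros Hg t. destruct (Hg (a * t + b)) as [e [He H]].
  destruct (affine_continuous a b t e He) as [e' [He' H']]. exists e'. auto.
Qed.

Lemma oscillates_ext r (g h : R -> T) : (forall t, g t = h t) ->
  oscillates_le r g -> oscillates_le r h.
Proof.
  intros E Hg t. destruct (Hg t) as [e [He H]]. exists e. split; auto.
  intros s Hs. rewrite <- !E. auto.
Qed.

(** [delta] is chosen before [z] and [eta]: the tolerance at the far end is dictated by the next gap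
    there and may depend on [z]. *)
Definition near_paths : Prop := forall c e, 0 < e -> exists delta, 0 < delta /\
  forall z, d c z < delta -> forall eta, 0 < eta ->
  exists p, mcontinuous Rd d p /\ (forall t, d c (p t) < e) /\ d c (p 0) < eta /\ d z (p 1) < eta.

(* [filled n] joins [c] to [z] by a path with 2^n gaps.  A gap, occupying the parameter
   interval [0,1], is filled on its middle third by a path almost joining
   its ends; this leaves two much smaller gaps. *)
Fixpoint filled (path : T -> T -> R -> R -> T) (n : nat) (c z : T) (e : R) (t : R) : T :=
  match n with
  | O => if Rlt_dec t (1/2) then c else z
  | S n =>
    if Rlt_dec t (1/3) then filled path n c (path c z e 0) (e/2) (3 * t)
    else if Rlt_dec t (2/3) then path c z e (3 * t - 1)
    (* The last third is run backwards from [z], because the threshold that makes the gap fillable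
       belongs to [z] and not to the end of the path. *)
    else filled path n z (path c z e 1) (e/2) (3 - 3 * t)
  end.

Lemma filled_ends path n : forall c z e t,
  (t <= 0 -> filled path n c z e t = c) /\ (1 <= t -> filled path n c z e t = z).
Proof.
  induction n as [|n IH]; intros c z e t; simpl; split; intros Ht.
  - destruct Rlt_dec; lra || auto.
  - destruct Rlt_dec; lra || auto.
  - destruct Rlt_dec; [|lra]. apply IH. lra.
  - destruct Rlt_dec; [lra|]. destruct Rlt_dec; [lra|]. apply IH. lra.
Qed.

(** Each path is chosen to end within the thresholds [D c (e/2)] and [D z (e/2)], so both new gaps
    satisfy the same hypothesis with half the radius. Distances between consecutive approximations
    and oscillations then halve at each step, and completeness yields a continuous limit. *)
Lemma near_paths_joined : complete d -> near_paths ->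
  forall c e, 0 < e -> exists delta, 0 < delta /\
  forall z, d c z < delta -> joined d (fun y => d c y < e) c z.
Proof.
  intros HC HQ.
  assert (HD : forall q : T * R, exists delta, 0 < snd q -> 0 < delta <= snd q /\
    forall z, d (fst q) z < delta -> forall eta, 0 < eta ->
    exists p, mcontinuous Rd d p /\ (forall t, d (fst q) (p t) < snd q) /\
              d (fst q) (p 0) < eta /\ d z (p 1) < eta).
  { intros [c e]. simpl. destruct (Rlt_le_dec 0 e) as [He|He]; [|exists 0; lra].
    destruct (HQ c e He) as [delta [Hd H]]. exists (Rmin delta e). intros _.
    split; [split; [apply Rmin_pos; auto|apply Rmin_r]|].
    intros z Hz. apply H. pose proof (Rmin_l delta e). lra. }
  apply choice in HD. destruct HD as [D' HD']. set (D := fun c e => D' (c, e)).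
  assert (HD : forall c e, 0 < e -> 0 < D c e <= e /\
    forall z, d c z < D c e -> forall eta, 0 < eta ->
    exists p, mcontinuous Rd d p /\ (forall t, d c (p t) < e) /\
              d c (p 0) < eta /\ d z (p 1) < eta) by (intros c e; apply (HD' (c, e))).
  clearbody D. clear D' HD'.
  assert (Hp : forall q : T * T * R, exists p, 0 < snd q ->
    d (fst (fst q)) (snd (fst q)) < D (fst (fst q)) (snd q) ->
    mcontinuous Rd d p /\ (forall t, d (fst (fst q)) (p t) < snd q) /\
    d (fst (fst q)) (p 0) < D (fst (fst q)) (snd q / 2) /\
    d (snd (fst q)) (p 1) < D (snd (fst q)) (snd q / 2)).
  { intros [[c z] e]. simpl.
    destruct (classic (0 < e /\ d c z < D c e)) as [[He Hz]|Hn];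
      [|exists (fun _ => c); tauto].
    destruct (HD c (e/2)) as [H1 _]; [lra|]. destruct (HD z (e/2)) as [H2 _]; [lra|].
    destruct (HD c e He) as [_ H]. destruct (H z Hz (Rmin (D c (e/2)) (D z (e/2))))
      as [p [Hp1 [Hp2 [Hp3 Hp4]]]]; [apply Rmin_pos; lra|].
    exists p. intros _ _. split; auto. split; auto.
    pose proof (Rmin_l (D c (e/2)) (D z (e/2))). pose proof (Rmin_r (D c (e/2)) (D z (e/2))).
    split; lra. }
  apply choice in Hp. destruct Hp as [path' Hp']. set (path := fun c z e => path' (c, z, e)).
  assert (Hp : forall c z e, 0 < e -> d c z < D c e ->
    mcontinuous Rd d (path c z e) /\ (forall t, d c (path c z e t) < e) /\
    d c (path c z e 0) < D c (e / 2) /\ d z (path c z e 1) < D z (e / 2)).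
  { intros c z e. apply (Hp' (c, z, e)). }
  clearbody path. clear path' Hp'.
  (* In the last third, [d c z < D c e <= e] adds to the inductive bound [2 * (e/2)]; this gives the
     factor 2. *)
  assert (Hnear : forall n c z e t, 0 < e -> d c z < D c e ->
            d c (filled path n c z e t) <= 2 * e).
  { induction n as [|n IH]; intros c z e t He Hz; destruct (HD c e He) as [[_ HDe] _]; simpl.
    - destruct Rlt_dec; [rewrite (metric_refl M)|]; lra.
    - destruct (Hp c z e He Hz) as [_ [H1 [H2 H3]]].
      destruct Rlt_dec; [|destruct Rlt_dec].
      + specialize (IH c (path c z e 0) (e/2) (3 * t) ltac:(lra) H2). lra.
      + specialize (H1 (3 * t - 1)). lra.
      + specialize (IH z (path c z e 1) (e/2) (3 - 3 * t) ltac:(lra) H3).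
        eapply Rle_trans; [apply (metric_tri M c z)|]. lra. }
  assert (Hstep : forall n c z e t, 0 < e -> d c z < D c e ->
            d (filled path n c z e t) (filled path (S n) c z e t) <= 4 * e * (/2)^n).
  { induction n as [|n IH]; intros c z e t He Hz.
    - pose proof (Hnear 0%nat c z e t He Hz). pose proof (Hnear 1%nat c z e t He Hz).
      eapply Rle_trans; [apply (metric_tri M _ c)|]. rewrite (metric_sym M _ c). simpl pow. lra.
    - destruct (Hp c z e He Hz) as [_ [H1 [H2 H3]]].
      remember (S n) as m eqn:Em. rewrite Em at 1 3. simpl filled. simpl pow. subst m.
      pose proof (half_pow_pos n).
      destruct Rlt_dec; [|destruct Rlt_dec].
      + specialize (IH c (path c z e 0) (e/2) (3 * t) ltac:(lra) H2). lra.
      + rewrite (metric_refl M). nra.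
      + specialize (IH z (path c z e 1) (e/2) (3 - 3 * t) ltac:(lra) H3). lra. }
  assert (Hosc : forall n c z e, 0 < e -> d c z < D c e ->
            oscillates_le (e * (/2)^n) (filled path n c z e)).
  { induction n as [|n IH]; intros c z e He Hz.
    - destruct (HD c e He) as [[_ HDe] _]. intros t. exists 1. split; [lra|]. intros s _.
      simpl. pose proof (metric_sym M c z). pose proof (metric_refl M c).
      pose proof (metric_refl M z). repeat destruct Rlt_dec; lra.
    - destruct (Hp c z e He Hz) as [H0 [H1 [H2 H3]]]. simpl filled. simpl pow.
      replace (e * (/2 * (/2)^n)) with (e / 2 * (/2)^n) by (unfold Rdiv; ring).
      apply (oscillates_glue _ _ (fun t => filled path n c (path c z e 0) (e/2) (3 * t))).
      + destruct Rlt_dec; [|lra].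
        rewrite (proj2 (filled_ends path n _ _ _ _)) by lra. f_equal. lra.
      + apply oscillates_ext with (fun t => filled path n c (path c z e 0) (e/2) (3 * t + 0));
          [intros; f_equal; ring|].
        apply (oscillates_affine _ (filled path n c (path c z e 0) (e/2))). apply IH; auto; lra.
      + apply (oscillates_glue _ _ (fun t => path c z e (3 * t - 1))).
        * rewrite (proj2 (filled_ends path n _ _ _ _)) by lra. f_equal. lra.
        * apply (oscillates_affine _ (path c z e) 3 (-1)). intros t.
          destruct (H0 t (e / 2 * (/2)^n)) as [r [Hr H]].
          { pose proof (half_pow_pos n). nra. }
          exists r. split; auto. intros s Hs. left. auto.
        * apply oscillates_ext with
            (fun t => filled path n z (path c z e 1) (e/2) (-3 * t + 3));
            [intros; f_equal; ring|].
          apply (oscillates_affine _ (filled path n z (path c z e 1) (e/2))). apply IH; auto; lra. }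
  (* Staying near [c] costs [2 * e] and passing to the limit [8 * e], together half of [e']. *)
  intros c e' He'. set (e := e' / 20). assert (He : 0 < e) by (unfold e; lra).
  destruct (HD c e He) as [[HD1 HD2] _]. exists (D c e). split; auto. intros z Hz.
  assert (Hlim : forall t, exists l, forall n,
            d (filled path n c z e t) l <= 2 * (4 * e) * (/2)^n).
  { intros t. apply (complete_geometric M (fun n => filled path n c z e t)); auto. }
  apply choice in Hlim. destruct Hlim as [G HG].
  assert (Heq : forall a b, (forall n, d a b <= 2 * (4 * e) * (/2)^n) -> b = a).
  { intros a b H. symmetry. apply (metric_eq0 M). apply Rle_antisym; [|apply (metric_ge0 M)].
    apply Rnot_lt_le. intros Hpos.
    destruct (half_pow_small (d a b / (2 * (4 * e)))) as [n Hn].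
    - apply Rdiv_lt_0_compat; lra.
    - specialize (Hn n ltac:(lia)). specialize (H n).
      apply Rmult_lt_compat_l with (r := 2 * (4 * e)) in Hn; [|lra].
      replace (2 * (4 * e) * (d a b / (2 * (4 * e)))) with (d a b) in Hn by (field; lra). lra. }
  exists G. split; [|split; [|split]].
  - intros t r Hr. destruct (half_pow_small (r / (20 * e))) as [n Hn].
    { apply Rdiv_lt_0_compat; lra. }
    specialize (Hn n ltac:(lia)). apply Rmult_lt_compat_l with (r := 20 * e) in Hn; [|lra].
    replace (20 * e * (r / (20 * e))) with r in Hn by (field; lra).
    destruct (Hosc n c z e He Hz t) as [s [Hs H]]. exists s. split; auto. intros y Hy.
    specialize (H y Hy). pose proof (HG t n). pose proof (HG y n).
    pose proof (metric_tri M (G t) (filled path n c z e t) (G y)).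
    pose proof (metric_tri M (filled path n c z e t) (filled path n c z e y) (G y)).
    rewrite (metric_sym M (G t) (filled path n c z e t)) in *.
    pose proof (half_pow_pos n). assert (0 < e * (/2)^n) by nra. lra.
  - apply Heq. intros n. rewrite <- (proj1 (filled_ends path n c z e 0)) at 1 by lra. apply HG.
  - apply Heq. intros n. rewrite <- (proj2 (filled_ends path n c z e 1)) at 1 by lra. apply HG.
  - intros t. pose proof (HG t 0%nat) as H. pose proof (Hnear 0%nat c z e t He Hz).
    simpl pow in H. pose proof (metric_tri M c (filled path 0 c z e t) (G t)). unfold e in *. lra.
Qed.
End FillingGaps.

(** * Local arcwise connectedness and the equivalence *)

Section Joined.
Context {T : Type} {d : T -> T -> R} (M : metric d).

Lemma joined_mono (V W : T -> Prop) a b : (forall y, V y -> W y) -> joined d V a b -> joined d W a b.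
Proof. intros H [p [? [? [? ?]]]]. exists p. auto. Qed.

Lemma joined_refl (V : T -> Prop) a : V a -> joined d V a a.
Proof.
  intros Va. exists (fun _ => a). repeat split; auto. intros t e He. exists e.
  split; auto. intros. now rewrite (metric_refl M).
Qed.

Lemma joined_sym (V : T -> Prop) a b : joined d V a b -> joined d V b a.
Proof.
  intros [p [Hp [p0 [p1 pV]]]]. exists (fun t => p (-1 * t + 1)).
  split; [exact (mcontinuous_comp _ _ (affine_continuous (-1) 1) Hp)|].
  split; [rewrite <- p1; f_equal; ring|]. split; [rewrite <- p0; f_equal; ring|auto].
Qed.

Lemma joined_trans (V : T -> Prop) a b c : joined d V a b -> joined d V b c -> joined d V a c.
Proof.
  intros H H'. apply joined_mono with (fun y => V y \/ V y); [tauto|].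
  apply joined_concat with b; auto.
Qed.

Lemma joined_initial (V : T -> Prop) (p : R -> T) s :
  mcontinuous Rd d p -> (forall t, V (p t)) -> joined d V (p 0) (p s).
Proof.
  intros Hp pV. exists (fun t => p (s * t + 0)).
  split; [exact (mcontinuous_comp _ _ (affine_continuous s 0) Hp)|].
  split; [f_equal; ring|]. split; [f_equal; ring|auto].
Qed.

(** A function equal to -1 over [U] and 1 over [V] would be continuous along the path, against the
    intermediate value theorem. *)
Lemma path_clopen (p : R -> T) (U V : T -> Prop) :
  mcontinuous Rd d p -> metric_open d U -> metric_open d V ->
  (forall y, U y \/ V y) -> (forall y, ~ (U y /\ V y)) -> U (p 0) -> V (p 1) -> False.
Proof.
  intros Hp oU oV Hc Hd Hu Hv.
  set (h := fun t => if excluded_middle_informative (U (p t)) then -1 else 1).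
  assert (Hh : mcontinuous Rd Rd h).
  { intros t e He.
    assert (exists r, 0 < r /\ forall s, Rd t s < r -> h s = h t) as [r [Hr H]].
    { destruct (Hc (p t)) as [H|H].
      - destruct (oU _ H) as [r [Hr H']]. destruct (Hp t r Hr) as [s [Hs H'']].
        exists s. split; auto. intros y Hy. unfold h.
        repeat destruct excluded_middle_informative; auto; exfalso; auto.
      - destruct (oV _ H) as [r [Hr H']]. destruct (Hp t r Hr) as [s [Hs H'']].
        exists s. split; auto. intros y Hy. unfold h.
        repeat destruct excluded_middle_informative; auto; exfalso; eapply Hd; eauto. }
    exists r. split; auto. intros s Hs. rewrite (H s Hs), (metric_refl Rd_metric). auto. }
  assert (H0 : h 0 = -1) by (unfold h; destruct excluded_middle_informative; tauto).
  assert (H1 : h 1 = 1).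
  { unfold h; destruct excluded_middle_informative; auto. exfalso. eapply Hd; eauto. }
  destruct (IVT_cor h 0 1) as [t [_ Ht]]; [now apply mcontinuous_continuity|lra|rewrite H0, H1; lra|].
  unfold h in Ht. destruct excluded_middle_informative; lra.
Qed.
End Joined.

Lemma I01_mcont {T : Type} {d : T -> T -> R} (g : I01 -> T) :
  mcont d g <-> mcontinuous I01_dist d g.
Proof.
  split; intros H x e He.
  - destruct (H x e He) as [W [oW [Wx HW]]]. destruct (oW x Wx) as [r [Hr H']]. exists r; auto.
  - destruct (H x e He) as [r [Hr H']].
    exists (fun y => I01_dist x y < r). split; [exact (ball_open I01_metric x r)|].
    split; [rewrite (metric_refl I01_metric); lra|auto].
Qed.

Section Metrizable.
Context {Y : TopSpace} {d : Y -> Y -> R} (M : metric d)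
  (HO : forall U : Y -> Prop, is_open U <-> metric_open d U).

(** The neighbourhood is the path component of [x] in [U]. A path in [U] starting in the component
    stays there, as its initial segments show, and so does the arc extracted from it. *)
Lemma locally_path_connected_arcwise :
  (forall c e, 0 < e -> exists delta, 0 < delta /\
     forall z, d c z < delta -> joined d (fun y => d c y < e) c z) ->
  locally_arcwise_connected Y.
Proof.
  intros Hloc x U oU Ux. apply HO in oU. exists (joined d U x).
  split; [|split; [|split]].
  - apply HO. intros y Hy. assert (Uy : U y).
    { destruct Hy as [p [_ [_ [<- H]]]]. apply H. }
    destruct (oU y Uy) as [e [He H]]. destruct (Hloc y e He) as [r [Hr H']].
    exists r. split; auto. intros z Hz. apply joined_trans with y; auto.
    apply joined_mono with (2 := H' z Hz). auto.
  - now apply joined_refl.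
  - intros y [p [_ [_ [<- H]]]]. apply H.
  - intros a b Ha Hb Hab.
    destruct (joined_trans _ _ _ _ (joined_sym _ _ _ Ha) Hb) as [p [Hp [p0 [p1 pU]]]].
    apply (path_arc M HO); auto. exists p. split; auto. split; auto. split; auto.
    intros t. apply joined_trans with a; auto. rewrite <- p0. now apply joined_initial.
Qed.

Lemma arcwise_path_connected (V : Y -> Prop) :
  arcwise_connected_set V -> path_connected_set d V.
Proof.
  intros HV a b Va Vb. destruct (classic (a = b)) as [<-|Hab]; [now apply joined_refl|].
  destruct (HV a b Va Vb Hab) as [g [[Hg _] [g0 [g1 gV]]]].
  exists (fun t => g (clampI t)). split; [|split; [|split]].
  - apply (mcontinuous_comp (dB := I01_dist) clampI g clampI_continuous).
    apply I01_mcont. apply (continuous_mcont (dY := d) g M HO). exact Hg.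
  - rewrite <- g0. f_equal. apply (metric_eq0 I01_metric). unfold I01_dist. simpl.
    rewrite clamp_id by lra. rewrite Rminus_diag. apply Rabs_R0.
  - rewrite <- g1. f_equal. apply (metric_eq0 I01_metric). unfold I01_dist. simpl.
    rewrite clamp_id by lra. rewrite Rminus_diag. apply Rabs_R0.
  - auto.
Qed.

Lemma connected_path_connected :
  connected Y -> locally_arcwise_connected Y -> path_connected_set d (fun _ : Y => True).
Proof.
  intros Hc Hl a b _ _. apply NNPP. intros Hn. apply Hc.
  assert (Hloc : forall y : Y, exists e, 0 < e /\ forall z, d y z < e -> joined d (fun _ => True) y z).
  { intros y. destruct (Hl y (fun _ => True)) as [V [oV [Vy [_ HV]]]]; [apply open_full|auto|].
    apply HO in oV. destruct (oV y Vy) as [e [He H]]. exists e. split; auto.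
    intros z Hz. apply joined_mono with V; auto. apply arcwise_path_connected; auto. }
  exists (joined d (fun _ => True) a), (fun y => ~ joined d (fun _ => True) a y).
  split; [|split; [|split; [|split; [|split]]]].
  - apply HO. intros y Hy. destruct (Hloc y) as [e [He H]]. exists e. split; auto.
    intros z Hz. apply joined_trans with y; auto.
  - apply HO. intros y Hy. destruct (Hloc y) as [e [He H]]. exists e. split; auto.
    intros z Hz Ha. apply Hy. apply joined_trans with z; auto. apply joined_sym; auto.
  - exists a. now apply joined_refl.
  - eauto.
  - intros x. apply classic.
  - intros x. tauto.
Qed.

Theorem Kclass1_Sigma_f_Baire1 {X : TopSpace} (f : X -> Y) :
  connected Y -> locally_arcwise_connected Y -> Kclass1 f -> Sigma_f f -> Baire1 f.
Proof.
  intros Hc Hl HK HS. apply (Baire1_pointwise M HO). apply (approximable_by_levels M).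
  - now apply connected_path_connected.
  - intros m. apply level_exists; auto. intros y. pose proof (half_pow_pos m).
    destruct (Hl y (fun z => d y z < (/2)^m)) as [V [oV [Vy [HV1 HV2]]]].
    + apply HO. exact (ball_open M y _).
    + rewrite (metric_refl M). auto.
    + exists V. split; auto. split; auto. split; auto. now apply arcwise_path_connected.
Qed.
End Metrizable.

(** The identity of [0,1] is a constant sequence's limit, so it is in K_1, and its preimages are the
    open sets themselves. *)
Lemma open_F_sigma01 (O : I01 -> Prop) : is_open O -> F_sigma O.
Proof.
  assert (H : Hclass1 (fun x : I01 => x)).
  { apply Hclass1_Kclass1. apply (Baire1_Kclass1 (Y := I01) I01_metric I01_open_iff).
    exists (fun _ x => x). split; [intros n V; auto|]. intros x V _ Vx. exists 0%nat. auto. }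
  apply H.
Qed.

Lemma F_sigma01_open_countable (O A : I01 -> Prop) (q : nat -> I01) :
  is_open O -> (forall x, O x -> A x) -> (forall x, A x -> O x \/ exists n, x = q n) -> F_sigma A.
Proof.
  intros oO HOA HA. destruct (open_F_sigma01 O oO) as [F [HF HOF]].
  exists (fun m => match fst (of_nat m) with
                   | O => F (snd (of_nat m))
                   | _ => fun x => x = q (snd (of_nat m)) /\ A x end).
  split.
  - intros m. destruct (fst (of_nat m)); [apply HF|].
    set (b := q (snd (of_nat m))). intros x Hx. destruct (classic (x = b)) as [->|Hne].
    + exists 1. split; [lra|]. intros y _ [-> Ay]. tauto.
    + exists (I01_dist x b). split.
      * destruct (metric_ge0 I01_metric x b) as [H|H]; auto.
        destruct Hne. now apply (metric_eq0 I01_metric).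
      * intros y Hy [-> _]. lra.
  - intros x. split.
    + intros Ax. destruct (HA x Ax) as [Ox|[n Hn]].
      * destruct (proj1 (HOF x) Ox) as [n Hn]. exists (to_nat (0%nat, n)). now rewrite cancel_of_to.
      * exists (to_nat (1%nat, n)). rewrite cancel_of_to. simpl. auto.
    + intros [m Hm]. destruct (fst (of_nat m)); [|tauto]. apply HOA, HOF. eauto.
Qed.

(** By category, countably many points cannot cover the middle third of [v,w]. *)
Lemma dense01_misses v w : 0 <= v -> v < w -> w <= 1 ->
  exists l : I01, v < proj1_sig l < w /\ forall n, l <> dense01 n.
Proof.
  intros Hv Hvw Hw. apply NNPP. intros Hno.
  set (a := (2 * v + w) / 3). set (b := (v + 2 * w) / 3).
  assert (v < a /\ a < b /\ b < w) as [Ha [Hab Hb]] by (unfold a, b; lra).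
  assert (Ha01 : 0 <= a <= 1) by lra.
  destruct (Baire_category I01_metric (fun x => a <= proj1_sig x <= b)
    (fun n x => x = dense01 n)) as [n [x [r [Hr [Kx H]]]]].
  - exact I01_complete.
  - intros x Hx.
    assert (exists e, 0 < e /\ (proj1_sig x + e <= a \/ b + e <= proj1_sig x)) as [e [He H]].
    { destruct (Rlt_le_dec (proj1_sig x) a).
      - exists (a - proj1_sig x). lra.
      - exists (proj1_sig x - b). lra. }
    exists e. split; auto. intros y Hy Hy'. apply Rabs_def2 in Hy. lra.
  - exists (exist _ a Ha01). simpl. lra.
  - intros n x Hx. exists (I01_dist x (dense01 n)). split.
    + destruct (metric_ge0 I01_metric x (dense01 n)) as [H|H]; auto.
      destruct Hx. now apply (metric_eq0 I01_metric).
    + intros y Hy ->. lra.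
  - intros x Hx. apply NNPP. intros Hn. apply Hno. exists x. split; [lra|].
    intros n E. apply Hn. eauto.
  - assert (exists y, a <= y <= b /\ y <> proj1_sig x /\ Rabs (proj1_sig x - y) < r) as [y [Hy [Hne Hd]]].
    { destruct (Rlt_le_dec (proj1_sig x) b).
      - exists (proj1_sig x + Rmin (b - proj1_sig x) (r/2)).
        assert (0 < Rmin (b - proj1_sig x) (r/2)) by (apply Rmin_pos; lra).
        pose proof (Rmin_l (b - proj1_sig x) (r/2)). pose proof (Rmin_r (b - proj1_sig x) (r/2)).
        split; [lra|]. split; [lra|]. apply Rabs_def1; lra.
      - exists (proj1_sig x - Rmin (b - a) (r/2)).
        assert (0 < Rmin (b - a) (r/2)) by (apply Rmin_pos; lra).
        pose proof (Rmin_l (b - a) (r/2)). pose proof (Rmin_r (b - a) (r/2)).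
        split; [lra|]. split; [lra|]. apply Rabs_def1; lra. }
    assert (Hy01 : 0 <= y <= 1) by lra.
    apply Hne. change y with (proj1_sig (exist (fun x => 0 <= x <= 1) y Hy01)). f_equal.
    transitivity (dense01 n); [apply H; auto|symmetry; apply H; auto].
    rewrite (metric_refl I01_metric). auto.
Qed.

(** * Consequences for Y when every H_1 map on [0,1] is in B_1 *)

Section Necessity.
Context {Y : TopSpace} {d : Y -> Y -> R} (M : metric d)
  (HO : forall U : Y -> Prop, is_open U <-> metric_open d U)
  (H1B : forall f : I01 -> Y, Hclass1 f -> Baire1 f).

Lemma segment_path (g : I01 -> Y) (a b : I01) : mcont d g ->
  exists p, mcontinuous Rd d p /\ p 0 = g a /\ p 1 = g b /\
    forall t, exists x : I01, p t = g x /\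
      Rmin (proj1_sig a) (proj1_sig b) <= proj1_sig x <= Rmax (proj1_sig a) (proj1_sig b).
Proof.
  intros Hg. set (k := proj1_sig b - proj1_sig a).
  pose proof (proj2_sig a). pose proof (proj2_sig b). simpl in *.
  assert (Hx : forall t, Rmin (proj1_sig a) (proj1_sig b) <= k * clamp t + proj1_sig a
                <= Rmax (proj1_sig a) (proj1_sig b)).
  { intros t. pose proof (clamp_bounds t). unfold k, Rmin, Rmax. destruct Rle_dec; nra. }
  assert (Hx01 : forall t, 0 <= k * clamp t + proj1_sig a <= 1).
  { intros t. specialize (Hx t). unfold Rmin, Rmax in Hx. destruct Rle_dec; lra. }
  assert (Hend : forall t c, k * clamp t + proj1_sig a = proj1_sig c ->
                   clampI (k * clamp t + proj1_sig a) = c).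
  { intros t c E. apply (metric_eq0 I01_metric). unfold I01_dist. simpl.
    rewrite clamp_id by auto. rewrite E, Rminus_diag. apply Rabs_R0. }
  exists (fun t => g (clampI (k * clamp t + proj1_sig a))). split; [|split; [|split]].
  - apply (mcontinuous_comp (dB := I01_dist) (fun t => clampI (k * clamp t + proj1_sig a)) g).
    + apply (mcontinuous_comp (dB := Rd) (fun t => k * clamp t + proj1_sig a) clampI);
        [|exact clampI_continuous].
      exact (mcontinuous_comp _ _ clamp_continuous (affine_continuous k (proj1_sig a))).
    + now apply I01_mcont.
  - f_equal. apply Hend. rewrite clamp_id by lra. ring.
  - f_equal. apply Hend. rewrite clamp_id by lra. unfold k. ring.
  - intros t. exists (clampI (k * clamp t + proj1_sig a)). split; auto. simpl.
    rewrite clamp_id; auto.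
Qed.

(** The map with value [a] at 0 and [b] elsewhere is in H_1. A late approximant sends 0 into [U] and
    1 into [V], and its path contradicts the separation. *)
Lemma Hclass1_Baire1_connected : connected Y.
Proof.
  intros [U [V [oU [oV [[a Ua] [[b Vb] [Hc Hd]]]]]]].
  destruct (H1B (fun x => if excluded_middle_informative (x = I01_zero) then a else b))
    as [fn [Hfn Hl]].
  - intros W oW.
    apply F_sigma01_open_countable with (fun x => x <> I01_zero /\ W b) (fun _ => I01_zero).
    + apply (open_inter I01 (fun x => x <> I01_zero) (fun _ => W b)); [|apply open_const].
      intros x Hx. exists (I01_dist x I01_zero). split.
      * destruct (metric_ge0 I01_metric x I01_zero) as [H|H]; auto.
        destruct Hx. now apply (metric_eq0 I01_metric).
      * intros y Hy ->. lra.
    + intros x [Hx Wb]. destruct excluded_middle_informative; tauto.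
    + intros x. destruct excluded_middle_informative as [->|]; [right; exists 0%nat|left]; auto.
  - destruct (Hl I01_zero U oU) as [N HN]; [destruct excluded_middle_informative; tauto|].
    destruct (Hl I01_one V oV) as [N' HN'].
    { destruct excluded_middle_informative as [E|]; auto.
      apply (f_equal (@proj1_sig _ _)) in E. simpl in E. lra. }
    specialize (HN (Nat.max N N') ltac:(lia)). specialize (HN' (Nat.max N N') ltac:(lia)).
    destruct (segment_path (fn (Nat.max N N')) I01_zero I01_one) as [p [Hp [p0 [p1 _]]]].
    { apply (continuous_mcont (dY := d) _ M HO). apply Hfn. }
    apply HO in oU, oV. apply (path_clopen p U V Hp oU oV Hc Hd); congruence.
Qed.

(* Otherwise, with [y n] converging to [c] and not almost joined to [c] inside the
   [e]-ball around [c], the function taking the value [y n] at the [n]-th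
   rational and [c] at the irrationals would be in H_1 but not in B_1. *)
Lemma Hclass1_Baire1_near_paths : @near_paths _ d.
Proof.
  intros c e He. apply NNPP. intros Hno.
  (* The bound [/ (INR n + 1)] makes the bad points converge to [c]; [e / 2] leaves room inside the
     [e]-ball in which joining paths must stay. *)
  assert (Hbad : forall n : nat, exists q : Y * R, d c (fst q) < Rmin (/ (INR n + 1)) (e / 2) /\
    0 < snd q /\ ~ exists p, mcontinuous Rd d p /\ (forall t, d c (p t) < e) /\
       d c (p 0) < snd q /\ d (fst q) (p 1) < snd q).
  { intros n. apply NNPP. intros Hn. apply Hno. exists (Rmin (/ (INR n + 1)) (e / 2)). split.
    - apply Rmin_pos; [apply Rinv_0_lt_compat; pose proof (pos_INR n)|]; lra.
    - intros z Hz eta Heta. apply NNPP. intros Hp. apply Hn. exists (z, eta). auto. }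
  apply choice in Hbad. destruct Hbad as [q Hq].
  (* [dense01] repeats values, so the value at a point of its range is tied to the first index. *)
  assert (Hf : forall x : I01, exists v,
    (exists n, x = dense01 n /\ (forall m, (m < n)%nat -> x <> dense01 m) /\ v = fst (q n)) \/
    ((forall n, x <> dense01 n) /\ v = c)).
  { intros x. destruct (classic (exists n, x = dense01 n /\
      forall m, (m < n)%nat -> x <> dense01 m)) as [[n [H1 H2]]|Hn].
    - exists (fst (q n)). left. exists n. auto.
    - exists c. right. split; auto.
      assert (H : forall n m, (m < n)%nat -> x <> dense01 m).
      { induction n as [|n IH]; intros m Hm E; [lia|]. apply Hn. exists m. split; auto.
        intros k Hk. apply IH. lia. }
      intros n. apply (H (S n)). lia. }
  apply choice in Hf. destruct Hf as [f Hf].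
  destruct (H1B f) as [fn [Hfn Hl]].
  - intros V oV. pose proof (proj1 (HO V) oV) as oV'. destruct (classic (V c)) as [Vc|Vc].
    (* If [V] contains [c], the preimage contains all but finitely many points; otherwise it lies
       inside the countable range of [dense01]. Either way it is an F_sigma set. *)
    + destruct (oV' c Vc) as [r [Hr HV]]. destruct (inv_INR_small r Hr) as [N HN].
      apply F_sigma01_open_countable with
        (fun x => forall n, (n < N)%nat -> x <> dense01 n) dense01.
      * apply open_of_nbhds. intros x Hx.
        destruct (nbhd_forall_lt x (fun n W => forall y, W y -> y <> dense01 n) N)
          as [W [oW [Wx HW]]].
        -- intros n W W' HWW H y Wy. auto.
        -- intros n Hn. exists (fun y => I01_dist x y < I01_dist x (dense01 n)).
           split; [exact (ball_open I01_metric x _)|]. split.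
           ++ rewrite (metric_refl I01_metric).
              destruct (metric_ge0 I01_metric x (dense01 n)) as [H|H]; auto.
              destruct (Hx n Hn). now apply (metric_eq0 I01_metric).
           ++ intros y Hy ->. lra.
        -- exists W. split; [exact oW|]. split; [exact Wx|]. intros y Wy n Hn. exact (HW n Hn y Wy).
      * intros x Hx. destruct (Hf x) as [[n [H1 [_ ->]]]|[_ ->]]; auto. apply HV.
        destruct (Nat.lt_ge_cases n N) as [H|H]; [destruct (Hx n H H1)|].
        specialize (HN n H). destruct (Hq n) as [H3 _].
        pose proof (Rmin_l (/ (INR n + 1)) (e / 2)). lra.
      * intros x _. destruct (classic (exists n, x = dense01 n)) as [H|H]; auto.
        left. intros n _ E. eauto.
    + apply F_sigma01_open_countable with (fun _ => False) dense01.
      * apply open_const.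
      * tauto.
      * intros x Vx. destruct (Hf x) as [[n [H1 _]]|[_ H]]; [eauto|congruence].
  - assert (Hc : forall n, mcont d (fn n)).
    { intros n. apply (continuous_mcont (dY := d) _ M HO). apply Hfn. }
    assert (Hlim : forall x r, 0 < r -> exists N, forall n, (N <= n)%nat -> d (f x) (fn n x) < r).
    { intros x r Hr. apply (Hl x (fun y => d (f x) y < r)).
      - apply HO. exact (ball_open M _ r).
      - rewrite (metric_refl M). auto. }
    assert (Hfc : forall x, d c (f x) < e / 2).
    { intros x. destruct (Hf x) as [[n [_ [_ ->]]]|[_ ->]]; [|rewrite (metric_refl M); lra].
      destruct (Hq n) as [H _]. pose proof (Rmin_r (/ (INR n + 1)) (e / 2)). lra. }
    (* [f] stays strictly within [e / 2] of [c], so by category all late [fn k] stay within [e / 2]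
       on a common interval. *)
    destruct (Baire_category I01_metric (fun _ => True)
      (fun N x => forall k, (N <= k)%nat -> d c (fn k x) <= e / 2)) as [N [x0 [r [Hr [_ HN]]]]].
    + exact I01_complete.
    + intros x Hx. tauto.
    + exists I01_zero. auto.
    + intros N x Hx. apply not_all_ex_not in Hx. destruct Hx as [k Hx].
      apply imply_to_and in Hx. destruct Hx as [Hk Hx]. apply Rnot_le_lt in Hx.
      destruct (proj1 (I01_mcont (fn k)) (Hc k) x (d c (fn k x) - e/2)) as [s [Hs H]]; [lra|].
      exists s. split; auto. intros y Hy Hall. specialize (Hall k Hk). specialize (H y Hy).
      pose proof (metric_tri M c (fn k y) (fn k x)).
      rewrite (metric_sym M (fn k y) (fn k x)) in *. lra.
    + intros x _. destruct (Hlim x (e / 2 - d c (f x))) as [N HN]; [specialize (Hfc x); lra|].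
      exists N. intros k Hk. specialize (HN k Hk). pose proof (metric_tri M c (f x) (fn k x)). lra.
    + pose proof (proj2_sig x0) as Hx0. simpl in Hx0.
      (* Inside that interval a late approximant carries the segment from a point [x2] off the range
         of [dense01] to a point [x1] in it onto a path that [Hq] forbids. *)
      set (v := Rmax 0 (proj1_sig x0 - r)). set (w := Rmin 1 (proj1_sig x0 + r)).
      assert (0 <= v /\ v < w /\ w <= 1 /\ proj1_sig x0 - r <= v /\ w <= proj1_sig x0 + r)
        as [Hv [Hvw [Hw [Hv' Hw']]]].
      { unfold v, w, Rmax, Rmin. repeat destruct Rle_dec; lra. }
      assert (Hvw01 : 0 <= (v + w) / 2 <= 1) by lra.
      destruct (dense01_dense (exist _ _ Hvw01) ((w - v) / 2)) as [n Hn]; [lra|].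
      set (x1 := dense01 n) in *.
      assert (Hx1 : v < proj1_sig x1 < w).
      { change (Rabs (proj1_sig x1 - (v + w) / 2) < (w - v) / 2) in Hn.
        apply Rabs_def2 in Hn. lra. }
      destruct (dense01_misses v w Hv Hvw Hw) as [x2 [Hx2 Hmiss]].
      assert (f x2 = c) as E2 by (destruct (Hf x2) as [[m [H _]]|[_ H]]; [destruct (Hmiss m H)|auto]).
      assert (exists m, f x1 = fst (q m)) as [m E1].
      { destruct (Hf x1) as [[m [_ [_ H]]]|[H _]]; [eauto|destruct (H n eq_refl)]. }
      destruct (Hq m) as [_ [Heta Hnp]]. apply Hnp.
      destruct (Hlim x1 _ Heta) as [N1 HN1]. destruct (Hlim x2 _ Heta) as [N2 HN2].
      set (k := Nat.max N (Nat.max N1 N2)).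
      destruct (segment_path (fn k) x2 x1 (Hc k)) as [p [Hp [p0 [p1 pin]]]].
      exists p. split; auto. split; [|split].
      * intros t. destruct (pin t) as [x [-> Hx]].
        assert (d c (fn k x) <= e / 2); [|lra]. apply HN; [exact I| |unfold k; lia].
        unfold I01_dist. unfold Rmin, Rmax in Hx.
        apply Rabs_def1; destruct Rle_dec; lra.
      * rewrite p0, <- E2. apply HN2. unfold k; lia.
      * rewrite p1, <- E1. apply HN1. unfold k; lia.
Qed.
End Necessity.

Theorem mainTheorem14 (Y : TopSpace) (HY : completely_metrizable Y) :
  ((connected Y /\ locally_arcwise_connected Y) <->
     (forall (X : TopSpace) (f : X -> Y), (Kclass1 f /\ Sigma_f f) <-> Baire1 f)) /\
  ((forall (X : TopSpace) (f : X -> Y), (Kclass1 f /\ Sigma_f f) <-> Baire1 f) <->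
     (forall f : I01 -> Y, Hclass1 f <-> Baire1 f)).
Proof.
  destruct HY as [d [H1 [H2 [H3 [H4 [HO HC]]]]]].
  assert (M : metric d).
  { split; auto; [intros x y; apply H2|intros x; now apply H2]. }
  assert (i_ii : connected Y /\ locally_arcwise_connected Y ->
    forall (X : TopSpace) (f : X -> Y), (Kclass1 f /\ Sigma_f f) <-> Baire1 f).
  { intros [Hc Hl] X f. split.
    - intros [HK HS]. now apply (Kclass1_Sigma_f_Baire1 M HO).
    - intros Hf. split; [now apply (Baire1_Kclass1 M HO)|now apply (Baire1_Sigma_f M HO)]. }
  assert (ii_iii :
    (forall (X : TopSpace) (f : X -> Y), (Kclass1 f /\ Sigma_f f) <-> Baire1 f) ->
    forall f : I01 -> Y, Hclass1 f <-> Baire1 f).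
  { intros H f. rewrite <- H. split.
    - intros Hf. split; [now apply Hclass1_Kclass1|now apply (Hclass1_Sigma_f M HO)].
    - intros [HK _]. now apply Hclass1_Kclass1. }
  assert (iii_i : (forall f : I01 -> Y, Hclass1 f <-> Baire1 f) ->
    connected Y /\ locally_arcwise_connected Y).
  { intros H. assert (H' : forall f : I01 -> Y, Hclass1 f -> Baire1 f) by (intros f; apply H).
    split; [exact (Hclass1_Baire1_connected M HO H')|].
    apply (locally_path_connected_arcwise M HO). apply (near_paths_joined M HC).
    exact (Hclass1_Baire1_near_paths M HO H'). }
  tauto.
Qed.
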